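(* Let $1<\alpha<2$, let $m\ge 0$ be an integer, let $\alpha>\alpha_1>\dots>\alpha_m>0$ with $\alpha-\alpha_m\le 1$, and let $c>0$, $c_j>0$ for $j=1,\dots,m$. Let $A$ be a closed, densely defined linear operator in a Banach space $X$ which generates a bounded cosine family in $X$. Then the solution operator $S(t)$ of the problem $$cD_t^{\alpha}u(t)+\sum_{j=1}^m c_j D_t^{\alpha_j}u(t)=Au(t),\ t>0;\qquad u(0)=v\in X,\ u_t(0)=0,$$ admits an analytic extension to the sector $\Sigma(\theta_0)$, where $$\theta_0=\frac{(2-\alpha)\pi}{2\alpha}-\varepsilon$$ and $\varepsilon>0$ is arbitrarily small.
   Context: If $m=0$, the sums over $j$ are empty and the conditions on the $\alpha_j$ and $c_j$ are void. For $\theta\in(0,\pi)$, $\Sigma(\theta)=\{z\in\mathbb{C}\setminus\{0\}:\ |\arg z|<\theta\}$. ''Arbitrarily small'' means that the assertion holds for every $\varepsilon>0$ small enough that $\theta_0>0$. $D_t^\beta$ is the Caputo derivative of order $\beta>0$ in time. Put $g(s)=c s^{\alpha}+\sum_{j=1}^m c_j s^{\alpha_j}$. Cosine family: the cosine family $S_2(t)$ generated by $A$ is the strongly continuous solution operator of $u''(t)=Au(t)$, $u(0)=v$, $u'(0)=0$; its Laplace transform is $s(s^2-A)^{-1}$. Bounded means $\sup_{t\ge0}\|S_2(t)\|<\infty$. Solution operator: let $k$ be the locally integrable function with Laplace transform $\widehat k(s)=1/g(s)$. The multi-term problem is rewritten as the Volterra equation $u(t)=v+\int_0^t k(t-\tau)Au(\tau)\,\mathrm{d}\tau$,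 and its solution operator is the resolvent of this equation: a strongly continuous family $S(t)$, $t\ge 0$, of bounded linear operators on $X$ with $S(0)=I$, $S(t)D(A)\subset D(A)$, $AS(t)v=S(t)Av$ and $S(t)v=v+\int_0^t k(t-\tau)AS(\tau)v\,\mathrm{d}\tau$ for all $v\in D(A)$, $t\ge0$. Its Laplace transform is $\frac{g(s)}{s}(g(s)-A)^{-1}$. *)

(* Defs.v *)
From HB Require Import structures.
From mathcomp Require Import all_boot all_order all_algebra.
From mathcomp Require Import all_classical all_reals all_analysis.
From mathcomp Require Import complex.

Set Implicit Arguments.
Unset Strict Implicit.
Unset Printing Implicit Defensive.

Import numFieldNormedType.Exports.
Import Order.TTheory GRing.Theory Num.Theory.
Local Open Scope classical_set_scope.
Local Open Scope complex_scope.
Local Open Scope ring_scope.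

(* The norm of a space over R[i] takes its values in R[i], where they are real
   and nonnegative; [rnorm x] is the same number in R. *)
Definition rnorm (R : realType) (V : normedModType R[i]) (x : V) : R :=
  complex.Re `|x|.

Definition cmod (R : realType) (z : R[i]) : R := complex.Re `|z|.

(* Principal argument, with values in (-pi, pi] for z != 0. *)
Definition carg (R : realType) (z : R[i]) : R :=
  if 0 <= complex.Im z then acos (complex.Re z / cmod z)
  else - acos (complex.Re z / cmod z).

Definition sector (R : realType) (theta : R) : set R[i] :=
  [set z | z != 0 /\ `|carg z| < theta].

Definition cexp (R : realType) (z : R[i]) : R[i] :=
  (expR (complex.Re z))%:C * (cos (complex.Im z) +i* sin (complex.Im z)).

(* Principal branch of z ^ a, for a real exponent a. *)
Definition cpow (R : realType) (z : R[i]) (a : R) : R[i] :=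
  (cmod z `^ a)%:C * (cos (a * carg z) +i* sin (a * carg z)).

(* Bochner integral with respect to Lebesgue measure; a simple function may be
   given by overlapping pieces. *)
Record simple_fun (R : realType) (V : normedModType R[i]) := SimpleFun {
  sf_card : nat;
  sf_piece : 'I_sf_card -> set R;
  sf_value : 'I_sf_card -> V;
  sf_measurable : forall i, measurable (sf_piece i);
  sf_finite : forall i, (lebesgue_measure (sf_piece i) < +oo)%E }.

Definition sf_eval (R : realType) (V : normedModType R[i])
    (s : simple_fun V) (t : R) : V :=
  \sum_(i < sf_card s) (\1_(sf_piece i) t)%:C *: sf_value i.

Definition sf_integral (R : realType) (V : normedModType R[i])
    (D : set R) (s : simple_fun V) : V :=
  \sum_(i < sf_card s)
    (fine (lebesgue_measure (D `&` sf_piece i)))%:C *: sf_value i.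

Definition is_bochner_integral (R : realType) (V : normedModType R[i])
    (D : set R) (f : R -> V) (w : V) : Prop :=
  exists s : nat -> simple_fun V,
    [/\ forall n, measurable_fun D (fun t => rnorm (f t - sf_eval (s n) t)),
        (\int[lebesgue_measure]_(t in D) (rnorm (f t - sf_eval (s n) t))%:E)%E
          @[n --> \oo] --> 0%E
      & sf_integral D (s n) @[n --> \oo] --> w].

Definition locally_integrable_Rplus (R : realType) (k : R -> R) : Prop :=
  forall T : R, (@lebesgue_measure R).-integrable `[0, T] (EFin \o k).

Definition is_laplace (R : realType) (k : R -> R) (s w : R[i]) : Prop :=
  @is_bochner_integral R R[i]^o `[0, +oo[
    (fun t => (k t)%:C * cexp (- (s * t%:C))) w.

(* A linear operator defined on a subspace [opdom] of X; the values of [opval]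
   off [opdom] carry no meaning. *)
Record unbounded_operator (R : realType) (X : normedModType R[i]) :=
  UnboundedOperator {
  opdom : set X;
  opval :> X -> X;
  opdom0 : opdom 0;
  opdom_linear : forall (a : R[i]) (x y : X),
    opdom x -> opdom y -> opdom (a *: x + y);
  opval_linear : forall (a : R[i]) (x y : X),
    opdom x -> opdom y -> opval (a *: x + y) = a *: opval x + opval y }.

Definition closed_operator (R : realType) (X : normedModType R[i])
    (A : unbounded_operator X) : Prop :=
  closed [set p : X * X | opdom A p.1 /\ p.2 = A p.1].

Definition densely_defined (R : realType) (X : normedModType R[i])
    (A : unbounded_operator X) : Prop :=
  dense (opdom A).

(* Only the values S t with t >= 0 matter. *)
Record strongly_continuous_family (R : realType) (X : normedModType R[i])
    (S : R -> {linear X -> X}) : Prop := StronglyContinuousFamily {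
  scf_bounded : forall t, 0 <= t -> continuous (S t);
  scf_continuous : forall v : X, {within `[0, +oo[, continuous (fun t => S t v)} }.

Record commuting_family (R : realType) (X : normedModType R[i])
    (A : unbounded_operator X) (S : R -> {linear X -> X}) : Prop :=
  CommutingFamily {
  cf_dom : forall t v, 0 <= t -> opdom A v -> opdom A (S t v);
  cf_comm : forall t v, 0 <= t -> opdom A v -> A (S t v) = S t (A v) }.

(* Derivative of u : [0, +oo) -> X at t >= 0, one-sided at t = 0. *)
Definition is_rderive (R : realType) (X : normedModType R[i])
    (u : R -> X) (t : R) (w : X) : Prop :=
  (fun h : R => (h^-1)%:C *: (u (t + h) - u t))
    @ within [set h | 0 <= t + h] 0^' --> w.

Record cosine_family (R : realType) (X : normedModType R[i])
    (A : unbounded_operator X) (S : R -> {linear X -> X}) : Prop :=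
  CosineFamily {
  cos_scf : strongly_continuous_family S;
  cos_0 : forall v, S 0 v = v;
  cos_comm : commuting_family A S;
  cos_ode : forall v, opdom A v -> exists u' : R -> X,
    [/\ u' 0 = 0,
        forall t, 0 <= t -> is_rderive (fun r => S r v) t (u' t)
      & forall t, 0 <= t -> is_rderive u' t (A (S t v))] }.

Definition bounded_family (R : realType) (X : normedModType R[i])
    (S : R -> {linear X -> X}) : Prop :=
  exists M : R, forall t v, 0 <= t -> rnorm (S t v) <= M * rnorm v.

Definition generates_bounded_cosine_family (R : realType)
    (X : normedModType R[i]) (A : unbounded_operator X) : Prop :=
  exists S : R -> {linear X -> X}, cosine_family A S /\ bounded_family S.

(* g(s) = c s^alpha + \sum_j c_j s^(alpha_j) *)
Definition symbol (R : realType) (m : nat) (c alpha : R)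
    (cs alphas : 'I_m -> R) (s : R[i]) : R[i] :=
  c%:C * cpow s alpha + \sum_(j < m) (cs j)%:C * cpow s (alphas j).

Definition is_kernel (R : realType) (g : R[i] -> R[i]) (k : R -> R) : Prop :=
  locally_integrable_Rplus k /\
  forall s : R[i], 0 < complex.Re s -> is_laplace k s (g s)^-1.

(* Resolvent of the Volterra equation u = v + k * A u; when k has Laplace
   transform 1 / g this is the solution operator of the multi-term equation
   with symbol g and initial data u(0) = v, u_t(0) = 0. *)
Record solution_operator (R : realType) (X : normedModType R[i])
    (A : unbounded_operator X) (k : R -> R) (S : R -> {linear X -> X}) : Prop :=
  SolutionOperator {
  so_scf : strongly_continuous_family S;
  so_0 : forall v, S 0 v = v;
  so_comm : commuting_family A S;
  so_volterra : forall t v, 0 <= t -> opdom A v ->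
    is_bochner_integral `[0, t]
      (fun tau => (k (t - tau))%:C *: A (S tau v)) (S t v - v) }.

(* Complex derivative at z of an operator-valued function, in operator norm. *)
Definition is_op_derive (R : realType) (X : normedModType R[i])
    (F : R[i] -> {linear X -> X}) (z : R[i]) (G : {linear X -> X}) : Prop :=
  forall e : R, 0 < e -> exists2 d : R, 0 < d &
    forall h : R[i], h != 0 -> cmod h < d ->
    forall v : X,
      rnorm (h^-1 *: (F (z + h) v - F z v) - G v) <= e * rnorm v.

Definition analytic_on (R : realType) (X : normedModType R[i])
    (U : set R[i]) (F : R[i] -> {linear X -> X}) : Prop :=
  forall z, U z -> continuous (F z) /\
    exists2 G : {linear X -> X}, continuous G & is_op_derive F z G.

Definition admits_analytic_extension (R : realType) (X : normedModType R[i])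
    (S : R -> {linear X -> X}) (U : set R[i]) : Prop :=
  exists2 F : R[i] -> {linear X -> X}, analytic_on U F &
    forall t v, 0 < t -> F t%:C v = S t v.

(* Main.v *)
Require Import Defs.
From HB Require Import structures.
From mathcomp Require Import all_boot all_order all_algebra.
From mathcomp Require Import all_classical all_reals all_analysis.
From mathcomp Require Import measurable_realfun complex ring lra.
Import numFieldNormedType.Exports.
Import Order.TTheory GRing.Theory Num.Theory.
Local Open Scope classical_set_scope.
Local Open Scope complex_scope.
Local Open Scope ring_scope.
Set Implicit Arguments.
Unset Strict Implicit.
Unset Printing Implicit Defensive.

(** The analytic extension is an inverse Laplace integral over two rays that leave
the right half-plane, identified with S on the positive axis by comparing forward
Laplace transforms.

Where the angle comes from. The Laplace transform of S at s is
g(s)/s (g(s) - A)^-1. Write lam = sqrt (g(s)) and let L(lam) be the Laplace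
transform of the cosine family; then L(lam) = lam (lam^2 - A)^-1, so that the
transform of S is (lam/s) L(lam). All exponents of g lie in [0, alpha], hence g
multiplies arguments by at most alpha ([gsym_arg]): for om' with alpha om' < pi,
lam lies in a sector strictly inside the right half-plane as long as
|arg s| < om' ([gsqrt_Re_ge]). Boundedness of the cosine family then gives
|L(lam)| <= M / Re lam, and (lam/s) L(lam) is holomorphic and O(1/|s|) on that
sector ([transfer_C1], [transfer_bound]). The integral of e^(z s) (lam/s) L(lam)
over the rays s = 1 + r e^(i om), s = 1 + r e^(- i om) with
om = pi/2 + theta_0 = pi/alpha - eps converges when z e^(i om) and z e^(- i om)
have negative real part, that is for z in the sector of half-angle theta_0, and it
may be differentiated under the integral sign ([laplace_op_derive],
[contour_analytic], [sector_halfplane]).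

Why the integral is S on the positive axis. Since nothing is known about the growth
of S, its Laplace transform is truncated to [0, T] and taken at large real s only,
where lam is real. For v in the domain of A, applying L(lam) to the Volterra
equation turns A into lam^2 ([cosine_resolvent]), and the convolution theorem for
truncated transforms ([volterra_laplace]) shows that the transform of S(t) v is
(lam/s) L(lam) v up to O(s^2 e^(-s T)) ([solution_laplace]). The contour integral
has the same truncated transform up to O(e^(-s T)): by Fubini's theorem this is
Cauchy's formula for the rays ([ray_inversion_laplace], [ray_cauchy_formula]). A
continuous function whose truncated transform is O(s^2 e^(-s T)) vanishes on ]0, T[
([laplace_uniqueness]); density of the domain of A gives all v
([contour_solution]).

How the analysis is carried out. Vector-valued integrals are weak: they are defined
by testing against bounded real-linear functionals, which separate points by the
Hahn-Banach theorem ([hahn_banach]), so that every computation is one about real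
Lebesgue integrals. The two rays are conjugate to each other; [pairing] encodes the
pair of vectors attached to lam and its conjugate as one complex number depending
holomorphically on lam, and Cauchy's formula becomes a statement on a scalar
holomorphic function that is real on the real axis. It is proved by rotating the
ray towards the axis: by the Cauchy-Riemann equation in polar coordinates, the
derivative in the angle of the integral over a segment of the ray is a boundary
term, which tends to zero as the segment grows ([ray_rotation]); in the limit of
angle zero the integrand is a Poisson kernel whose mass is explicit. *)

(** * Modulus and real-valued norms *)

Section modulus.
Variable R : realType.
Implicit Types (z w : R[i]) (x y : R).

Lemma cmodE z : cmod z = Num.sqrt (complex.Re z ^+ 2 + complex.Im z ^+ 2).
Proof. by rewrite /cmod normc_def. Qed.

Lemma normc_cmod z : `|z| = (cmod z)%:C.
Proof. by rewrite cmodE normc_def. Qed.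

Lemma cmod_ge0 z : 0 <= cmod z.
Proof. by rewrite cmodE sqrtr_ge0. Qed.

Lemma cmodM z w : cmod (z * w) = cmod z * cmod w.
Proof.
by apply: (@complexI R); rewrite rmorphM /= -!normc_cmod normrM.
Qed.

Lemma cmodD z w : cmod (z + w) <= cmod z + cmod w.
Proof. by rewrite -lecR rmorphD /= -!normc_cmod ler_normD. Qed.

Lemma cmodN z : cmod (- z) = cmod z.
Proof. by rewrite /cmod normrN. Qed.

Lemma cmodB z w : cmod (z - w) <= cmod z + cmod w.
Proof. by rewrite (le_trans (cmodD _ _))// cmodN. Qed.

Lemma cmodV z : cmod z^-1 = (cmod z)^-1.
Proof. by apply: (@complexI R); rewrite -normc_cmod fmorphV /= normfV normc_cmod. Qed.

Lemma cmod_real x : cmod x%:C = `|x|.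
Proof. by rewrite cmodE /= expr0n /= addr0 sqrtr_sqr. Qed.

Lemma cmod0 : cmod (0 : R[i]) = 0.
Proof. by rewrite /cmod normr0. Qed.

Lemma cmod1 : cmod (1 : R[i]) = 1.
Proof. by rewrite /cmod normr1. Qed.

Lemma cmodJ z : cmod z^* = cmod z.
Proof. by rewrite /cmod normcJ. Qed.

Lemma cmod_eq0 z : (cmod z == 0) = (z == 0).
Proof. by rewrite -(inj_eq (@complexI R)) -normc_cmod normr_eq0. Qed.

Lemma cmod_gt0 z : (0 < cmod z) = (z != 0).
Proof. by rewrite lt_def cmod_ge0 andbT cmod_eq0. Qed.

Lemma sqr_cmod z : cmod z ^+ 2 = complex.Re z ^+ 2 + complex.Im z ^+ 2.
Proof. by rewrite cmodE sqr_sqrtr// addr_ge0 ?sqr_ge0. Qed.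

Lemma Re_le_cmod z : `|complex.Re z| <= cmod z.
Proof. by rewrite cmodE -sqrtr_sqr ler_wsqrtr// lerDl sqr_ge0. Qed.

Lemma Im_le_cmod z : `|complex.Im z| <= cmod z.
Proof. by rewrite cmodE -sqrtr_sqr ler_wsqrtr// lerDr sqr_ge0. Qed.

Lemma cmod_le_ReIm z : cmod z <= `|complex.Re z| + `|complex.Im z|.
Proof.
rewrite cmodE -[leRHS]ger0_norm ?addr_ge0// -sqrtr_sqr ler_wsqrtr//.
by rewrite sqrrD !real_normK ?num_real// lerD2r lerDl mulrn_wge0 ?mulr_ge0.
Qed.

Lemma cReD z w : complex.Re (z + w) = complex.Re z + complex.Re w.
Proof. by case: z; case: w. Qed.
Lemma cImD z w : complex.Im (z + w) = complex.Im z + complex.Im w.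
Proof. by case: z; case: w. Qed.
Lemma cReN z : complex.Re (- z) = - complex.Re z.
Proof. by case: z. Qed.
Lemma cImN z : complex.Im (- z) = - complex.Im z.
Proof. by case: z. Qed.
Lemma cReM z w : complex.Re (z * w) =
  complex.Re z * complex.Re w - complex.Im z * complex.Im w.
Proof. by case: z; case: w. Qed.
Lemma cImM z w : complex.Im (z * w) =
  complex.Re z * complex.Im w + complex.Im z * complex.Re w.
Proof. by case: z; case: w. Qed.
Lemma cReJ z : complex.Re z^* = complex.Re z.
Proof. by case: z. Qed.
Lemma cImJ z : complex.Im z^* = - complex.Im z.
Proof. by case: z. Qed.

Lemma complex_eq z w : complex.Re z = complex.Re w ->
  complex.Im z = complex.Im w -> z = w.
Proof. by case: z; case: w => /= ? ? ? ? -> ->. Qed.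

(** The modulus is attained as a real part after a rotation. *)
Lemma cmod_rotation z : exists c : R[i], cmod c = 1 /\ complex.Re (c * z) = cmod z.
Proof.
have [->|z0] := eqVneq z 0; first by exists 1; rewrite cmod1 mul1r cmod0.
have cz0 : cmod z != 0 by rewrite cmod_eq0.
exists (z^* / (cmod z)%:C); split.
  by rewrite cmodM cmodJ cmodV cmod_real ger0_norm ?cmod_ge0// divff.
have -> : z^* / (cmod z)%:C * z = (cmod z)%:C; last by [].
rewrite mulrAC [z^* * z]mulrC -sqr_normc normc_cmod.
by rewrite expr2 mulfK// (inj_eq (@complexI R)).
Qed.

End modulus.

Section rnorm.
Variables (R : realType) (X : normedModType R[i]).
Implicit Types (x y : X).

Lemma norm_rnorm x : `|x| = (rnorm x)%:C.
Proof. by rewrite /rnorm RRe_real// normr_real. Qed.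

Lemma rnorm_ge0 x : 0 <= rnorm x.
Proof. by rewrite -lecR -norm_rnorm normr_ge0. Qed.

Lemma rnormD x y : rnorm (x + y) <= rnorm x + rnorm y.
Proof. by rewrite -lecR rmorphD /= -!norm_rnorm ler_normD. Qed.

Lemma rnormN x : rnorm (- x) = rnorm x.
Proof. by rewrite /rnorm normrN. Qed.

Lemma rnormB x y : rnorm (x - y) <= rnorm x + rnorm y.
Proof. by rewrite (le_trans (rnormD _ _))// rnormN. Qed.

Lemma rnormC x y : rnorm (x - y) = rnorm (y - x).
Proof. by rewrite -rnormN opprB. Qed.

Lemma rnormZ (a : R[i]) x : rnorm (a *: x) = cmod a * rnorm x.
Proof.
by apply: (@complexI R); rewrite rmorphM /= -norm_rnorm normrZ normc_cmod norm_rnorm.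
Qed.

Lemma rnorm0 : rnorm (0 : X) = 0.
Proof. by rewrite /rnorm normr0. Qed.

Lemma rnorm_eq0 x : (rnorm x == 0) = (x == 0).
Proof. by rewrite -(inj_eq (@complexI R)) -norm_rnorm normr_eq0. Qed.

Lemma rnorm_triangle x y z : rnorm (x - z) <= rnorm (x - y) + rnorm (y - z).
Proof. by have -> : x - z = (x - y) + (y - z); rewrite ?rnormD// addrA subrK. Qed.

Lemma rnorm_dist x y : `|rnorm x - rnorm y| <= rnorm (x - y).
Proof.
have := rnorm_triangle x y 0; have := rnorm_triangle y x 0.
rewrite !subr0 (rnormC y x) => h1 h2; rewrite ler_norml; apply/andP; split; lra.
Qed.

Lemma rcvgP {T : Type} (F : set_system T) {FF : Filter F} (f : T -> X) (x : X) :
  f @ F --> x <-> (forall e : R, 0 < e -> \forall t \near F, rnorm (f t - x) < e).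
Proof.
split=> [/cvgrPdist_lt cf e e0|cf].
  have /cf : (0 : R[i]) < e%:C by rewrite ltcR.
  by apply: filterS => t; rewrite distrC norm_rnorm ltcR.
apply/cvgrPdist_lt => -[e e']; rewrite ltcE /= => /andP[/eqP -> e0].
have := cf e e0; apply: filterS => t.
by rewrite distrC norm_rnorm ltcR.
Qed.

End rnorm.

Lemma rnorm_cmod (R : realType) (z : R[i]) : rnorm (z : R[i]^o) = cmod z.
Proof. by []. Qed.

(** * Real-linear functionals and the Hahn-Banach theorem *)

(** The scalars of X are complex, but the integrals to be tested are real; a bound is
stored because continuity is only ever used in quantitative form. *)
Record rfun (R : realType) (X : normedModType R[i]) := RFun {
  rf :> X -> R;
  rf_norm : R;
  rfD : forall x y, rf (x + y) = rf x + rf y;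
  rfZ : forall (r : R) x, rf (r%:C *: x) = r * rf x;
  rf_norm_ge0 : 0 <= rf_norm;
  rf_bound : forall x, `|rf x| <= rf_norm * rnorm x }.

Section rfun_theory.
Variables (R : realType) (X : normedModType R[i]).
Implicit Types (l : rfun X) (x y : X).

Lemma rf0 l : l 0 = 0.
Proof. by have := rfZ l 0 0; rewrite scaler0 mul0r. Qed.

Lemma rfN l x : l (- x) = - l x.
Proof. by apply/eqP; rewrite -addr_eq0 -rfD addNr rf0. Qed.

Lemma rfB l x y : l (x - y) = l x - l y.
Proof. by rewrite rfD rfN. Qed.

(** A complex scalar acts on a real functional through its real and imaginary
   parts. *)
Lemma rf_scale l (a : R[i]) x :
  l (a *: x) = complex.Re a * l x + complex.Im a * l ('i *: x).
Proof.
rewrite -!rfZ -rfD scalerA -scalerDl; congr (l (_ *: _)).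
by rewrite [LHS]complexE [in RHS]mulrC.
Qed.

Definition rfun_comp (Y : normedModType R[i]) (l : rfun Y) (T : X -> Y) (M : R)
    (TD : forall x y, T (x + y) = T x + T y)
    (TZ : forall (r : R) x, T (r%:C *: x) = r%:C *: T x)
    (M0 : 0 <= M) (TM : forall x, rnorm (T x) <= M * rnorm x) : rfun X.
Proof.
refine (@RFun R X (fun x => l (T x)) (rf_norm l * M) _ _ _ _).
- by move=> x y; rewrite TD rfD.
- by move=> r x; rewrite TZ rfZ.
- by rewrite mulr_ge0// rf_norm_ge0.
- move=> x; rewrite (le_trans (rf_bound l _))// -mulrA ler_wpM2l// rf_norm_ge0//.
Defined.

Definition rfun_scale l (a : R[i]) : rfun X.
Proof.
apply: (@rfun_comp X l (fun x => a *: x) (cmod a)).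
- by move=> x y; rewrite scalerDr.
- by move=> r x; rewrite !scalerA mulrC.
- exact: cmod_ge0.
- by move=> x; rewrite rnormZ.
Defined.

Lemma rf_cvg {T : Type} (F : set_system T) {FF : Filter F} (f : T -> X) x l :
  f @ F --> x -> l (f t) @[t --> F] --> l x.
Proof.
move=> /rcvgP cf; apply/cvgrPdist_lt => e e0.
have M0 : 0 < rf_norm l + 1 by rewrite ltr_wpDl ?rf_norm_ge0.
have /cf : 0 < e / (rf_norm l + 1) by rewrite divr_gt0.
apply: filterS => t; rewrite ltr_pdivlMr// => h.
rewrite -rfB (le_lt_trans (rf_bound _ _))// rnormC (le_lt_trans _ h)//.
by rewrite mulrC ler_wpM2l ?rnorm_ge0// lerDl.
Qed.

End rfun_theory.

Section hahn_banach.
Variables (R : realType) (X : normedModType R[i]) (x0 : X).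

(** Zorn's lemma is applied to graphs instead of functionals on subspaces: unions of
chains are then plain unions of sets. The third clause allows the empty graph, the
union of the empty chain. *)
Let P (G : set (X * R)) :=
  [/\ forall p q r, G p -> G q -> G (p.1 + r%:C *: q.1, p.2 + r * q.2),
      forall p, G p -> p.2 <= rnorm p.1 &
      forall p, G p -> G (x0, rnorm x0)].

Let P_span : P [set p | exists r : R, p = (r%:C *: x0, r * rnorm x0)].
Proof.
split.
- move=> _ _ r [a ->] [b ->]; exists (a + r * b) => /=; congr (_, _).
    by rewrite scalerA -scalerDl rmorphD rmorphM.
  by rewrite mulrDl mulrA.
- move=> _ [r ->] /=; rewrite rnormZ cmod_real ler_wpM2r ?rnorm_ge0//.
  exact: ler_norm.
- by move=> _ _; exists 1; rewrite scale1r mul1r.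
Qed.

Let P_chain (F : set (set (X * R))) :
  F `<=` P -> total_on F subset -> P (\bigcup_(G in F) G).
Proof.
move=> FP totF; split.
- move=> p q r [G1 F1 G1p] [G2 F2 G2q].
  have [s12|s21] := totF _ _ F1 F2.
    by exists G2 => //; have [+ _ _] := FP _ F2; apply => //; exact: s12.
  by exists G1 => //; have [+ _ _] := FP _ F1; apply => //; exact: s21.
- by move=> p [G /FP[_ + _]]; apply.
- by move=> p [G FG Gp]; exists G => //; have [_ _ +] := FP _ FG; apply; exact: Gp.
Qed.

(** The admissible values at a new vector form an interval, nonempty by the triangle
inequality. *)
Let extension_value (A : set (X * R)) (y : X) : P A -> A !=set0 ->
  exists c, forall p, A p ->
    p.2 - c <= rnorm (p.1 - y) /\ p.2 + c <= rnorm (p.1 + y).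
Proof.
move=> [Alin Adom _] [p0 Ap0].
pose E := [set p.2 - rnorm (p.1 - y) | p in A].
have ub q : A q -> ubound E (rnorm (q.1 + y) - q.2).
  move=> Aq _ [p Ap <-].
  have /Adom := Alin p q 1 Ap Aq; rewrite scale1r mul1r /= => h.
  have := rnormD (p.1 - y) (q.1 + y).
  have -> : p.1 - y + (q.1 + y) = p.1 + q.1 by rewrite addrACA addNr addr0.
  lra.
have hsE : has_sup E.
  by split; [exists (p0.2 - rnorm (p0.1 - y)); exists p0|eexists; exact: (ub p0)].
exists (sup E) => p Ap; split.
  have : p.2 - rnorm (p.1 - y) <= sup E.
    by apply: ub_le_sup; [case: hsE|exists p].
  lra.
have : sup E <= rnorm (p.1 + y) - p.2 by apply: ge_sup; [case: hsE|exact: ub].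
lra.
Qed.

Lemma hahn_banach : exists l : rfun X,
  (forall x, `|l x| <= rnorm x) /\ l x0 = rnorm x0.
Proof.
have [A [PA maxA]] := Zorn_bigcup P_chain.
have [Alin Adom Ax0] := PA.
have A0 : A !=set0.
  apply/set0P/negP => /eqP A0; apply: (maxA _ _ P_span).
  rewrite A0; split; first by [].
  by move=> /(_ (1%:C *: x0, 1 * rnorm x0)); apply; exists 1.
have {Ax0}Ax0 : A (x0, rnorm x0) by case: A0 => p /Ax0.
have A00 : A (0, 0).
  by have := Alin _ _ (-1) Ax0 Ax0; rewrite /= rmorphN scaleN1r mulN1r !subrr.
have AZ p r : A p -> A (r%:C *: p.1, r * p.2).
  by move=> Ap; have := Alin _ _ r A00 Ap; rewrite /= !add0r.
have Afun x a b : A (x, a) -> A (x, b) -> a = b.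
  move=> Aa Ab.
  have /Adom /= := Alin _ _ (-1) Aa Ab; rewrite rmorphN scaleN1r mulN1r subrr rnorm0.
  have /Adom /= := Alin _ _ (-1) Ab Aa; rewrite rmorphN scaleN1r mulN1r subrr rnorm0.
  by move=> h1 h2; apply/eqP; rewrite eq_le; apply/andP; split; lra.
have Atot y : exists a, A (y, a).
  apply: contrapT => Ny.
  have [c hc] := extension_value y PA A0.
  pose B := [set p | exists q r, A q /\ p = (q.1 + r%:C *: y, q.2 + r * c)].
  apply: (maxA B).
    split.
      move=> p Ap; exists p, 0; split => //.
      by rewrite scale0r mul0r !addr0; case: p {Ap}.
    move=> BA; apply: Ny; exists c; apply: BA.
    by exists (0, 0), 1; split => //=; rewrite !add0r scale1r mul1r.
  split.
  - move=> _ _ r [q1 [r1 [Aq1 ->]]] [q2 [r2 [Aq2 ->]]] /=.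
    exists (q1.1 + r%:C *: q2.1, q1.2 + r * q2.2), (r1 + r * r2); split.
      exact: Alin.
    congr (_, _) => /=; last by ring.
    rewrite rmorphD rmorphM scalerDr scalerDl -!addrA; congr (_ + _).
    by rewrite scalerA addrCA.
  - move=> _ [q [r [Aq ->]]] /=.
    have [r0|r0|->] := ltgtP r 0.
    + have s0 : 0 < - r by rewrite oppr_gt0.
      have [+ _] := hc _ (AZ _ (- r)^-1 Aq); rewrite /= => /(ler_wpM2l (ltW s0)).
      rewrite mulrBr mulrA divff ?gt_eqF// mul1r mulNr opprK.
      move=> /le_trans; apply.
      rewrite -[X in X * _]ger0_norm ?(ltW s0)// -cmod_real -rnormZ scalerBr scalerA.
      by rewrite -rmorphM divff ?gt_eqF// rmorphN scaleNr opprK scale1r.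
    + have [_] := hc _ (AZ _ r^-1 Aq); rewrite /= => /(ler_wpM2l (ltW r0)).
      rewrite mulrDr mulrA divff ?gt_eqF// mul1r.
      move=> /le_trans; apply.
      rewrite -[X in X * _]ger0_norm ?(ltW r0)// -cmod_real -rnormZ scalerDr scalerA.
      by rewrite -rmorphM divff ?gt_eqF// scale1r.
    + by rewrite mul0r addr0 scale0r addr0; exact: Adom.
  - move=> _ _; exists (x0, rnorm x0), 0; split => //=.
    by rewrite scale0r mul0r !addr0.
have [l Al] := choice Atot.
have lbound x : `|l x| <= 1 * rnorm x.
  rewrite mul1r ler_norml; apply/andP; split; last exact: (Adom _ (Al x)).
  have /Adom /= := AZ _ (-1) (Al x).
  by rewrite rmorphN scaleN1r rnormN; lra.
have lD x y : l (x + y) = l x + l y.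
  apply: (Afun (x + y)) => //.
  by have := Alin _ _ 1 (Al x) (Al y); rewrite /= scale1r mul1r.
have lZ (r : R) x : l (r%:C *: x) = r * l x.
  by apply: (Afun (r%:C *: x)) => //; have := AZ _ r (Al x).
exists (RFun lD lZ ler01 lbound); split => /=.
  by move=> x; have := lbound x; rewrite mul1r.
exact: (Afun x0).
Qed.

End hahn_banach.

Lemma rf_eq (R : realType) (X : normedModType R[i]) (x y : X) :
  (forall l : rfun X, l x = l y) -> x = y.
Proof.
move=> h; apply/eqP; rewrite -subr_eq0 -rnorm_eq0.
by have [l [_ <-]] := hahn_banach (x - y); rewrite rfB h subrr.
Qed.

(** * Real Lebesgue integrals and weak vector-valued integrals *)
Section real_integrals.
Variable R : realType.
Notation mu := (@lebesgue_measure R).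
Implicit Types (D : set R) (f g : R -> R).

Lemma integrable_measurable D f : mu.-integrable D (EFin \o f) -> measurable_fun D f.
Proof. by move=> /integrableP[/measurable_EFinP]. Qed.

Lemma dominated_integrable D f g : measurable D -> measurable_fun D f ->
  mu.-integrable D (EFin \o g) -> (forall t, D t -> `|f t| <= g t) ->
  mu.-integrable D (EFin \o f).
Proof.
move=> mD mf ig fg; apply: le_integrable ig => //; first exact/measurable_EFinP.
move=> t Dt /=; rewrite lee_fin (le_trans (fg t Dt))// ler_norm//.
Qed.

Lemma RintegrableZ D f (c : R) : measurable D -> mu.-integrable D (EFin \o f) ->
  mu.-integrable D (EFin \o (fun t => c * f t)).
Proof.
by move=> mD jf; apply: eq_integrable (integrableZl _ c jf) => // t _ /=; rewrite EFinM.
Qed.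

Lemma RintegrableD D f g : measurable D -> mu.-integrable D (EFin \o f) ->
  mu.-integrable D (EFin \o g) -> mu.-integrable D (EFin \o (fun t => f t + g t)).
Proof.
by move=> mD jf jg; apply: eq_integrable (integrableD _ jf jg) => // t _ /=; rewrite EFinD.
Qed.

Lemma Rintegral_bound D f g : measurable D -> measurable_fun D f ->
  mu.-integrable D (EFin \o g) -> (forall t, D t -> `|f t| <= g t) ->
  `|\int[mu]_(t in D) f t| <= \int[mu]_(t in D) g t.
Proof.
move=> mD mf ig fg; have jf := dominated_integrable mD mf ig fg.
rewrite (le_trans (le_normr_Rintegral _ jf))//.
apply: le_Rintegral => //.
apply: (@dominated_integrable _ _ g) => //.
  by apply: measurableT_comp => //; exact: integrable_measurable jf.
by move=> t Dt; rewrite normr_id fg.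
Qed.

Lemma Rdominated_convergence D (f_ : nat -> R -> R) f g : measurable D ->
  (forall n, measurable_fun D (f_ n)) -> measurable_fun D f ->
  (forall t, D t -> f_ n t @[n --> \oo] --> f t) ->
  mu.-integrable D (EFin \o g) -> (forall n t, D t -> `|f_ n t| <= g t) ->
  \int[mu]_(t in D) f_ n t @[n --> \oo] --> \int[mu]_(t in D) f t.
Proof.
move=> mD mf_ mf cf ig fg.
have jf : mu.-integrable D (EFin \o f).
  apply: (dominated_integrable mD mf ig) => t Dt.
  have h : `|f_ n t| @[n --> \oo] --> `|f t| by apply: cvg_norm; exact: cf.
  rewrite -(cvg_lim _ h)//; apply: limr_le; first by apply/cvg_ex; eexists; exact: h.
  by apply: nearW => n; exact: fg.
have [] := @dominated_convergence _ _ _ mu D mD (fun n => EFin \o f_ n) (EFin \o f)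
  (EFin \o g).
- by move=> n; apply/measurable_EFinP; exact: mf_.
- exact/measurable_EFinP.
- by apply: aeW => t Dt; apply/fine_cvgP; split; [exact: nearW|exact: cf].
- by [].
- by apply: aeW => t n Dt; rewrite /= lee_fin fg.
move=> _ _ h; apply: fine_cvg.
by rewrite /Rintegral fineK//; exact: integrable_fin_num.
Qed.

End real_integrals.

Section weak_integral.
Variables (R : realType) (X : normedModType R[i]).
Notation mu := (@lebesgue_measure R).
Implicit Types (D : set R) (f g : R -> X) (l : rfun X) (x y : X).

(** The weak (Pettis) integral. *)
Definition wint D f x := forall l : rfun X,
  mu.-integrable D (EFin \o (l \o f)) /\ l x = \int[mu]_(t in D) l (f t).

Lemma wint_unique D f x y : wint D f x -> wint D f y -> x = y.
Proof. by move=> fx fy; apply: rf_eq => l; rewrite (fx l).2 (fy l).2. Qed.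

Lemma eq_wint D f g x : measurable D -> {in D, f =1 g} -> wint D f x -> wint D g x.
Proof.
move=> mD fg fx l; have [h1 h2] := fx l; split.
  by apply: eq_integrable h1 => // t tD; rewrite /= fg.
by rewrite h2; apply: eq_Rintegral => t tD; rewrite fg.
Qed.

Lemma wintD D f g x y : measurable D -> wint D f x -> wint D g y ->
  wint D (fun t => f t + g t) (x + y).
Proof.
move=> mD fx gy l; have [i1 e1] := fx l; have [i2 e2] := gy l; split.
  by apply: eq_integrable (integrableD _ i1 i2) => // t _ /=; rewrite rfD.
by rewrite rfD e1 e2 -RintegralD//; apply: eq_Rintegral => t _; rewrite rfD.
Qed.

Lemma wintZ D f x (a : R[i]) : wint D f x -> wint D (fun t => a *: f t) (a *: x).
Proof. by move=> fx l; have := fx (rfun_scale l a). Qed.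

Lemma wint_scaleD D f g x y (a : R[i]) : measurable D -> wint D f x -> wint D g y ->
  wint D (fun t => a *: f t + g t) (a *: x + y).
Proof. by move=> mD fx gy; apply: wintD => //; exact: wintZ. Qed.

Lemma wintB D f g x y : measurable D -> wint D f x -> wint D g y ->
  wint D (fun t => f t - g t) (x - y).
Proof.
move=> mD fx /(wintZ (-1)) gy; have := wintD mD fx gy; rewrite scaleN1r.
by apply: eq_wint => // t _; rewrite scaleN1r.
Qed.

(** A functional of norm one attains the norm of x. *)
Lemma wint_bound D f x (G : R -> R) : measurable D -> wint D f x ->
  mu.-integrable D (EFin \o G) -> (forall t, D t -> rnorm (f t) <= G t) ->
  rnorm x <= \int[mu]_(t in D) G t.
Proof.
move=> mD fx iG fG; have [l [lle <-]] := hahn_banach x.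
have [lf ->] := fx l; apply: le_Rintegral => // t Dt.
by rewrite (le_trans (ler_norm _))// (le_trans (lle _))// fG.
Qed.

Lemma wint_indic D (P : set R) (v : X) : measurable D -> measurable P ->
  (mu P < +oo)%E ->
  wint D (fun t => (\1_P t)%:C *: v) ((fine (mu (D `&` P)))%:C *: v).
Proof.
move=> mD mP Poo l.
have iP : mu.-integrable D (EFin \o \1_P).
  apply/integrableP; split; first exact/measurable_EFinP/measurable_indic.
  under eq_integral do rewrite gee0_abs ?lee_fin//.
  rewrite integral_indic//; apply: le_lt_trans Poo.
  by apply: le_measure; rewrite ?inE//; exact: measurableI.
split.
  by apply: eq_integrable (integrableZr _ (l v) iP) => // t _; rewrite /= rfZ.
under eq_Rintegral do rewrite rfZ.
rewrite RintegralZr// rfZ; congr (_ * _).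
by rewrite /Rintegral integral_indic// setIC.
Qed.

Lemma wint_sum D (I : Type) (s : seq I) (F : I -> R -> X) (x : I -> X) : measurable D ->
  (forall i, wint D (F i) (x i)) ->
  wint D (fun t => \sum_(i <- s) F i t) (\sum_(i <- s) x i).
Proof.
move=> mD h; elim: s => [|i s ih].
  rewrite big_nil => l; split.
    apply: eq_integrable (@integrable0 _ _ _ mu D) => // t _.
    by rewrite /= big_nil rf0.
  rewrite rf0 (@eq_Rintegral _ _ _ mu D (fun=> 0)); last by move=> t _; rewrite big_nil rf0.
  by rewrite Rintegral_cst// mul0r.
rewrite big_cons; have := wintD mD (h i) ih.
by apply: eq_wint => // t _; rewrite big_cons.
Qed.

Lemma wint_simple D (s : simple_fun X) : measurable D ->
  wint D (sf_eval s) (sf_integral D s).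
Proof.
move=> mD; apply: wint_sum => // i; apply: wint_indic => //.
  exact: sf_measurable.
exact: sf_finite.
Qed.

Lemma rnorm_measurable D f : measurable D -> {within D, continuous f} ->
  measurable_fun D (fun t => rnorm (f t)).
Proof.
move=> mD cf; apply: subspace_continuous_measurable_fun => // t.
apply/cvgrPdist_lt => e e0; have /rcvgP/(_ _ e0) := cf t.
by apply: filterS => u; apply: le_lt_trans; rewrite distrC rnorm_dist.
Qed.

Lemma rf_measurable D f l : measurable D -> {within D, continuous f} ->
  measurable_fun D (l \o f).
Proof.
move=> mD cf; apply: subspace_continuous_measurable_fun => // t.
by apply: rf_cvg; exact: cf.
Qed.

Lemma sf_dist_measurable D f (s : simple_fun X) : measurable D ->
  {within D, continuous f} -> measurable_fun D (fun t => rnorm (f t - sf_eval s t)).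
Proof.
move=> mD; rewrite /sf_eval; case: s => n P v mP _ /=.
elim: n P v mP f => [|n ih] P v mP f cf.
  apply: eq_measurable_fun (rnorm_measurable mD cf) => t _.
  by rewrite big_ord0 subr0.
pose P' i := P (lift ord0 i); pose v' i := v (lift ord0 i).
have mP' i : measurable (P' i) by exact: mP.
have cfv : {within D, continuous (fun t => f t - v ord0)}.
  by move=> t; apply: cvgB; [exact: cf|exact: cvg_cst].
have m1 := ih P' v' mP' _ cfv; have m2 := ih P' v' mP' _ cf.
pose g t := \1_(P ord0) t * rnorm (f t - v ord0 - \sum_(i < n) (\1_(P' i) t)%:C *: v' i)
  + (1 - \1_(P ord0) t) * rnorm (f t - \sum_(i < n) (\1_(P' i) t)%:C *: v' i).
apply: (@eq_measurable_fun _ _ _ _ _ g).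
  move=> t _; rewrite /g big_ord_recl /= indicE; case: (t \in P ord0).
    by rewrite subrr mul0r addr0 mul1r scale1r opprD addrA.
  by rewrite subr0 mul0r add0r mul1r scale0r add0r.
apply: measurable_funD; apply: measurable_funM => //.
by apply: measurable_funB => //; exact: measurable_indic.
Qed.

Section limits.
Variables (D : set R) (f : R -> X) (g_ : nat -> R -> X) (x_ : nat -> X).
Hypotheses (mD : measurable D) (gx : forall n, wint D (g_ n) (x_ n)).
Hypothesis mfg : forall n, measurable_fun D (fun t => rnorm (f t - g_ n t)).
Hypothesis fg0 : (\int[mu]_(t in D) (rnorm (f t - g_ n t))%:E)%E @[n --> \oo] --> 0%E.
Hypothesis mf : forall l : rfun X, measurable_fun D (l \o f).

Let d n t := rnorm (f t - g_ n t).

Let d_integrable : \forall n \near \oo, mu.-integrable D (EFin \o d n).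
Proof.
have [+ _] := (fine_cvgP _ _).1 fg0; apply: filterS => n fin.
apply/integrableP; split; first by apply/measurable_EFinP; exact: mfg.
rewrite (@eq_integral _ _ _ mu D (EFin \o d n)); last by move=> t _; rewrite /= ger0_norm ?rnorm_ge0.
by rewrite ltey_eq fin.
Qed.

Let d_cvg : \int[mu]_(t in D) d n t @[n --> \oo] --> 0.
Proof. by have [_] := (fine_cvgP _ _).1 fg0. Qed.

(** The differences become integrable from some rank on, and the approximants are
integrable. *)
Lemma rf_integrable_limit l : mu.-integrable D (EFin \o (l \o f)).
Proof.
have [n _ /(_ n (leqnn n)) dn] := d_integrable.
have [gi _] := gx n l.
have ld : mu.-integrable D (EFin \o (fun t => l (f t) - l (g_ n t))).
  apply: (@dominated_integrable _ _ _ (fun t => rf_norm l * d n t)) => //.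
  - by apply: measurable_funB; [exact: mf|exact: integrable_measurable gi].
  - exact: RintegrableZ.
  - by move=> t _; rewrite -rfB rf_bound.
apply: eq_integrable (integrableD _ ld gi) => // t _.
by rewrite /= -EFinD subrK.
Qed.

Let rf_dist l n : mu.-integrable D (EFin \o d n) ->
  `|l (x_ n) - \int[mu]_(t in D) l (f t)| <= rf_norm l * \int[mu]_(t in D) d n t.
Proof.
move=> dn; have [gi ->] := gx n l.
rewrite -RintegralB//; last exact: rf_integrable_limit.
rewrite -RintegralZl//; apply: Rintegral_bound => //.
- apply: measurable_funB; first exact: integrable_measurable gi.
  exact: integrable_measurable (rf_integrable_limit l).
- exact: RintegrableZ.
- by move=> t _; rewrite -rfB (le_trans (rf_bound _ _))// /d rnormC.
Qed.

Lemma wint_limit x : x_ @ \oo --> x -> wint D f x.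
Proof.
move=> xx l; split; first exact: rf_integrable_limit.
have h1 : l (x_ n) @[n --> \oo] --> l x by exact: rf_cvg.
suff h2 : l (x_ n) @[n --> \oo] --> \int[mu]_(t in D) l (f t).
  by rewrite -(cvg_lim _ h1)// -(cvg_lim _ h2).
have h3 : rf_norm l * \int[mu]_(t in D) d n t @[n --> \oo] --> 0.
  by rewrite -(mulr0 (rf_norm l)); apply: cvgM => //; exact: cvg_cst.
apply/cvgrPdist_lt => e e0; near=> n.
rewrite distrC; apply: le_lt_trans; first by apply: rf_dist; near: n; exact: d_integrable.
by near: n; exact: (cvgr_lt _ h3).
Unshelve. all: end_near. Qed.

(** Both terms are compared with the integral of f through a functional of norm one
that attains the norm of their difference; no limit vector is needed yet. *)
Lemma wint_limit_cauchy (e : R) : 0 < e -> exists N, forall n m, (N <= n)%N -> (N <= m)%N ->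
  rnorm (x_ n - x_ m) < e.
Proof.
move=> e0; have e20 : 0 < e / 2 by rewrite divr_gt0.
have /cvgrPdist_lt/(_ _ e20) h := d_cvg.
have [N _ hN] := filterI h d_integrable.
exists N => n m Nn Nm; have [dn idn] := hN n Nn; have [dm idm] := hN m Nm.
have [l [lle le]] := hahn_banach (x_ n - x_ m).
rewrite -le rfB.
have dist k : mu.-integrable D (EFin \o d k) ->
    `|l (x_ k) - \int[mu]_(t in D) l (f t)| <= \int[mu]_(t in D) d k t.
  move=> dk; have [gi ->] := gx k l.
  rewrite -RintegralB//; last exact: rf_integrable_limit.
  apply: Rintegral_bound => //.
    apply: measurable_funB; first exact: integrable_measurable gi.
    exact: integrable_measurable (rf_integrable_limit l).
  by move=> t _; rewrite -rfB (le_trans (lle _))// /d rnormC.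
move: (dist n idn) (dist m idm).
rewrite !sub0r !normrN in dn dm.
move: (le_lt_trans (ler_norm _) dn) (le_lt_trans (ler_norm _) dm).
rewrite !ler_norml => h1 h2 /andP[_ h3] /andP[h4 _]; lra.
Qed.

End limits.

End weak_integral.

Lemma wint_exists_limit (R : realType) (X : completeNormedModType R[i]) (D : set R)
    (f : R -> X) (g_ : nat -> R -> X) (x_ : nat -> X) :
  measurable D -> (forall n, wint D (g_ n) (x_ n)) ->
  (forall n, measurable_fun D (fun t => rnorm (f t - g_ n t))) ->
  (\int[lebesgue_measure]_(t in D) (rnorm (f t - g_ n t))%:E)%E @[n --> \oo] --> 0%E ->
  (forall l : rfun X, measurable_fun D (l \o f)) ->
  exists x, wint D f x.
Proof.
move=> mD gx mfg fg0 mf.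
have cx : cvg (x_ @ \oo).
  apply/cauchy_cvgP/cauchyP => -[e e']; rewrite ltcE /= => /andP[/eqP -> e0].
  have [N hN] := wint_limit_cauchy mD gx mfg fg0 mf e0.
  exists (x_ N); exists N => // n Nn /=.
  by rewrite -ball_normE /ball_/= norm_rnorm ltcR hN.
by exists (lim (x_ @ \oo)); exact: (wint_limit mD gx mfg fg0 mf cx).
Qed.

(** Bochner integrals are weak integrals: the functionals commute with the integrals of
simple functions and with L1 limits. *)
Lemma bochner_wint (R : realType) (X : normedModType R[i]) (D : set R)
    (f : R -> X) (w : X) : measurable D ->
  (forall l : rfun X, measurable_fun D (l \o f)) ->
  is_bochner_integral D f w -> wint D f w.
Proof.
move=> mD mf [s [mfs fs0 sw]].
exact: (wint_limit mD (fun n => wint_simple (s n) mD) mfs fs0 mf sw).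
Qed.

(** * Calculus on the half-line *)
Section derivative_instances.
Variable R : realType.
Implicit Types (f g : R -> R).

Global Instance is_derive_expR_comp g (x dg : R) : is_derive x 1 g dg ->
  is_derive x 1 (fun t => expR (g t)) (expR (g x) * dg).
Proof. by move=> h; exact: is_derive1_comp. Qed.

Global Instance is_derive_sin_comp g (x dg : R) : is_derive x 1 g dg ->
  is_derive x 1 (fun t => sin (g t)) (cos (g x) * dg).
Proof. by move=> h; exact: is_derive1_comp. Qed.

Global Instance is_derive_cos_comp g (x dg : R) : is_derive x 1 g dg ->
  is_derive x 1 (fun t => cos (g t)) (- sin (g x) * dg).
Proof. by move=> h; exact: is_derive1_comp. Qed.

Lemma is_derive_continuous f (x df : R) : is_derive x 1 f df -> {for x, continuous f}.
Proof.
by move=> h; apply: differentiable_continuous; apply/derivable1_diffP; exact: ex_derive.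
Qed.

Lemma derive1_is_derive f (x df : R) : is_derive x 1 f df -> derive1 f x = df.
Proof. by move=> h; rewrite derive1E; exact: derive_val. Qed.

End derivative_instances.

Section half_line.
Variable R : realType.
Notation mu := (@lebesgue_measure R).
Notation Rp := (`[0%R, +oo[%classic : set R).

Lemma Rpos_itv (t : R) : Rp t <-> 0 <= t.
Proof. by rewrite /= in_itv /= andbT. Qed.

Lemma integral_expRN (k : R) : 0 < k ->
  (\int[mu]_(t in Rp) (expR (- (k * t)))%:E)%E = (k^-1)%:E.
Proof.
move=> k0; pose F t := - (k^-1 * expR (- (k * t))).
have dF (x : R) : is_derive x 1 F (expR (- (k * x))).
  apply: is_derive_eq; rewrite /GRing.scale /=; field; exact: lt0r_neq0.
have cF (x : R) : {for x, continuous F}.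
  exact: is_derive_continuous.
rewrite (@ge0_continuous_FTC2y _ _ F 0 0).
- by rewrite /F mulr0 oppr0 expR0 mulr1 -EFinB sub0r opprK.
- by move=> x _; exact: expR_ge0.
- apply: continuous_subspaceT => x.
  apply: (@continuous_comp _ _ _ (fun t => - (k * t)) expR); last exact: continuous_expR.
  by apply: cvgN; apply: cvgM; [exact: cvg_cst|exact: cvg_id].
- rewrite /F -oppr0; apply: cvgN; rewrite -(mulr0 k^-1); apply: cvgM; first exact: cvg_cst.
  apply: (@cvg_comp _ _ _ (fun t => k * t) (fun t => expR (- t))); last exact: cvgr_expR.
  by apply: gt0_cvgMry => //; exact: cvg_id.
- by move=> x _; exact: ex_derive.
- by apply: cvg_at_right_filter; exact: cF.
- by move=> x _; exact: derive1_is_derive.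
Qed.

Lemma integrable_expRN (k : R) : 0 < k ->
  mu.-integrable Rp (EFin \o (fun t => expR (- (k * t)))).
Proof.
move=> k0; apply/integrableP; split.
  apply/measurable_EFinP; apply: measurableT_comp => //.
  by apply: measurableT_comp => //; exact: measurable_funM.
rewrite (@eq_integral _ _ _ mu Rp (fun t => (expR (- (k * t)))%:E)).
  by rewrite integral_expRN// ltry.
by move=> t _ /=; rewrite ger0_norm// expR_ge0.
Qed.

Lemma Rintegral_expRN (k : R) : 0 < k ->
  \int[mu]_(t in Rp) expR (- (k * t)) = k^-1.
Proof. by move=> k0; rewrite /Rintegral integral_expRN. Qed.

End half_line.

Section within_continuity.
Variable R : realType.

Lemma rwithin_contP (X : normedModType R[i]) (D : set R) (f : R -> X) :
  {within D, continuous f} <-> (forall t, D t -> forall e : R, 0 < e ->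
    exists2 d : R, 0 < d & forall u, D u -> `|u - t| < d -> rnorm (f u - f t) < e).
Proof.
split=> [/subspace_continuousP cf t Dt e e0|h].
  have /rcvgP/(_ e e0)/nbhs_ballP [d /= d0 hd] := cf t Dt.
  exists d => // u Du ut; apply: hd => //=.
  by rewrite /ball /= distrC.
apply/subspace_continuousP => t Dt; apply/rcvgP => e e0.
have [d d0 hd] := h t Dt e e0.
apply/nbhs_ballP; exists d => //= u; rewrite /ball /= distrC => ut Du.
exact: hd.
Qed.

Lemma within_contP (D : set R) (f : R -> R) :
  {within D, continuous f} <-> (forall t, D t -> forall e : R, 0 < e ->
    exists2 d : R, 0 < d & forall u, D u -> `|u - t| < d -> `|f u - f t| < e).
Proof.
split=> [/subspace_continuousP cf t Dt e e0|h].
  have /cvgrPdist_lt/(_ e e0)/nbhs_ballP [d /= d0 hd] := cf t Dt.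
  exists d => // u Du ut; rewrite distrC; apply: hd => //=.
  by rewrite /ball /= distrC.
apply/subspace_continuousP => t Dt; apply/cvgrPdist_lt => e e0.
have [d d0 hd] := h t Dt e e0.
apply/nbhs_ballP; exists d => //= u; rewrite /ball /= distrC => ut Du.
rewrite distrC; exact: hd.
Qed.

End within_continuity.

(** * Existence of weak integrals of decaying continuous functions *)
Section step_approximation.
Variables (R : realType) (X : normedModType R[i]).
Notation mu := (@lebesgue_measure R).
Notation Rp := (`[0%R, +oo[%classic : set R).
Variable f : R -> X.

(** At stage n the step function has step 1/(n+1) and lives on [0, n+1[, so that both
the mesh and the truncation are refined together. *)
Definition mesh (n : nat) : R := n.+1%:R.

Lemma mesh_gt0 n : 0 < mesh n. Proof. exact: ltr0Sn. Qed.

Definition mesh_piece n (j : 'I_(n.+1 * n.+1)) : set R :=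
  `[j%:R / mesh n, j.+1%:R / mesh n[%classic.

Lemma mesh_piece_measurable n j : measurable (@mesh_piece n j).
Proof. exact: measurable_itv. Qed.

Lemma mesh_piece_finite n j : (mu (@mesh_piece n j) < +oo)%E.
Proof. by rewrite /mesh_piece lebesgue_measure_itv; case: ifP => _ //=; rewrite ltry. Qed.

Definition step_fun n : simple_fun X :=
  SimpleFun (fun j : 'I_(n.+1 * n.+1) => f (j%:R / mesh n))
    (@mesh_piece_measurable n) (@mesh_piece_finite n).

Definition mesh_point n (t : R) : R := (Num.truncn (t * mesh n))%:R / mesh n.

Lemma mesh_point_itv n t : 0 <= t -> mesh_point n t <= t < mesh_point n t + (mesh n)^-1.
Proof.
move=> t0; have m0 := mesh_gt0 n.
have /andP[h1 h2] := truncn_itv (mulr_ge0 t0 (ltW m0)).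
rewrite /mesh_point ler_pdivrMr// h1 /=.
by rewrite -[X in _ + X]mul1r -mulrDl ltr_pdivlMr// natr1.
Qed.

Lemma mesh_point_ge0 n t : 0 <= mesh_point n t.
Proof. by rewrite divr_ge0// ltW// mesh_gt0. Qed.

Lemma step_funE n t : 0 <= t ->
  sf_eval (step_fun n) t = if t < mesh n then f (mesh_point n t) else 0.
Proof.
move=> t0; have m0 := mesh_gt0 n.
have tm0 : 0 <= t * mesh n by rewrite mulr_ge0// ltW.
have inP (j : 'I_(n.+1 * n.+1)) : (t \in mesh_piece j) = (j == Num.truncn (t * mesh n) :> nat).
  rewrite eq_sym truncn_eq//.
  rewrite /mesh_piece; apply/idP/idP; rewrite inE /= in_itv /= ler_pdivrMr// ltr_pdivlMr//.
rewrite /sf_eval /=; case: ifPn => [tn|]; last first.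
  rewrite -leNgt => nt; rewrite big1// => j _; rewrite indicE inP.
  case: eqP => [je|_]; last by rewrite scale0r.
  have : (Num.truncn (t * mesh n) < n.+1 * n.+1)%N by rewrite -je.
  rewrite truncn_lt_nat// natrM => /(le_lt_trans (ler_wpM2r (ltW m0) nt)).
  by rewrite ltxx.
have jlt : (Num.truncn (t * mesh n) < n.+1 * n.+1)%N.
  by rewrite truncn_lt_nat// natrM ltr_pM2r.
rewrite (bigD1 (Ordinal jlt))//= indicE inP eqxx scale1r big1 ?addr0//.
move=> j; rewrite -val_eqE /= => /negPf jn.
by rewrite indicE inP jn scale0r.
Qed.

Variables (C k : R).
Hypotheses (k0 : 0 < k) (cf : {within Rp, continuous f}).
Hypothesis fC : forall t, 0 <= t -> rnorm (f t) <= C * expR (- (k * t)).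

Lemma step_fun_cvg t : 0 <= t -> rnorm (f t - sf_eval (step_fun n) t) @[n --> \oo] --> 0.
Proof.
move=> t0; apply/cvgrPdist_lt => e e0.
have [d d0 hd] := (rwithin_contP _ _).1 cf t ((Rpos_itv t).2 t0) e e0.
have [N _ hN] : \forall n \near \oo, Num.max t d^-1 < n%:R.
  exact: nbhs_infty_gtr.
exists N => // n Nn.
have : Num.max t d^-1 < mesh n by apply: hN; exact: (leq_trans Nn).
rewrite gt_max => /andP[tn dn].
rewrite sub0r normrN ger0_norm ?rnorm_ge0// step_funE// tn rnormC.
apply: hd; first by apply/Rpos_itv; exact: mesh_point_ge0.
have /andP[h1 h2] := mesh_point_itv n t0.
rewrite ler0_norm ?subr_le0// opprB ltrBlDl (lt_trans h2)// ltrD2l.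
by rewrite invf_plt// posrE mesh_gt0.
Qed.

Lemma step_fun_bound n t : 0 <= t ->
  rnorm (f t - sf_eval (step_fun n) t) <= (C * (1 + expR k)) * expR (- (k * t)).
Proof.
move=> t0; have C0 : 0 <= C.
  have := le_trans (rnorm_ge0 _) (fC (lexx 0)).
  by rewrite mulr0 oppr0 expR0 mulr1.
rewrite (le_trans (rnormB _ _))// mulrDr mulr1 mulrDl lerD ?fC//.
rewrite step_funE//; case: ifP => _; last by rewrite rnorm0 !mulr_ge0// expR_ge0.
rewrite (le_trans (fC (mesh_point_ge0 n t)))// -mulrA ler_wpM2l// -expRD ler_expR.
have /andP[_ h2] := mesh_point_itv n t0.
have m1 : (mesh n)^-1 <= 1 by rewrite invf_le1 ?mesh_gt0// /mesh ler1n.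
have : k * t <= k * (mesh_point n t + 1).
  by rewrite ler_wpM2l ?(ltW k0)// (le_trans (ltW h2))// lerD2l.
rewrite mulrDr mulr1; lra.
Qed.

(** Dominated convergence: the step function samples f to the left of t, at distance
less than 1, so it obeys the same exponential bound up to a constant. *)
Lemma step_fun_L1 :
  (\int[mu]_(t in Rp) (rnorm (f t - sf_eval (step_fun n) t))%:E)%E @[n --> \oo] --> 0%E.
Proof.
have m n := sf_dist_measurable (step_fun n) (measurable_itv _) cf.
have ie := RintegrableZ (C * (1 + expR k)) (measurable_itv _) (integrable_expRN k0).
have b n t : Rp t ->
    `|rnorm (f t - sf_eval (step_fun n) t)| <= (C * (1 + expR k)) * expR (- (k * t)).
  by move=> /Rpos_itv t0; rewrite ger0_norm ?rnorm_ge0// step_fun_bound.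
apply/fine_cvgP; split.
  apply: nearW => n; apply: integrable_fin_num => //.
  exact: (dominated_integrable _ (m n) ie (b n)).
have := @Rdominated_convergence _ Rp
  (fun n t => rnorm (f t - sf_eval (step_fun n) t)) (fun=> 0) _ (measurable_itv _) m
  _ _ ie b.
rewrite Rintegral_cst// mul0r; apply => //.
by move=> t /Rpos_itv; exact: step_fun_cvg.
Qed.

End step_approximation.

Lemma wint_exists (R : realType) (X : completeNormedModType R[i]) (f : R -> X) (C k : R) :
  0 < k -> {within `[0%R, +oo[, continuous f} ->
  (forall t, 0 <= t -> rnorm (f t) <= C * expR (- (k * t))) ->
  exists x, wint `[0%R, +oo[ f x.
Proof.
move=> k0 cf fC.
apply: (@wint_exists_limit _ _ _ _ (fun n => sf_eval (step_fun f n))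
  (fun n => sf_integral `[0%R, +oo[ (step_fun f n))) => //.
- by move=> n; apply: wint_simple; exact: measurable_itv.
- by move=> n; apply: sf_dist_measurable => //; exact: measurable_itv.
- exact: (step_fun_L1 k0 cf fC).
- by move=> l; apply: rf_measurable => //; exact: measurable_itv.
Qed.

(** * The complex exponential *)
Section complex_exponential.
Variable R : realType.
Implicit Types (z w c : R[i]) (x y : R).

Lemma cRe_realM x z : complex.Re (x%:C * z) = x * complex.Re z.
Proof. by rewrite cReM mul0r subr0. Qed.

Lemma cIm_realM x z : complex.Im (x%:C * z) = x * complex.Im z.
Proof. by rewrite cImM mul0r addr0. Qed.

Lemma cexpD z w : cexp (z + w) = cexp z * cexp w.
Proof.
case: z => a b; case: w => p q.
rewrite /cexp /= expRD sinD cosD; apply: complex_eq => /=; ring.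
Qed.

Lemma cexp0 : cexp (0 : R[i]) = 1.
Proof. by rewrite /cexp /= expR0 cos0 sin0 mul1r. Qed.

Lemma cexp_real x : cexp x%:C = (expR x)%:C.
Proof. by rewrite /cexp /= cos0 sin0 mulr1. Qed.

Lemma cmod_cos_sin x : cmod (cos x +i* sin x) = 1.
Proof. by rewrite cmodE /= cos2Dsin2 sqrtr1. Qed.

Lemma cmod_cexp z : cmod (cexp z) = expR (complex.Re z).
Proof. by rewrite /cexp cmodM cmod_cos_sin mulr1 cmod_real ger0_norm// expR_ge0. Qed.

Lemma cexp_neq0 z : cexp z != 0.
Proof. by rewrite -cmod_gt0 cmod_cexp expR_gt0. Qed.

Lemma cexpJ z : cexp z^* = (cexp z)^*.
Proof.
case: z => a b; rewrite /cexp /= sinN cosN; by apply: complex_eq => /=; ring.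
Qed.

Lemma is_derive_Re_cexp c w x :
  is_derive x 1 (fun y : R => complex.Re (c * cexp (w * y%:C)))
    (complex.Re (c * w * cexp (w * x%:C))).
Proof.
case: c => a b; case: w => p q.
rewrite [X in is_derive _ _ X](_ : _ = fun y : R =>
  a * (expR (p * y) * cos (q * y)) - b * (expR (p * y) * sin (q * y))); last first.
  by apply/funext => y; rewrite /cexp /=; rewrite !(mulr0, subr0, add0r, mul0r, addr0).
apply: is_derive_eq.
rewrite /cexp /GRing.scale /= !(mulr0, subr0, add0r, mul0r, addr0, mulr1); ring.
Qed.

(** Along the segment from 0 to w, the remainder has second derivative w^2 e^(s w); a
rotation reduces the modulus of the remainder to a real part, to which the mean
value theorem applies twice. *)
Lemma cexp_taylor2 w : cmod (cexp w - 1 - w) <= cmod w ^+ 2 * expR (cmod w).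
Proof.
have [c [c1 <-]] := cmod_rotation (cexp w - 1 - w).
pose phi0 y := complex.Re (c * cexp (w * y%:C)).
pose phi1 y := complex.Re (c * w * cexp (w * y%:C)).
pose phi2 y := complex.Re (c * w * w * cexp (w * y%:C)).
have d0 x : is_derive x 1 phi0 (phi1 x) by exact: is_derive_Re_cexp.
have d1 x : is_derive x 1 phi1 (phi2 x) by exact: is_derive_Re_cexp.
have [xi] := MVT ltr01 (fun x _ => d0 x)
  (continuous_subspaceT (fun x => is_derive_continuous (d0 x))).
rewrite in_itv /= => /andP[xi0 xi1]; rewrite subr0 mulr1 => e0.
have [eta] := MVT xi0 (fun x _ => d1 x)
  (continuous_subspaceT (fun x => is_derive_continuous (d1 x))).
rewrite in_itv /= => /andP[eta0 eta1]; rewrite subr0 => e1.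
have -> : complex.Re (c * (cexp w - 1 - w)) = phi2 eta * xi.
  rewrite -e1 -e0 /phi0 /phi1 !(mulr0, mulr1, cexp0).
  by rewrite !mulrBr !cReD !cReN !mulr1; ring.
have phi2b : `|phi2 eta| <= cmod w ^+ 2 * expR (cmod w).
  rewrite (le_trans (Re_le_cmod _))// 3!cmodM c1 mul1r -expr2 ler_wpM2l ?sqr_ge0//.
  rewrite cmod_cexp ler_expR cReM /= mulr0 subr0.
  rewrite (le_trans (ler_norm _))// normrM (ger0_norm (ltW eta0)).
  rewrite (le_trans (ler_pM _ _ (Re_le_cmod w) (ltW (lt_trans eta1 xi1))))//; first exact: ltW.
  by rewrite mulr1.
rewrite (le_trans (ler_norm _))// normrM (ger0_norm (ltW xi0)).
by rewrite (le_trans (ler_pM _ _ phi2b (ltW xi1)))//; [exact: ltW|rewrite mulr1].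
Qed.

End complex_exponential.

Section linear_packing.
Variables (R : realType) (X : normedModType R[i]).

Lemma pack_linear (T : X -> X) :
  (forall (a : R[i]) x y, T (a *: x + y) = a *: T x + T y) ->
  exists L : {linear X -> X}, forall v, L v = T v.
Proof.
move=> Tlin.
pose L : {linear X -> X} := HB.pack T (GRing.isLinear.Build R[i] X X *:%R T Tlin).
by exists L.
Qed.

Lemma rnorm_bounded_continuous (L : {linear X -> X}) (M : R) :
  (forall v, rnorm (L v) <= M * rnorm v) -> continuous L.
Proof.
move=> LM v; apply/rcvgP => e e0.
have M0 : 0 < `|M| + 1 by rewrite ltr_wpDl.
have e1 : 0 < e / (`|M| + 1) by rewrite divr_gt0.
have /rcvgP/(_ _ e1) : id @ nbhs v --> v by exact: cvg_id.
apply: filterS => u; rewrite ltr_pdivlMr// => h.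
rewrite -linearB (le_lt_trans (LM _))// (le_lt_trans _ h)// mulrC ler_wpM2l ?rnorm_ge0//.
by rewrite (le_trans (ler_norm _))// lerDl.
Qed.

End linear_packing.

(** * Operator-valued Laplace integrals and their analyticity *)
Section laplace_operators.
Variables (R : realType) (X : completeNormedModType R[i]).
Notation mu := (@lebesgue_measure R).
Notation Rp := (`[0%R, +oo[%classic : set R).
Implicit Types (B : R -> X -> X) (z : R[i]).

(** Subexponential growth, rather than boundedness, is the class stable under
multiplication by affine functions, hence under differentiation of the Laplace
integral. *)
Record subexp_family B : Prop := SubexpFamily {
  sub_linear : forall u, 0 <= u -> forall (a : R[i]) x y,
    B u (a *: x + y) = a *: B u x + B u y;
  sub_continuous : forall v, {within Rp, continuous (fun u => B u v)};
  sub_growth : forall k : R, 0 < k -> exists2 C : R, 0 <= C &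
    forall u v, 0 <= u -> rnorm (B u v) <= C * expR (k * u) * rnorm v }.

(** Exponents e^(z (a0 + u a1)) cover both the Laplace transform (a0 = 0, a1 = -1) and
the integral over a ray issued from 1 (a0 = 1, a1 the direction). *)
Definition affine (a0 a1 : R[i]) (u : R) : R[i] := a0 + u%:C * a1.

Lemma cmod_affine a0 a1 u : 0 <= u -> cmod (affine a0 a1 u) <= cmod a0 + u * cmod a1.
Proof.
by move=> u0; rewrite (le_trans (cmodD _ _))// cmodM cmod_real ger0_norm.
Qed.

(** A linear function is dominated by any growing exponential. *)
Lemma affine_growth a0 a1 (k : R) : 0 < k -> exists2 C : R, 0 <= C &
  forall u, 0 <= u -> cmod (affine a0 a1 u) <= C * expR (k * u).
Proof.
move=> k0; exists (cmod a0 + cmod a1 / k).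
  by rewrite addr_ge0 ?cmod_ge0// divr_ge0 ?cmod_ge0// ltW.
move=> u u0; rewrite (le_trans (cmod_affine _ _ u0))// mulrDl lerD//.
  rewrite ler_peMr ?cmod_ge0//.
  by rewrite -expR0 ler_expR mulr_ge0// ltW.
rewrite mulrC -mulrA ler_wpM2l ?cmod_ge0// mulrC ler_pdivlMr// mulrC.
by rewrite (le_trans _ (expR_ge1Dx _))// lerDr.
Qed.

Lemma rwithin_continuousZ (D : set R) (a : R -> R[i]) (f : R -> X) :
  {within D, continuous (a : R -> R[i]^o)} -> {within D, continuous f} ->
  {within D, continuous (fun t => a t *: f t)}.
Proof.
by move=> ca cf t; apply: cvgZ; [exact: ca|exact: cf].
Qed.

Lemma complex_continuous (D : set R) (a : R -> R[i]) :
  {within D, continuous (fun t => complex.Re (a t))} ->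
  {within D, continuous (fun t => complex.Im (a t))} ->
  {within D, continuous (a : R -> R[i]^o)}.
Proof.
move=> /within_contP cr /within_contP ci; apply/rwithin_contP => t Dt e e0.
have e2 : 0 < e / 2 by rewrite divr_gt0.
have [d1 d10 h1] := cr t Dt _ e2; have [d2 d20 h2] := ci t Dt _ e2.
exists (Num.min d1 d2); first by rewrite lt_min d10.
move=> u Du; rewrite lt_min => /andP[ud1 ud2].
have := h1 u Du ud1; have := h2 u Du ud2.
rewrite -cImN -cReN -cImD -cReD => i1 i2.
rewrite rnorm_cmod (le_lt_trans (cmod_le_ReIm _))//.
by rewrite [e]splitr addrC ltrD.
Qed.

Lemma cexp_affine_continuous z a0 a1 :
  {within Rp, continuous ((fun u => cexp (z * affine a0 a1 u)) : R -> R[i]^o)}.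
Proof.
pose p := complex.Re (z * a0); pose q := complex.Re (z * a1).
pose p' := complex.Im (z * a0); pose q' := complex.Im (z * a1).
have E u : z * affine a0 a1 u = (p + u * q) +i* (p' + u * q').
  by rewrite /affine mulrDr mulrCA; apply: complex_eq;
    rewrite ?cReD ?cImD ?cRe_realM ?cIm_realM.
have cRe : continuous (fun u => complex.Re (cexp (z * affine a0 a1 u))).
  rewrite [X in continuous X](_ : _ = fun u : R =>
    expR (p + u * q) * cos (p' + u * q')); last first.
    by apply/funext => r; rewrite E /cexp /= mul0r subr0.
  by move=> u; exact: is_derive_continuous.
have cIm : continuous (fun u => complex.Im (cexp (z * affine a0 a1 u))).
  rewrite [X in continuous X](_ : _ = fun u : R =>
    expR (p + u * q) * sin (p' + u * q')); last first.
    by apply/funext => r; rewrite E /cexp /= mul0r addr0.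
  by move=> u; exact: is_derive_continuous.
by apply: complex_continuous; apply: continuous_subspaceT.
Qed.

Lemma affine_continuous a0 a1 : {within Rp, continuous (affine a0 a1 : R -> R[i]^o)}.
Proof.
have E u : affine a0 a1 u =
    (complex.Re a0 + u * complex.Re a1) +i* (complex.Im a0 + u * complex.Im a1).
  by rewrite /affine; apply: complex_eq; rewrite ?cReD ?cImD ?cRe_realM ?cIm_realM.
apply: complex_continuous; apply: continuous_subspaceT.
- rewrite [X in continuous X](_ : _ = fun u => complex.Re a0 + u * complex.Re a1).
    by move=> u; exact: is_derive_continuous.
  by apply/funext => r; rewrite E.
- rewrite [X in continuous X](_ : _ = fun u => complex.Im a0 + u * complex.Im a1).
    by move=> u; exact: is_derive_continuous.
  by apply/funext => r; rewrite E.
Qed.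

Lemma subexp_affine B a0 a1 : subexp_family B ->
  subexp_family (fun u v => affine a0 a1 u *: B u v).
Proof.
move=> [Blin Bcont Bgrowth]; split.
- by move=> u u0 a x y; rewrite Blin// scalerDr !scalerA mulrC.
- by move=> v; apply: rwithin_continuousZ => //; exact: affine_continuous.
- move=> k k0; have k2 : 0 < k / 2 by rewrite divr_gt0.
  have [C C0 hC] := Bgrowth _ k2; have [C' C'0 hC'] := affine_growth a0 a1 k2.
  exists (C' * C); first exact: mulr_ge0.
  move=> u v u0; rewrite rnormZ.
  rewrite (le_trans (ler_pM (cmod_ge0 _) (rnorm_ge0 _) (hC' u u0) (hC u v u0)))//.
  rewrite [in leRHS](splitr k) mulrDl expRD le_eqVlt; apply/orP; left; apply/eqP; ring.
Qed.

Definition laplace_kernel B a0 a1 z v (u : R) : X := cexp (z * affine a0 a1 u) *: B u v.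

Lemma cmod_cexp_affine z a0 a1 u :
  cmod (cexp (z * affine a0 a1 u)) =
  expR (complex.Re (z * a0)) * expR (u * complex.Re (z * a1)).
Proof.
rewrite cmod_cexp -expRD /affine mulrDr cReD mulrCA; congr (expR (_ + _)).
by rewrite cRe_realM.
Qed.

Lemma laplace_kernel_continuous B a0 a1 z v : subexp_family B ->
  {within Rp, continuous (laplace_kernel B a0 a1 z v)}.
Proof.
move=> sB; apply: rwithin_continuousZ; last exact: sub_continuous.
exact: cexp_affine_continuous.
Qed.

Lemma laplace_kernel_decay B a0 a1 z : subexp_family B -> complex.Re (z * a1) < 0 ->
  exists C k : R, [/\ 0 <= C, 0 < k & forall v u, 0 <= u ->
    rnorm (laplace_kernel B a0 a1 z v u) <= C * rnorm v * expR (- (k * u))].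
Proof.
move=> sB zn; pose p := - complex.Re (z * a1).
have p2 : 0 < p / 2 by rewrite divr_gt0// oppr_gt0.
have [C C0 hC] := sub_growth sB p2.
exists (expR (complex.Re (z * a0)) * C), (p / 2); split => //.
  by rewrite mulr_ge0// expR_ge0.
move=> v u u0; rewrite rnormZ cmod_cexp_affine.
have -> : u * complex.Re (z * a1) = - (p / 2 * u) - p / 2 * u by rewrite /p; field.
have h : expR (- (p / 2 * u)) * rnorm (B u v) <= C * rnorm v.
  rewrite expRN mulrC ler_pdivrMr ?expR_gt0// (le_trans (hC u v u0))//.
  by rewrite -!mulrA ler_wpM2l// mulrC.
rewrite expRD; set r := expR (complex.Re (z * a0)); set E := expR _ in h *.
have -> : r * (E * E) * rnorm (B u v) = (r * E) * (E * rnorm (B u v)) by ring.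
have -> : r * C * rnorm v * E = (r * E) * (C * rnorm v) by ring.
by rewrite ler_wpM2l// mulr_ge0// expR_ge0.
Qed.

Lemma laplace_op_exists B a0 a1 z : subexp_family B -> complex.Re (z * a1) < 0 ->
  exists J : {linear X -> X}, forall v, wint Rp (laplace_kernel B a0 a1 z v) (J v).
Proof.
move=> sB zn; have [C [k [C0 k0 hC]]] := laplace_kernel_decay a0 sB zn.
have ex v : exists x, wint Rp (laplace_kernel B a0 a1 z v) x.
  apply: (@wint_exists _ _ _ (C * rnorm v) k) => //; last by move=> u u0; exact: hC.
  exact: laplace_kernel_continuous.
have [T hT] := choice ex.
have [J hJ] : exists J : {linear X -> X}, forall v, J v = T v.
  apply: pack_linear => a x y; apply: (wint_unique (hT _)).
  have h := wint_scaleD a (measurable_itv _) (hT x) (hT y).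
  apply: eq_wint h; first exact: measurable_itv.
  move=> u /[!inE]/Rpos_itv u0; rewrite /laplace_kernel (sub_linear sB)// scalerDr.
  by rewrite !scalerA mulrC.
by exists J => v; rewrite hJ.
Qed.

(** The integral exists as a linear operator only where the exponential decays; the zero
operator is a default value elsewhere. *)
Definition laplace_op B a0 a1 z : {linear X -> X} :=
  if pselect (exists J : {linear X -> X}, forall v, wint Rp (laplace_kernel B a0 a1 z v) (J v))
  is left h then sval (cid h) else \0.

Lemma laplace_opP B a0 a1 z : subexp_family B -> complex.Re (z * a1) < 0 ->
  forall v, wint Rp (laplace_kernel B a0 a1 z v) (laplace_op B a0 a1 z v).
Proof.
move=> sB zn; rewrite /laplace_op; case: pselect => [h|]; first by case: cid.
by have := laplace_op_exists a0 sB zn.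
Qed.

Lemma laplace_op_continuous B a0 a1 z : subexp_family B -> complex.Re (z * a1) < 0 ->
  continuous (laplace_op B a0 a1 z).
Proof.
move=> sB zn; have [C [k [C0 k0 hC]]] := laplace_kernel_decay a0 sB zn.
have b v : rnorm (laplace_op B a0 a1 z v) <= C * k^-1 * rnorm v.
  have := wint_bound (measurable_itv _) (laplace_opP a0 sB zn v)
    (RintegrableZ (C * rnorm v) (measurable_itv _) (integrable_expRN k0)).
  rewrite RintegralZl//; last exact: integrable_expRN.
  by rewrite Rintegral_expRN// mulrAC; apply => u /Rpos_itv; exact: hC.
exact: rnorm_bounded_continuous b.
Qed.

(** Differentiation under the integral sign, in operator norm: the Taylor remainder of
e^(h a) is at most |h a|^2 e^(|h a|), and for small h the exponential decay absorbs
the growth of all the other factors. *)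
Theorem laplace_op_derive B a0 a1 z : subexp_family B -> complex.Re (z * a1) < 0 ->
  is_op_derive (laplace_op B a0 a1) z
    (laplace_op (fun u v => affine a0 a1 u *: B u v) a0 a1 z).
Proof.
move=> sB zn; have saB := subexp_affine a0 a1 sB.
pose p := - complex.Re (z * a1).
have p0 : 0 < p by rewrite oppr_gt0.
have p4 : 0 < p / 4 by rewrite divr_gt0.
have p8 : 0 < p / 8 by rewrite divr_gt0.
have [C C0 hC] := sub_growth sB p4.
have [C1 C10 hC1] := affine_growth a0 a1 p8.
pose K := expR (complex.Re (z * a0) + cmod a0) * C1 ^+ 2 * C * (p / 4)^-1.
have K0 : 0 <= K by rewrite !mulr_ge0 ?expR_ge0 ?sqr_ge0// invr_ge0 ltW.
move=> e e0.
exists (Num.min (Num.min 1 (p / 4 / (cmod a1 + 1))) (e / (K + 1))).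
  by rewrite !lt_min ltr01 !divr_gt0 ?ltr_wpDl ?cmod_ge0.
move=> h h0; rewrite !lt_min => /andP[/andP[h1 hp] hK] v.
have ha1 : cmod h * cmod a1 <= p / 4.
  move: hp; rewrite ltr_pdivlMr ?ltr_wpDl ?cmod_ge0// => /ltW; apply: le_trans.
  by rewrite ler_wpM2l ?cmod_ge0// lerDl.
have zhn : complex.Re ((z + h) * a1) < 0.
  rewrite mulrDl cReD.
  have := le_trans (Re_le_cmod (h * a1)) _; rewrite cmodM => /(_ _ ha1).
  rewrite ler_norml /p => /andP[_]; move: zn; lra.
have w1 := laplace_opP a0 sB zhn v; have w2 := laplace_opP a0 sB zn v.
have w3 := wintZ h (laplace_opP a0 saB zn v).
have w := wintB (measurable_itv _) (wintB (measurable_itv _) w1 w2) w3.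
set Delta := _ - _ in w.
have -> : h^-1 *: (laplace_op B a0 a1 (z + h) v - laplace_op B a0 a1 z v) -
  laplace_op (fun u v => affine a0 a1 u *: B u v) a0 a1 z v = h^-1 *: Delta.
  by rewrite /Delta [in RHS]scalerBr scalerA mulVf// scale1r.
suff DK : rnorm Delta <= cmod h ^+ 2 * K * rnorm v.
  rewrite rnormZ cmodV ler_pdivrMl ?cmod_gt0// (le_trans DK)//.
  have -> : cmod h ^+ 2 * K * rnorm v = cmod h * (cmod h * K * rnorm v) by ring.
  rewrite ler_wpM2l ?cmod_ge0// ler_wpM2r ?rnorm_ge0//.
  move: hK; rewrite ltr_pdivlMr ?ltr_wpDl// => /ltW; apply: le_trans.
  by rewrite ler_wpM2l ?cmod_ge0// lerDl.
have ie := RintegrableZ (cmod h ^+ 2 * rnorm v *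
  (expR (complex.Re (z * a0) + cmod a0) * C1 ^+ 2 * C)) (measurable_itv _) (integrable_expRN p4).
have -> : cmod h ^+ 2 * K * rnorm v = \int[mu]_(u in Rp) ((cmod h ^+ 2 * rnorm v *
  (expR (complex.Re (z * a0) + cmod a0) * C1 ^+ 2 * C)) * expR (- (p / 4 * u))).
  rewrite RintegralZl//; last exact: integrable_expRN.
  rewrite Rintegral_expRN// /K; ring.
apply: (wint_bound (measurable_itv _) w ie) => u /Rpos_itv u0.
rewrite /laplace_kernel; set a := affine a0 a1 u.
have -> : cexp ((z + h) * a) *: B u v - cexp (z * a) *: B u v -
  h *: (cexp (z * a) *: (a *: B u v)) =
  (cexp (z * a) * (cexp (h * a) - 1 - h * a)) *: B u v.
  rewrite !scalerA -!scalerBl; congr (_ *: _).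
  rewrite mulrDl cexpD; ring.
rewrite rnormZ cmodM cmod_cexp_affine.
have ta := cexp_taylor2 (h * a).
have ca : cmod a <= C1 * expR (p / 8 * u) by exact: hC1.
have cha : cmod (h * a) <= cmod a0 + p / 4 * u.
  rewrite cmodM (le_trans (ler_wpM2l (cmod_ge0 h) (cmod_affine a0 a1 u0)))// mulrDr lerD//.
    by rewrite ler_piMl ?cmod_ge0// ltW.
  by rewrite mulrCA [leRHS]mulrC ler_wpM2l.
have t1 : cmod (cexp (h * a) - 1 - h * a) <=
    cmod h ^+ 2 * (C1 * expR (p / 8 * u)) ^+ 2 * expR (cmod a0 + p / 4 * u).
  rewrite (le_trans ta)// ler_pM ?expR_ge0 ?sqr_ge0//; last by rewrite ler_expR.
  rewrite -exprMn ler_pXn2r ?nnegrE ?cmod_ge0 ?mulr_ge0 ?cmod_ge0 ?expR_ge0//.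
  by rewrite cmodM ler_wpM2l ?cmod_ge0.
have t2 := ler_pM (mulr_ge0 (mulr_ge0 (expR_ge0 (complex.Re (z * a0)))
  (expR_ge0 (u * complex.Re (z * a1)))) (cmod_ge0 _)) (rnorm_ge0 _)
  (ler_wpM2l (mulr_ge0 (expR_ge0 (complex.Re (z * a0)))
    (expR_ge0 (u * complex.Re (z * a1)))) t1) (hC u v u0).
rewrite (le_trans t2)// le_eqVlt; apply/orP; left; apply/eqP.
have -> : u * complex.Re (z * a1) = - (p / 4 * u) - p / 4 * u - p / 8 * u - p / 8 * u
  - p / 4 * u by rewrite /p; field.
rewrite exprMn !expRD !expRN.
have E1 := lt0r_neq0 (expR_gt0 (p / 4 * u)); have E2 := lt0r_neq0 (expR_gt0 (p / 8 * u)).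
by field; rewrite E1 E2.
Qed.

End laplace_operators.

(** * The Laplace transform of a cosine family *)
Section half_line_limits.
Variable R : realType.
Notation mu := (@lebesgue_measure R).
Notation Rp := (`[0%R, +oo[%classic : set R).

Lemma Rintegral_itv_cvg (f : R -> R) : mu.-integrable Rp (EFin \o f) ->
  \int[mu]_(t in `[0%R, n%:R]) f t @[n --> \oo] --> \int[mu]_(t in Rp) f t.
Proof.
move=> jf; pose f_ (n : nat) t := \1_(`[0%R, n%:R]%classic : set R) t * f t.
have mf := integrable_measurable jf.
have mf_ n : measurable_fun Rp (f_ n).
  by apply: measurable_funM => //; exact: measurable_indic.
have ja : mu.-integrable Rp (EFin \o (fun t => `|f t|)).
  apply: eq_integrable (integrable_abse jf) => // t _.
have h := @Rdominated_convergence _ Rp f_ f (fun t => `|f t|) (measurable_itv _) mf_ mf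
  _ ja _.
have -> : (fun n => \int[mu]_(t in `[0%R, n%:R]) f t) = (fun n => \int[mu]_(t in Rp) f_ n t).
  apply/funext => n.
  rewrite (_ : `[0%R, n%:R]%classic = Rp `&` `[0%R, n%:R]%classic); last first.
    apply/seteqP; split => [t /= /[dup] tn|t []//]; rewrite !in_itv /= => /andP[t0 _].
    by rewrite andbT.
  rewrite Rintegral_mkcondr; apply: eq_Rintegral => t _.
  by rewrite /f_ /patch indicE; case: ifP; rewrite ?mul1r ?mul0r.
apply: h => [t /Rpos_itv t0|n t _].
  apply: cvg_near_cst.
  have : \forall n \near \oo, t < n%:R by exact: nbhs_infty_gtr.
  apply: filterS => n tn; rewrite /f_ indicE mem_set ?mul1r//=.
  by rewrite in_itv /= t0 ltW.
by rewrite /f_ indicE normrM; case: (_ \in _); rewrite ?normr1 ?normr0 ?mul1r ?mul0r.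
Qed.

Lemma cvg_exp_growth (f : R -> R) (C k : R) : 0 < k ->
  (forall t, 0 <= t -> `|f t| <= C * expR (- (k * t))) -> f n%:R @[n --> \oo] --> 0.
Proof.
move=> k0 fC.
have h : C * expR (- (k * n%:R)) @[n --> \oo] --> 0.
  rewrite -(mulr0 C); apply: cvgM; first exact: cvg_cst.
  have kn : (k * n%:R : R) @[n --> \oo] --> +oo.
    have kr : k * r @[r --> +oo] --> +oo by apply: gt0_cvgMry => //; exact: cvg_id.
    exact: (cvg_comp _ _ (@cvgr_idn R) kr).
  exact: (cvg_comp _ _ kn (@cvgr_expR R)).
apply/cvgrPdist_lt => e e0; have /cvgrPdist_lt/(_ e e0) := h.
apply: filterS => n; rewrite !sub0r !normrN; apply: le_lt_trans.
by rewrite (le_trans (fC _ _))// ler_norm.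
Qed.

Lemma Rintegral_FTC_decay (f F : R -> R) (C k : R) : 0 < k ->
  mu.-integrable Rp (EFin \o f) -> {within Rp, continuous f} -> {within Rp, continuous F} ->
  (forall t : R, 0 < t -> is_derive t 1 F (f t)) ->
  (forall t, 0 <= t -> `|F t| <= C * expR (- (k * t))) ->
  \int[mu]_(t in Rp) f t = - F 0.
Proof.
move=> k0 jf cf cF dF FC.
have h1 := Rintegral_itv_cvg jf.
have h2 : F n%:R - F 0 @[n --> \oo] --> 0 - F 0.
  by apply: cvgB; [exact: cvg_exp_growth FC|exact: cvg_cst].
suff h3 : \int[mu]_(t in `[0%R, n%:R]) f t @[n --> \oo] --> 0 - F 0.
  by rewrite -[RHS]sub0r -(cvg_lim _ h1)// -(cvg_lim _ h3).
apply: cvg_trans h2; apply: near_eq_cvg; exists 1%N => // n /= n1.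
have n0 : 0 < n%:R :> R by rewrite ltr0n.
have sub : `[0%R, n%:R]%classic `<=` Rp.
  by move=> t /=; rewrite !in_itv /= => /andP[->].
rewrite /Rintegral (@continuous_FTC2 _ f F)//.
- exact: continuous_subspaceW cf.
- have /(continuous_within_itvP _ n0)[_ cl cr] := continuous_subspaceW sub cF.
  split => //.
  move=> t; rewrite in_itv /= => /andP[t0 _]; apply: ex_derive; exact: dF.
- move=> t; rewrite in_itv /= => /andP[t0 _]; apply: derive1_is_derive; exact: dF.
Qed.

End half_line_limits.

Section cosine_laplace.
Variables (R : realType) (X : completeNormedModType R[i]).
Notation mu := (@lebesgue_measure R).
Notation Rp := (`[0%R, +oo[%classic : set R).

Lemma rderive_is_derive (u : R -> X) (t : R) (w : X) (l : rfun X) : 0 < t ->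
  is_rderive u t w -> is_derive t 1 (fun r => l (u r)) (l w).
Proof.
move=> t0 uw.
have lw : l ((h^-1)%:C *: (u (t + h) - u t)) @[h --> within [set h | 0 <= t + h] 0^'] --> l w.
  exact: rf_cvg.
have h : (fun h : R => h^-1 *: (l (u (h *: 1 + t)) - l (u t))) @ 0^' --> l w.
  apply/cvgrPdist_lt => e e0; have /cvgrPdist_lt/(_ e e0) := lw.
  rewrite !near_withinE => H.
  have ht : \forall h \near (0 : R), `|h| < t.
    exact: nbhs0_lt.
  near=> h => h0.
  rewrite /GRing.scale /= mulr1 -rfB -rfZ [h + t]addrC.
  have : h != 0 -> 0 <= t + h -> `|l w - l ((h^-1)%:C *: (u (t + h) - u t))| < e by near: h.
  apply => //.
  have : `|h| < t by near: h.
  rewrite ltr_norml => /andP[]; lra.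
have dv : derivable (fun r => l (u r)) t 1 by apply/cvg_ex; exists (l w).
by apply: DeriveDef => //; apply/cvg_lim.
Unshelve. all: end_near. Qed.

(** The one-sided derivative at 0 is enough for continuity on the closed half-line. *)
Lemma rderive_cont (u u' : R -> X) :
  (forall t, 0 <= t -> is_rderive u t (u' t)) -> {within Rp, continuous u}.
Proof.
move=> du; apply/rwithin_contP => t /Rpos_itv t0 e e0.
have /rcvgP/(_ 1 ltr01) := du t t0.
rewrite !near_withinE => /nbhs_ballP[d /= d0 hd].
pose K := rnorm (u' t) + 1.
have K0 : 0 < K by rewrite ltr_wpDl ?rnorm_ge0.
exists (Num.min d (e / K)); first by rewrite lt_min d0 divr_gt0.
move=> r /Rpos_itv r0; rewrite lt_min => /andP[rd re].
have [->|rt] := eqVneq r t; first by rewrite subrr rnorm0.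
have rt0 : r - t != 0 by rewrite subr_eq0.
have := hd (r - t); rewrite /ball /= sub0r normrN => /(_ rd rt0).
have -> : t + (r - t) = r by ring.
move=> /(_ r0) h.
have {}h : rnorm ((r - t)^-1%:C *: (u r - u t)) < K.
  rewrite -(subrK (u' t) (_ *: _)) (le_lt_trans (rnormD _ _))// /K addrC ltrD2l//.
move: h; rewrite rnormZ cmod_real normfV ltr_pdivrMl ?normr_gt0// => /lt_trans; apply.
by rewrite -ltr_pdivlMr.
Qed.

Variables (A : unbounded_operator X) (Cs : R -> {linear X -> X}) (M : R).
Hypotheses (hC : cosine_family A Cs).
Hypothesis CM : forall t v, 0 <= t -> rnorm (Cs t v) <= M * rnorm v.
Hypothesis M0 : 0 <= M.

Lemma cosine_subexp : subexp_family Cs.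
Proof.
split.
- by move=> u u0 a x y; rewrite linearP.
- exact: (scf_continuous (cos_scf hC)).
- move=> k k0; exists M => // u v u0.
  rewrite (le_trans (CM _ u0))// ler_wpM2r ?rnorm_ge0// ler_peMr//.
  by rewrite -expR0 ler_expR mulr_ge0// ltW.
Qed.

Definition cosine_laplace (z : R[i]) : {linear X -> X} := laplace_op Cs 0 (-1) z.

Lemma cosine_laplaceP z v : 0 < complex.Re z ->
  wint Rp (fun u => cexp (- (z * u%:C)) *: Cs u v) (cosine_laplace z v).
Proof.
move=> z0; have h := @laplace_opP _ _ Cs 0 (-1) z cosine_subexp.
have zn : complex.Re (z * -1) < 0 by rewrite mulrN1 cReN oppr_lt0.
apply: eq_wint (h zn v); first exact: measurable_itv.
by move=> u _; rewrite /laplace_kernel /affine add0r mulrN1 mulrN.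
Qed.

Lemma cosine_laplace_bound z v : 0 < complex.Re z ->
  rnorm (cosine_laplace z v) <= M / complex.Re z * rnorm v.
Proof.
move=> z0.
have := wint_bound (measurable_itv _) (cosine_laplaceP v z0)
  (RintegrableZ (M * rnorm v) (measurable_itv _) (integrable_expRN z0)).
rewrite RintegralZl//; last exact: integrable_expRN.
rewrite Rintegral_expRN// mulrAC; apply => u /Rpos_itv u0.
rewrite rnormZ cmod_cexp mulrC cReN [z * _]mulrC cRe_realM [u * _]mulrC.
by rewrite ler_wpM2r ?expR_ge0// CM.
Qed.

(** L lam = lam (lam^2 - A)^-1, obtained by integrating by parts twice:
e^(-lam t) (y' + lam y) is a primitive of e^(-lam t) (y'' - lam^2 y), it takes the
value lam l(w) at 0, and it decays because y' grows at most linearly. *)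
Lemma cosine_resolvent (lam : R) w : 0 < lam -> opdom A w ->
  (lam ^+ 2)%:C *: cosine_laplace lam%:C w - cosine_laplace lam%:C (A w) = lam%:C *: w.
Proof.
move=> lam0 Aw; apply: rf_eq => l.
have [u' [u'0 du du']] := cos_ode hC Aw.
pose y t := l (Cs t w); pose y1 t := l (u' t); pose y2 t := l (Cs t (A w)).
have AC t : 0 <= t -> A (Cs t w) = Cs t (A w).
  by move=> t0; rewrite (cf_comm (cos_comm hC)).
have dy (t : R) : 0 < t -> is_derive t 1 y (y1 t).
  by move=> t0; apply: rderive_is_derive => //; apply: du; exact: ltW.
have dy1 (t : R) : 0 < t -> is_derive t 1 y1 (y2 t).
  by move=> t0; apply: rderive_is_derive => //; rewrite -AC ?ltW//; apply: du'; exact: ltW.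
have cX (u : R -> X) : {within Rp, continuous u} -> {within Rp, continuous (fun t => l (u t))}.
  by move=> cu t; apply: rf_cvg; exact: cu.
have cy : {within Rp, continuous y} by apply: cX; exact: rderive_cont du.
have cy1 : {within Rp, continuous y1} by apply: cX; exact: rderive_cont du'.
have cy2 : {within Rp, continuous y2} by apply: cX; exact: (scf_continuous (cos_scf hC)).
have lam_re : 0 < complex.Re lam%:C by [].
have kE v t : l (cexp (- (lam%:C * t%:C)) *: Cs t v) = expR (- (lam * t)) * l (Cs t v).
  by rewrite -rmorphM -rmorphN cexp_real rfZ.
have [i1 e1] := cosine_laplaceP w lam_re l.
have [i2 e2] := cosine_laplaceP (A w) lam_re l.
pose F t := expR (- (lam * t)) * (y1 t + lam * y t).
pose f t := expR (- (lam * t)) * y2 t - lam ^+ 2 * (expR (- (lam * t)) * y t).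
have ce : {within Rp, continuous (fun t : R => expR (- (lam * t)))}.
  by apply: continuous_subspaceT => t; exact: is_derive_continuous.
have cF : {within Rp, continuous F}.
  move=> t; apply: cvgM; first exact: ce.
  by apply: cvgD; [exact: cy1|apply: cvgM; [exact: cvg_cst|exact: cy]].
have cf : {within Rp, continuous f}.
  move=> t; apply: cvgB; first by apply: cvgM; [exact: ce|exact: cy2].
  by apply: cvgM; [exact: cvg_cst|apply: cvgM; [exact: ce|exact: cy]].
have i1' : mu.-integrable Rp (EFin \o (fun t => expR (- (lam * t)) * y t)).
  by apply: eq_integrable i1 => // t _; rewrite /= kE.
have i2' : mu.-integrable Rp (EFin \o (fun t => expR (- (lam * t)) * y2 t)).
  by apply: eq_integrable i2 => // t _; rewrite /= kE.
have i1l := RintegrableZ (lam ^+ 2) (measurable_itv _) i1'.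
have jf : mu.-integrable Rp (EFin \o f).
  apply: eq_integrable (integrableB _ i2' i1l) => //.
pose Y := rf_norm l * (M * rnorm w); pose Y2 := rf_norm l * (M * rnorm (A w)).
have Y0 : 0 <= Y by rewrite !mulr_ge0 ?rf_norm_ge0 ?rnorm_ge0.
have Y20 : 0 <= Y2 by rewrite !mulr_ge0 ?rf_norm_ge0 ?rnorm_ge0.
have yb t : 0 <= t -> `|y t| <= Y.
  by move=> t0; rewrite (le_trans (rf_bound _ _))// ler_wpM2l ?rf_norm_ge0// CM.
have y2b t : 0 <= t -> `|y2 t| <= Y2.
  by move=> t0; rewrite (le_trans (rf_bound _ _))// ler_wpM2l ?rf_norm_ge0// CM.
have y10 : y1 0 = 0 by rewrite /y1 u'0 rf0.
have y1b t : 0 <= t -> `|y1 t| <= Y2 * t.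
  rewrite le_eqVlt => /predU1P[<-|t0]; first by rewrite y10 normr0 mulr0.
  have sub : `[0%R, t]%classic `<=` Rp by move=> r /=; rewrite !in_itv /= => /andP[->].
  have [|xi] := MVT t0 _ (continuous_subspaceW sub cy1) (df := y2).
    by move=> x; rewrite in_itv /= => /andP[x0 _]; exact: dy1.
  rewrite in_itv /= => /andP[xi0 _]; rewrite y10 !subr0 => ->.
  rewrite normrM (ger0_norm (ltW t0)) ler_wpM2r ?(ltW t0)//; by rewrite y2b// ltW.
clearbody Y Y2.
have Fb t : 0 <= t ->
    `|F t| <= (Y2 * (lam / 2)^-1 + lam * Y) * expR (- (lam / 2 * t)).
  move=> t0; have l2 : 0 < lam / 2 by rewrite divr_gt0.
  have E1 : 1 <= expR (lam / 2 * t) by rewrite (le_trans _ (expR_ge1Dx _))// lerDl mulr_ge0// ltW.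
  have tE : t <= (lam / 2)^-1 * expR (lam / 2 * t).
    by rewrite mulrC ler_pdivlMr// mulrC (le_trans _ (expR_ge1Dx _))// lerDr.
  rewrite normrM ger0_norm ?expR_ge0//.
  set P := expR (lam / 2 * t) in E1 tE *.
  have PP : expR (- (lam * t)) = P^-1 * P^-1.
    by rewrite -!expRN -expRD; congr expR; field.
  rewrite PP expRN -/P -mulrA [leRHS]mulrC ler_wpM2l ?invr_ge0 ?expR_ge0//.
  rewrite mulrC ler_pdivrMr ?expR_gt0//.
  rewrite (le_trans (ler_normD _ _))// mulrDl lerD//.
    by rewrite (le_trans (y1b _ t0))// -mulrA ler_wpM2l.
  rewrite normrM (ger0_norm (ltW lam0)) -mulrA ler_wpM2l ?(ltW lam0)//.
  by rewrite (le_trans (yb _ t0))// ler_peMr.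
have dF (t : R) : 0 < t -> is_derive t 1 F (f t).
  move=> t0; have := dy t t0; have := dy1 t t0 => dy1t dyt.
  apply: is_derive_eq; rewrite /GRing.scale /= /f; ring.
have l2 : 0 < lam / 2 by rewrite divr_gt0.
have := Rintegral_FTC_decay l2 jf cf cF dF Fb.
rewrite /f RintegralB// RintegralZl// /F y10 add0r mulr0 oppr0 expR0 mul1r.
rewrite /y (cos_0 hC) => e.
rewrite rfB !rfZ e1 e2.
under eq_Rintegral do rewrite kE; under [X in _ - X = _]eq_Rintegral do rewrite kE.
move: e; lra.
Qed.

End cosine_laplace.

(** * Truncated Laplace transforms of convolutions *)
Section translation_fubini.
Variable R : realType.
Notation mu := (@lebesgue_measure R).
Let shift (a : R) : measurableTypeR R -> measurableTypeR R := fun x => x + a.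

Let shift_measurable a : measurable_fun setT (shift a).
Proof. by apply: measurable_funD. Qed.

Lemma lebesgue_measure_shift (a : R) (A : set R) : measurable A ->
  mu A = pushforward mu (shift a) A.
Proof.
apply: (@lebesgue_measure_unique R (pushforward mu (shift a))) => _ [[x y] _ <-].
rewrite /pushforward /=.
rewrite [X in _ = mu X](_ : _ = `]x - a, y - a]%classic); last first.
  by apply/seteqP; split => t /=; rewrite !in_itv /= /shift ltrBlDr lerBrDr.
by rewrite !lebesgue_measure_itv /= !lte_fin ltrD2r; case: ifP => // _; rewrite -!EFinD; congr EFin; ring.
Qed.

Lemma integrable_shift (a : R) (f : R -> R) : mu.-integrable setT (EFin \o f) ->
  mu.-integrable setT (EFin \o (fun x => f (x + a))).
Proof.
move=> jf; have mf := integrable_measurable jf.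
have mfa : measurable_fun setT (fun x : R => f (x + a)).
  by apply: (measurableT_comp mf); exact: measurable_funD.
apply/integrableP; split; first exact/measurable_EFinP.
have <- : (\int[pushforward mu (shift a)]_x `|(f x)%:E| =
           \int[mu]_x `|((f \o shift a) x)%:E|)%E.
  rewrite ge0_integral_pushforward ?preimage_setT//.
  by apply/measurable_EFinP; exact: measurableT_comp.
case/integrableP: jf => _; apply: le_lt_trans; rewrite le_eqVlt; apply/orP; left; apply/eqP.
by apply: eq_measure_integral => A mA _; exact/esym/lebesgue_measure_shift.
Qed.

Lemma Rintegral_shift (a : R) (f : R -> R) : mu.-integrable setT (EFin \o f) ->
  \int[mu]_x f (x + a) = \int[mu]_x f x.
Proof.
move=> jf; rewrite /Rintegral; congr fine.
have <- : (\int[pushforward mu (shift a)]_x (EFin \o f) x =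
           \int[mu]_x ((EFin \o f) \o shift a) x)%E.
  rewrite integral_pushforward ?preimage_setT//; last exact: integrable_shift.
  exact: (measurable_int mu).
by apply: eq_measure_integral => A mA _; exact/esym/lebesgue_measure_shift.
Qed.

(** The bound G on the absolute inner integrals gives joint integrability by Tonelli's
theorem. *)
Lemma Rfubini (f : R * R -> R) (G : R -> R) : measurable_fun setT f ->
  (forall x, mu.-integrable setT (EFin \o (fun y => f (x, y)))) ->
  (forall y, mu.-integrable setT (EFin \o (fun x => f (x, y)))) ->
  mu.-integrable setT (EFin \o G) -> (forall y, \int[mu]_x `|f (x, y)| <= G y) ->
  [/\ mu.-integrable setT (EFin \o (fun x => \int[mu]_y f (x, y))),
      mu.-integrable setT (EFin \o (fun y => \int[mu]_x f (x, y))) &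
      \int[mu]_x \int[mu]_y f (x, y) = \int[mu]_y \int[mu]_x f (x, y)].
Proof.
move=> mf fx fy jG fG.
have EF : EFin \o (fun x => \int[mu]_y f (x, y)) = fubini_F mu (EFin \o f).
  by apply/funext => x; rewrite /= /Rintegral fineK//; apply: integrable_fin_num => //; exact: fx.
have EG : EFin \o (fun y => \int[mu]_x f (x, y)) = fubini_G mu (EFin \o f).
  by apply/funext => x; rewrite /= /Rintegral fineK//; apply: integrable_fin_num => //; exact: fy.
have mEf : measurable_fun setT (EFin \o f) by exact/measurable_EFinP.
have jf : (mu \x mu)%E.-integrable setT (EFin \o f).
  apply/integrable21ltyP => //.
  case/integrableP: jG => mG; apply: le_lt_trans; apply: ge0_le_integral => //.
  - by move=> y _; apply: integral_ge0.
  - apply: (@measurable_fun_fubini_tonelli_G _ _ _ _ _ mu (abse \o (EFin \o f))) => //.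
      exact: measurableT_comp.
    by move=> x; exact: abse_ge0.
  - exact: measurableT_comp.
  - move=> y _; rewrite /= -[leLHS]fineK.
      by rewrite lee_fin (le_trans (fG y))// ler_norm.
    by apply: integrable_fin_num => //; exact: (integrable_abse (fy y)).
split; [by rewrite EF; exact: integrable_fubini_F| |].
  apply: (dominated_integrable _ _ jG) => //.
    by apply/measurable_EFinP; rewrite EG; exact: (measurable_fubini_G jf).
  by move=> y _; rewrite (le_trans (le_normr_Rintegral _ (fy y))).
have := Fubini jf; rewrite /Rintegral => h.
by congr fine; rewrite -[LHS]/(\int[mu]_x (EFin \o (fun x => \int[mu]_y f (x, y))%R) x)%E EF
  -[RHS]/(\int[mu]_x (EFin \o (fun y => \int[mu]_x f (x, y))%R) x)%E EG.
Qed.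

End translation_fubini.

Section indicator_integrals.
Variable R : realType.

Lemma expRN_le1 (x : R) : 0 <= x -> expR (- x) <= 1.
Proof. by move=> x0; rewrite -[leRHS]expR0 ler_expR oppr_le0. Qed.

Notation mu := (@lebesgue_measure R).
Implicit Types (D : set R) (f g : R -> R).

Lemma measurable_expRN D (c : R) : measurable_fun D (fun t : R => expR (- (c * t))).
Proof.
apply: measurable_funTS; apply: continuous_measurable_fun => t.
exact: is_derive_continuous.
Qed.

Lemma indic_patch D f : (fun t => \1_D t * f t) = f \_ D.
Proof.
by apply/funext => t; rewrite /patch indicE; case: (t \in D); rewrite ?mul1r ?mul0r.
Qed.

Lemma integrable_indicM D f : measurable D -> mu.-integrable D (EFin \o f) ->
  mu.-integrable setT (EFin \o (fun t => \1_D t * f t)).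
Proof.
move=> mD jf; rewrite indic_patch -restrict_EFin.
by apply/integrable_restrict; rewrite ?setTI.
Qed.

Lemma Rintegral_indicM D f : \int[mu]_(t in D) f t = \int[mu]_t (\1_D t * f t).
Proof. by rewrite indic_patch Rintegral_mkcond. Qed.

Lemma integrable_norm D f : measurable D -> mu.-integrable D (EFin \o f) ->
  mu.-integrable D (EFin \o (fun t => `|f t|)).
Proof. by move=> mD jf; apply: eq_integrable (integrable_abse jf). Qed.

Lemma integrable_itv_cst (a b c : R) : mu.-integrable `[a, b] (EFin \o (fun=> c)).
Proof.
apply: measurable_bounded_integrable => //=; last exact: bounded_cst.
by rewrite lebesgue_measure_itv/=; case: ifP => _ //; rewrite -EFinD ltry.
Qed.

End indicator_integrals.

Section volterra_laplace.
Variable R : realType.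
Notation mu := (@lebesgue_measure R).
Notation Rp := (`[0%R, +oo[%classic : set R).
Variables (k m p : R -> R) (T N s : R).
Hypotheses (T0 : 0 < T) (s1 : 1 <= s).
Hypothesis ik : mu.-integrable Rp (EFin \o (fun t => k t * expR (- t))).
Hypothesis cm : {within Rp, continuous m}.
Hypothesis mN : forall t, 0 <= t <= T -> `|m t| <= N.
Hypothesis im : forall t, 0 <= t ->
  mu.-integrable `[0, t] (EFin \o (fun tau => k (t - tau) * m tau)).
Hypothesis pE : forall t, 0 <= t -> p t = \int[mu]_(tau in `[0, t]) (k (t - tau) * m tau).

Let K := \int[mu]_(t in Rp) `|k t * expR (- t)|.
Let kh := \int[mu]_(t in Rp) (k t * expR (- (s * t))).
Let D : set R := `[0, T]%classic.
Let k1 t := \1_Rp t * (k t * expR (- (s * t))).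
Let k2 t := \1_Rp t * `|k t * expR (- t)|.
Let m1 t := \1_D t * (expR (- (s * t)) * m t).
Let f (x : R * R) := \1_D x.1 * (k1 (x.1 - x.2) * m1 x.2).

Let N0 : 0 <= N.
Proof. by apply: (le_trans (normr_ge0 (m 0))); apply: mN; rewrite lexx ltW. Qed.

Let ik2 : mu.-integrable setT (EFin \o k2).
Proof. by apply: integrable_indicM => //; apply: integrable_norm. Qed.

Let k2_int : \int[mu]_t k2 t = K.
Proof. by rewrite /K [RHS]Rintegral_indicM. Qed.

Let k12 t : `|k1 t| <= expR (- ((s - 1) * t)) * k2 t.
Proof.
rewrite /k1 /k2 indicE; case: (_ \in _); rewrite ?mul0r ?mulr0 ?normr0// !mul1r.
rewrite !normrM !(ger0_norm (expR_ge0 _)) mulrCA -expRD le_eqVlt; apply/orP; left.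
by apply/eqP; congr (_ * expR _); ring.
Qed.

Let k2_ge0 t : 0 <= k2 t.
Proof. by rewrite /k2 mulr_ge0// indicE ler0n. Qed.

Let k12' t : `|k1 t| <= k2 t.
Proof.
have [t0|t0] := leP 0 t.
  rewrite (le_trans (k12 t))// ler_piMl// expRN_le1// mulr_ge0//.
  by rewrite subr_ge0.
by rewrite /k1 indicE memNset ?mul0r ?normr0// /= in_itv /= andbT; apply/negP; rewrite -ltNge.
Qed.

Let ik1' : mu.-integrable Rp (EFin \o (fun t => k t * expR (- (s * t)))).
Proof.
apply: (dominated_integrable (g := fun t => `|k t * expR (- t)|)) => //.
- have -> : (fun t => k t * expR (- (s * t))) =
      (fun t => (k t * expR (- t)) * expR (- ((s - 1) * t))).
    by apply/funext => t; rewrite -mulrA -expRD; congr (_ * expR _); ring.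
  apply: measurable_funM; first exact: integrable_measurable ik.
  exact: measurable_expRN.
- exact: integrable_norm.
- move=> t /Rpos_itv t0; rewrite !normrM ler_wpM2l// !ger0_norm ?expR_ge0//.
  by rewrite ler_expR lerN2 ler_peMl.
Qed.

Let ik1 : mu.-integrable setT (EFin \o k1).
Proof. exact: integrable_indicM. Qed.

Let kh_int : \int[mu]_t k1 t = kh.
Proof. by rewrite /kh [RHS]Rintegral_indicM. Qed.

Let m1_bound t : `|m1 t| <= \1_D t * (expR (- (s * t)) * N).
Proof.
rewrite /m1 indicE; case: (boolP (t \in D)) => [|_]; last by rewrite !mul0r normr0.
rewrite inE /D /= in_itv /= => tD; rewrite !mul1r normrM ger0_norm ?expR_ge0//.
by rewrite ler_wpM2l ?expR_ge0// mN.
Qed.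

Let m1_boundN t : `|m1 t| <= \1_D t * N.
Proof.
rewrite (le_trans (m1_bound t))// indicE; case: (boolP (t \in D)) => [|_]; last by rewrite !mul0r.
rewrite inE /D /= in_itv /= => /andP[t0 _]; rewrite !mul1r ler_piMl// expRN_le1//.
by rewrite mulr_ge0// (le_trans ler01).
Qed.

Let DRp : D `<=` Rp.
Proof. by move=> t; rewrite /D /= !in_itv /= => /andP[->]. Qed.

Let mm1 : measurable_fun setT m1.
Proof.
rewrite /m1 indic_patch; apply/(measurable_restrictT _ _).1; first exact: measurable_itv.
apply: measurable_funM.
  exact: measurable_expRN.
apply: (measurable_funS _ DRp) => //.
by apply: subspace_continuous_measurable_fun => //; exact: measurable_itv.
Qed.

Let iDN (c : R) : mu.-integrable setT (EFin \o (fun t => \1_D t * c)).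
Proof. by apply: integrable_indicM; [exact: measurable_itv|exact: integrable_itv_cst]. Qed.

Let im1 : mu.-integrable setT (EFin \o m1).
Proof. exact: (dominated_integrable _ mm1 (iDN N)). Qed.

Let k1m1 t tau : D t -> k1 (t - tau) * m1 tau =
  \1_(`[0, t]%classic : set R) tau * (expR (- (s * t)) * (k (t - tau) * m tau)).
Proof.
rewrite /D /= in_itv /= => /andP[t0 tT].
have -> : expR (- (s * t)) = expR (- (s * (t - tau))) * expR (- (s * tau)).
  by rewrite -expRD; congr expR; ring.
rewrite /k1 /m1 !indicE.
have -> : (tau \in (`[0, t]%classic : set R)) = (t - tau \in Rp) && (tau \in D).
  have mi b x : (x \in (`[0%R, b]%classic : set R)) = (0 <= x <= b).
    by apply/idP/idP; rewrite inE /= in_itv.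
  have mR x : (x \in Rp) = (0 <= x) by apply/idP/idP; rewrite inE /= in_itv /= andbT.
  rewrite /D !mi mR subr_ge0; apply/idP/idP => [/andP[tau0 taut]|/andP[-> /andP[->]]//].
  by rewrite taut tau0 (le_trans taut).
case: (_ \in Rp); case: (_ \in D) => /=; rewrite ?(mul0r, mulr0)//; ring.
Qed.

Let fxE t : D t -> (fun tau => f (t, tau)) = (fun tau =>
  \1_(`[0, t]%classic : set R) tau * (expR (- (s * t)) * (k (t - tau) * m tau))).
Proof.
by move=> Dt; apply/funext => tau; rewrite /f /= indicE mem_set// mul1r k1m1.
Qed.

Let fx0 t : ~ D t -> (fun tau => f (t, tau)) = (fun=> 0).
Proof. by move=> Dt; apply/funext => tau; rewrite /f /= indicE memNset// mul0r. Qed.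

Let mf : measurable_fun setT f.
Proof.
have mk1 := integrable_measurable ik1.
apply: measurable_funM.
  by apply: (@measurableT_comp _ _ _ _ _ _ (\1_D : R -> R)) => //; apply: measurable_indic;
    exact: measurable_itv.
apply: measurable_funM; last exact: (measurableT_comp mm1).
by apply: (measurableT_comp mk1); exact: measurable_funB.
Qed.

Let D_itv t : D t -> 0 <= t. Proof. by rewrite /D /= in_itv /= => /andP[]. Qed.

Let fx t : mu.-integrable setT (EFin \o (fun tau => f (t, tau))).
Proof.
have [Dt|nDt] := pselect (D t); last by rewrite fx0//; exact: (integrable0 _ setT).
rewrite fxE//; apply: integrable_indicM; first exact: measurable_itv.
by apply: RintegrableZ; [exact: measurable_itv|apply: im; exact: D_itv].
Qed.

Let f_bound t tau : `|f (t, tau)| <= `|m1 tau| * `|k1 (t + - tau)|.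
Proof.
rewrite /f /= !normrM [X in _ <= X]mulrC ler_piMl ?mulr_ge0//.
by rewrite indicE; case: (_ \in _); rewrite ?normr1 ?normr0.
Qed.

Let ik1_shift tau : mu.-integrable setT (EFin \o (fun t => `|m1 tau| * `|k1 (t + - tau)|)).
Proof.
apply: RintegrableZ => //; apply: integrable_norm => //.
exact: (integrable_shift (- tau) ik1).
Qed.

Let fy tau : mu.-integrable setT (EFin \o (fun t => f (t, tau))).
Proof.
apply: (dominated_integrable _ _ (ik1_shift tau)) => //.
by apply: (measurableT_comp mf); exact: measurable_pair2.
Qed.

Let fG tau : \int[mu]_t `|f (t, tau)| <= (\int[mu]_t `|k1 t|) * `|m1 tau|.
Proof.
rewrite mulrC -(Rintegral_shift (- tau) (integrable_norm measurableT ik1)).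
rewrite -RintegralZl//; last first.
  by apply: integrable_norm => //; exact: (integrable_shift (- tau) ik1).
by apply: le_Rintegral => //; exact: integrable_norm.
Qed.

(** The transform over [0, T] of the convolution k * m is the product of the
transforms, except for the part of k beyond T - tau; there e^(-s t) is at most
e^(-(s-1) (T - tau)) e^(-t), and the missing decay in tau comes from the factor
e^(-s tau) of m. *)
Lemma volterra_laplace :
  `|\int[mu]_(t in `[0, T]) (expR (- (s * t)) * p t) -
    kh * \int[mu]_(t in `[0, T]) (expR (- (s * t)) * m t)|
  <= K * N * T * expR (- ((s - 1) * T)).
Proof.
have -> : \int[mu]_(t in `[0, T]) (expR (- (s * t)) * p t) = \int[mu]_t \int[mu]_tau f (t, tau).
  rewrite [LHS]Rintegral_indicM -/D; apply: eq_Rintegral => t _.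
  have [Dt|nDt] := pselect (D t); last first.
    by rewrite fx0// Rintegral_cst// mul0r indicE memNset// mul0r.
  rewrite fxE// -Rintegral_indicM RintegralZl//; last by apply: im; exact: D_itv.
  by rewrite indicE mem_set// mul1r -pE//; exact: D_itv.
have [_ i2 ->] := Rfubini mf fx fy
  (RintegrableZ _ measurableT (integrable_norm measurableT im1)) fG.
rewrite [X in _ - kh * X]Rintegral_indicM -/D -/m1 -(RintegralZl _ measurableT im1).
rewrite -(RintegralB measurableT i2 (RintegrableZ kh measurableT im1)).
have mi2 := integrable_measurable i2; clear i2.
pose c := N * K * expR (- ((s - 1) * T)).
have -> : K * N * T * expR (- ((s - 1) * T)) = \int[mu]_t (\1_D t * c).
  rewrite -Rintegral_indicM Rintegral_cst; last exact: measurable_itv.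
  rewrite /D /= lebesgue_measure_itv /= lte_fin T0 -EFinD /= subr0 /c; ring.
apply: Rintegral_bound => //.
  by apply: measurable_funB mi2 _; exact: measurable_funM.
move=> tau _.
have iD : mu.-integrable setT (EFin \o (fun t => \1_D t * k1 (t + - tau))).
  apply: (dominated_integrable (g := fun t => `|k1 (t + - tau)|)) => //.
  - apply: measurable_funM; first by apply: measurable_indic; exact: measurable_itv.
    exact: integrable_measurable (integrable_shift (- tau) ik1).
  - by apply: integrable_norm => //; exact: (integrable_shift (- tau) ik1).
  - move=> t _; rewrite normrM ler_piMl//.
    by rewrite indicE; case: (_ \in _); rewrite ?normr1 ?normr0.
have -> : \int[mu]_t f (t, tau) - kh * m1 tau =
    m1 tau * (\int[mu]_t (\1_D t * k1 (t + - tau)) - \int[mu]_t k1 (t + - tau)).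
  rewrite (Rintegral_shift (- tau) ik1) kh_int mulrBr [m1 tau * kh]mulrC -RintegralZl//.
  by congr (_ - _); apply: eq_Rintegral => t _; rewrite /f /=; ring.
rewrite -RintegralB//; last exact: (integrable_shift (- tau) ik1).
rewrite normrM; have [Dtau|nDtau] := pselect (D tau); last first.
  by rewrite /m1 indicE memNset// !mul0r normr0 mul0r.
have /andP[tau0 tauT] : 0 <= tau <= T by move: Dtau; rewrite /D /= in_itv.
have ik2s := integrable_shift (- tau) ik2.
have B : `|\int[mu]_t (\1_D t * k1 (t + - tau) - k1 (t + - tau))| <=
    expR (- ((s - 1) * (T - tau))) * K.
  rewrite -k2_int -(Rintegral_shift (- tau) ik2) -RintegralZl//.
  apply: Rintegral_bound => //.
  - apply: measurable_funB; first exact: integrable_measurable iD.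
    exact: integrable_measurable (integrable_shift (- tau) ik1).
  - exact: RintegrableZ.
  - move=> t _; rewrite indicE; case: (boolP (t \in D)) => [_|].
      by rewrite mul1r subrr normr0 mulr_ge0// expR_ge0.
    rewrite notin_setE /D /= in_itv /= => /negP; rewrite negb_and -!ltNge mul0r sub0r normrN.
    case/orP => [t0|tT].
      rewrite /k1 indicE memNset ?mul0r ?normr0 ?mulr_ge0 ?expR_ge0//.
      by rewrite /= in_itv /= andbT; apply/negP; rewrite -ltNge; lra.
    rewrite (le_trans (k12 _))// ler_wpM2r// ler_expR lerN2 ler_wpM2l ?subr_ge0//; lra.
rewrite (le_trans (ler_pM _ _ (m1_bound tau) B))//.
rewrite indicE mem_set// !mul1r /c.
have -> : expR (- (s * tau)) * N * (expR (- ((s - 1) * (T - tau))) * K) =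
    N * K * (expR (- tau) * expR (- ((s - 1) * T))).
  transitivity (N * K * (expR (- (s * tau)) * expR (- ((s - 1) * (T - tau))))); first by ring.
  by rewrite -!expRD; congr (_ * expR _); ring.
have K0 : 0 <= K by apply: Rintegral_ge0.
by rewrite ler_wpM2l ?mulr_ge0// ler_piMl ?expR_ge0// expRN_le1.
Qed.

End volterra_laplace.

(** * Uniqueness for truncated Laplace transforms *)
Section laplace_uniqueness.
Variable R : realType.
Notation mu := (@lebesgue_measure R).
Variables (d : R -> R) (T C s0 : R).
Hypothesis C0 : 0 <= C.
Hypothesis jd : mu.-integrable `[0, T] (EFin \o d).
Hypothesis lap_d : forall s, s0 <= s ->
  `|\int[mu]_(t in `[0, T]) (expR (- (s * t)) * d t)| <= C * s ^+ 2 * expR (- (s * T)).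

Let D : set R := `[0, T]%classic.
Let mD : measurable D. Proof. exact: measurable_itv. Qed.
Let jdD : mu.-integrable D (EFin \o d). Proof. exact: jd. Qed.

Lemma series_exp_coeff_le (x : R) N : 0 <= x -> series (exp_coeff x) N <= expR x.
Proof.
move=> x0; apply: nondecreasing_cvgn_le; last exact: is_cvg_series_exp_coeff.
by apply/nondecreasing_seqP => n; rewrite seriesSr lerDl exp_coeff_ge0.
Qed.

Lemma norm_series_exp_coeff (x : R) N : `|series (exp_coeff x) N| <= expR `|x|.
Proof.
apply: (le_trans _ (series_exp_coeff_le N (normr_ge0 x))).
rewrite /series /= (le_trans (ler_norm_sum _ _ _))//.
apply: ler_sum => i _; rewrite /exp_coeff /= normf_div normrX.
by rewrite (ger0_norm (ler0n _ _)).
Qed.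

Let mulexp_integrable (g : R -> R) (B : R) : measurable_fun D g ->
  (forall t, D t -> `|g t| <= B) -> mu.-integrable D (EFin \o (fun t => g t * d t)).
Proof.
move=> mg gB; apply: (dominated_integrable (g := fun t => B * `|d t|)) => //.
- by apply: measurable_funM => //; exact: integrable_measurable jdD.
- by apply: RintegrableZ => //; exact: integrable_norm.
- by move=> t Dt; rewrite normrM ler_wpM2r// gB.
Qed.

Variable x : R.
Hypotheses (x0 : 0 < x) (xT : x < T).
Let y := T - x.
Let y0 : 0 < y. Proof. by rewrite subr_gt0. Qed.
Let E (n : nat) t := expR (n%:R * (x - t)).

Let mE n : measurable_fun D (E n).
Proof.
apply: measurable_funTS; apply: continuous_measurable_fun => t.
exact: is_derive_continuous.
Qed.

Let E_bound n t : D t -> E n t <= expR (n%:R * x).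
Proof.
rewrite /D /= in_itv /= => /andP[t0 _].
by rewrite ler_expR ler_wpM2l ?ler0n// gerBl.
Qed.

Let coeff_integrable n j : mu.-integrable D (EFin \o (fun t => exp_coeff (- E n t) j * d t)).
Proof.
apply: (@mulexp_integrable _ (exp_coeff (expR (n%:R * x)) j)).
  rewrite /exp_coeff /=; apply: measurable_funM => //.
  apply: measurable_funX; exact: measurableT_comp.
move=> t Dt; rewrite /exp_coeff /= normf_div normrX normrN (ger0_norm (expR_ge0 _)).
rewrite (ger0_norm (ler0n _ _)) ler_wpM2r ?invr_ge0 ?ler0n//.
by rewrite lerXn2r ?nnegrE ?expR_ge0// E_bound.
Qed.

Let series_integral n N : mu.-integrable D (EFin \o (fun t => series (exp_coeff (- E n t)) N * d t)) /\
  \int[mu]_(t in D) (series (exp_coeff (- E n t)) N * d t) =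
  \sum_(0 <= j < N) \int[mu]_(t in D) (exp_coeff (- E n t) j * d t).
Proof.
elim: N => [|N [ih1 ih2]].
  have e0 : (fun t => series (exp_coeff (- E n t)) 0 * d t) = (fun=> 0).
    by apply/funext => t; rewrite /series /= big_geq// mul0r.
  rewrite e0 big_geq//; split; first exact: integrable_itv_cst.
  by rewrite Rintegral_cst// mul0r.
have eN : (fun t => series (exp_coeff (- E n t)) N.+1 * d t) =
    (fun t => series (exp_coeff (- E n t)) N * d t + exp_coeff (- E n t) N * d t).
  by apply/funext => t; rewrite seriesSr mulrDl.
rewrite eN; split; first exact: RintegrableD.
by rewrite RintegralD// ih2 big_nat_recr.
Qed.

(** The j-th term of the exponential series of - e^(n (x - t)) is a multiple of
e^(-j n t), so its integral against d is controlled by the transform at s = j n; the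
factor e^(s x) is beaten by e^(-s T), and half of the gain T - x pays for s^2. *)
Let coeff_bound n j : s0 <= n%:R -> 1 <= n%:R :> R -> (0 < j)%N ->
  `|\int[mu]_(t in D) (exp_coeff (- E n t) j * d t)| <=
  C * (4 / y) ^+ 2 * exp_coeff (expR (- (n%:R * (y / 2)))) j.
Proof.
move=> sn n1 j0; pose s : R := j%:R * n%:R.
have j1 : 1 <= j%:R :> R by rewrite ler1n.
have ss : s0 <= s by rewrite (le_trans sn)// /s ler_peMl// (le_trans ler01).
have s_ge0 : 0 <= s by rewrite mulr_ge0// (le_trans ler01).
have fE t : exp_coeff (- E n t) j * d t =
    (-1) ^+ j / j`!%:R * expR (s * x) * (expR (- (s * t)) * d t).
  rewrite /exp_coeff /E /= [in LHS]exprNn -expRM_natl.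
  have -> : j%:R * (n%:R * (x - t)) = s * x + - (s * t) by rewrite /s; ring.
  by rewrite expRD; set o := (-1) ^+ j; ring.
under eq_Rintegral do rewrite fE.
have je : mu.-integrable D (EFin \o (fun t => expR (- (s * t)) * d t)).
  apply: (@mulexp_integrable _ 1); first exact: measurable_expRN.
  move=> t; rewrite /D /= in_itv /= => /andP[t0 _].
  by rewrite ger0_norm ?expR_ge0// expRN_le1// mulr_ge0.
rewrite RintegralZl// normrM (le_trans (ler_wpM2l (normr_ge0 _) (lap_d ss)))//.
rewrite !normrM normfV normrX normrN1 expr1n mul1r (ger0_norm (ler0n _ _)).
rewrite (ger0_norm (expR_ge0 _)) /exp_coeff /= -expRM_natl.
have h : s ^+ 2 <= (4 / y) ^+ 2 * expR (s * (y / 2)).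
  have -> : s * (y / 2) = 2%:R * (s * y / 4) by field.
  have y4 : 0 < 4 / y by rewrite divr_gt0.
  have s4 : s <= 4 / y * expR (s * y / 4).
    rewrite -ler_pdivrMl// invf_div (le_trans _ (expR_ge1Dx _))//.
    have -> : y / 4 * s = s * y / 4 by ring.
    by rewrite lerDr.
  rewrite expRM_natl -exprMn ler_pXn2r// nnegrE.
  by rewrite mulr_ge0 ?expR_ge0// ltW.
have -> : j%:R * - (n%:R * (y / 2)) = s * x - s * T + s * (y / 2) by rewrite /s /y; field.
rewrite !expRD expRN.
have -> : (j`!%:R)^-1 * expR (s * x) * (C * s ^+ 2 * (expR (s * T))^-1) =
   (C * (expR (s * x) * (expR (s * T))^-1 / j`!%:R)) * s ^+ 2 by ring.
have -> : C * (4 / y) ^+ 2 * (expR (s * x) / expR (s * T) * expR (s * (y / 2)) / j`!%:R) =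
   (C * (expR (s * x) * (expR (s * T))^-1 / j`!%:R)) * ((4 / y) ^+ 2 * expR (s * (y / 2))) by ring.
by rewrite ler_wpM2l// !mulr_ge0// ?expR_ge0 ?invr_ge0 ?expR_ge0 ?ler0n.
Qed.

Let C' := C * (4 / y) ^+ 2.
Let C'0 : 0 <= C'. Proof. by rewrite mulr_ge0// sqr_ge0. Qed.

Let mexpE n : measurable_fun D (fun t => expR (- E n t)).
Proof. by apply: measurableT_comp => //; exact: measurableT_comp. Qed.

Let expE_integrable n : mu.-integrable D (EFin \o (fun t => expR (- E n t) * d t)).
Proof.
apply: (@mulexp_integrable _ 1) => // t _.
by rewrite ger0_norm ?expR_ge0// expRN_le1// expR_ge0.
Qed.

(** Summing the series: the kernel 1 - exp (- e^(n (x - t))) converges to the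
indicator function of [0, x], while its integrals against d tend to 0. *)
Let kernel_bound n : s0 <= n%:R -> 1 <= n%:R :> R ->
  `|\int[mu]_(t in D) ((1 - expR (- E n t)) * d t)| <=
  C' * (expR (expR (- (n%:R * (y / 2)))) - 1).
Proof.
move=> sn n1; set q := expR (- (n%:R * (y / 2))).
have -> : \int[mu]_(t in D) ((1 - expR (- E n t)) * d t) =
    \int[mu]_(t in D) d t - \int[mu]_(t in D) (expR (- E n t) * d t).
  rewrite -RintegralB//; apply: eq_Rintegral => t _; ring.
have h1 : \int[mu]_(t in D) (series (exp_coeff (- E n t)) N * d t) @[N --> \oo] -->
    \int[mu]_(t in D) (expR (- E n t) * d t).
  apply: (@Rdominated_convergence _ _ _ _ (fun t => expR (expR (n%:R * x)) * `|d t|)) => //.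
  - move=> N; exact: integrable_measurable (series_integral n N).1.
  - exact: integrable_measurable (expE_integrable n).
  - move=> t _; apply: cvgM; last exact: cvg_cst.
    exact: is_cvg_series_exp_coeff.
  - by apply: RintegrableZ => //; exact: integrable_norm.
  - move=> N t Dt; rewrite normrM ler_wpM2r// (le_trans (norm_series_exp_coeff _ _))//.
    by rewrite ler_expR normrN (ger0_norm (expR_ge0 _)) E_bound.
have h2 : `|\int[mu]_(t in D) d t - \int[mu]_(t in D) (series (exp_coeff (- E n t)) N * d t)|
    @[N --> \oo] --> `|\int[mu]_(t in D) d t - \int[mu]_(t in D) (expR (- E n t) * d t)|.
  by apply: cvg_norm; apply: cvgB => //; exact: cvg_cst.
apply: (cvgr_to_le h2); near=> N.
have N0 : (0 < N)%N by near: N; exists 1%N.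
rewrite (series_integral n N).2 big_ltn//.
have -> : \int[mu]_(t in D) (exp_coeff (- E n t) 0 * d t) = \int[mu]_(t in D) d t.
  by apply: eq_Rintegral => t _; rewrite /exp_coeff /= expr0 fact0 divr1 mul1r.
rewrite opprD addrA subrr sub0r normrN (le_trans (ler_norm_sum _ _ _))//.
apply: (@le_trans _ _ (\sum_(1 <= j < N) C' * exp_coeff q j)).
  rewrite big_nat_cond [leRHS]big_nat_cond; apply: ler_sum => j /andP[/andP[j0 _] _].
  exact: coeff_bound.
rewrite -mulr_sumr ler_wpM2l//.
have := series_exp_coeff_le N (expR_ge0 (- (n%:R * (y / 2)))).
rewrite /series /= big_ltn// -/q {1}/exp_coeff /= expr0 fact0 divr1; lra.
Unshelve. all: end_near. Qed.

(** The value at t = x matters only on a null set. *)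
Let step t : R := if t < x then 1 else if t == x then 1 - expR (- 1) else 0.

Let kernel_cvg t : 1 - expR (- E n t) @[n --> \oo] --> step t.
Proof.
rewrite /step /E; have [tx|tx|<-] := ltgtP t x.
- have tx' : 0 < x - t by rewrite subr_gt0.
  rewrite -[X in _ --> X]subr0; apply: cvgB; first exact: cvg_cst.
  have h1 : (n%:R * (x - t) : R) @[n --> \oo] --> +oo.
    have kr : r * (x - t) @[r --> +oo] --> +oo by apply: gt0_cvgMly => //; exact: cvg_id.
    exact: (cvg_comp _ _ (@cvgr_idn R) kr).
  have h2 : expR (n%:R * (x - t)) @[n --> \oo] --> +oo.
    apply/cvgryPge => A; have /cvgryPge/(_ A) := h1.
    by apply: filterS => n /le_trans; apply; rewrite (le_trans _ (expR_ge1Dx _))// lerDr.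
  exact: (cvg_comp _ _ h2 (@cvgr_expR R)).
- have tx' : 0 < t - x by rewrite subr_gt0.
  rewrite -(subrr (expR (- 0))) oppr0 {1}expR0; apply: cvgB; first exact: cvg_cst.
  apply: (@cvg_comp _ _ _ (fun n : nat => - expR (n%:R * (x - t))) expR); last exact: continuous_expR.
  rewrite -oppr0; apply: cvgN.
  have h1 : (n%:R * (t - x) : R) @[n --> \oo] --> +oo.
    have kr : r * (t - x) @[r --> +oo] --> +oo by apply: gt0_cvgMly => //; exact: cvg_id.
    exact: (cvg_comp _ _ (@cvgr_idn R) kr).
  have -> : (fun n : nat => expR (n%:R * (x - t))) = (fun n : nat => expR (- (n%:R * (t - x)))).
    by apply/funext => n; rewrite -mulrN opprB.
  exact: (cvg_comp _ _ h1 (@cvgr_expR R)).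
- apply: cvg_near_cst; apply: nearW => n.
  by rewrite subrr mulr0 expR0.
Qed.

Lemma laplace_uniqueness_primitive : \int[mu]_(t in `[0, x]) d t = 0.
Proof.
pose I : set R := `[0, x]%classic; pose P : set R := [set x].
have mI : measurable I by exact: measurable_itv.
have mP : measurable P by exact: measurable_set1.
have DI : D `&` I = I.
  apply/setIidr => t; rewrite /I /D /= !in_itv /= => /andP[-> tx].
  by rewrite (le_trans tx)// ltW.
have DP : D `&` P = P.
  by apply/setIidr => t; rewrite /P /D /= in_itv /= => ->; rewrite !ltW.
have stepE t : D t -> step t = \1_I t + \1_P t * - expR (- 1).
  rewrite /D /= in_itv /= => /andP[t0 _]; rewrite /step !indicE.
  have -> : (t \in I) = (t <= x) by apply/idP/idP; rewrite inE /I /= in_itv /= t0.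
  have -> : (t \in P) = (t == x).
    by apply/idP/idP; rewrite inE /P /= => /eqP.
  by case: ltgtP => //= _; rewrite ?mul0r ?addr0 ?mul1r.
have mstep : measurable_fun D step.
  apply: (@eq_measurable_fun _ _ _ _ _ (fun t => \1_I t + \1_P t * - expR (- 1))).
    by move=> t; rewrite inE => /stepE.
  apply: measurable_funD; first exact: measurable_indic.
  by apply: measurable_funM => //; exact: measurable_indic.
have jstep : mu.-integrable D (EFin \o (fun t => step t * d t)).
  apply: (@mulexp_integrable _ 1) => // t _; rewrite /step.
  case: ltgtP; rewrite ?normr1 ?normr0// => _.
  by rewrite ger0_norm ?subr_ge0 ?expRN_le1// gerBl expR_ge0.
have h1 : \int[mu]_(t in D) ((1 - expR (- E n t)) * d t) @[n --> \oo] -->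
    \int[mu]_(t in D) (step t * d t).
  apply: (@Rdominated_convergence _ _ _ _ (fun t => 1 * `|d t|)) => //.
  - move=> n; apply: measurable_funM; last exact: integrable_measurable jdD.
    exact: measurable_funB.
  - exact: integrable_measurable jstep.
  - by move=> t _; apply: cvgM; [exact: kernel_cvg|exact: cvg_cst].
  - by apply: RintegrableZ => //; exact: integrable_norm.
  - move=> n t _; rewrite normrM ler_wpM2r//.
    by rewrite ger0_norm ?subr_ge0 ?expRN_le1 ?expR_ge0// gerBl expR_ge0.
have h2 : \int[mu]_(t in D) ((1 - expR (- E n t)) * d t) @[n --> \oo] --> 0.
  have y2 : 0 < y / 2 by rewrite divr_gt0.
  have b : C' * (expR (expR (- (n%:R * (y / 2)))) - 1) @[n --> \oo] --> 0.
    rewrite -(mulr0 C'); apply: cvgM; first exact: cvg_cst.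
    rewrite -[X in _ --> X](subrr 1); apply: cvgB; last exact: cvg_cst.
    rewrite -[X in _ --> X]expR0.
    apply: (@cvg_comp _ _ _ (fun n : nat => expR (- (n%:R * (y / 2)))) expR);
      last exact: continuous_expR.
    have kr : r * (y / 2) @[r --> +oo] --> +oo by apply: gt0_cvgMly => //; exact: cvg_id.
    exact: (cvg_comp _ _ (cvg_comp _ _ (@cvgr_idn R) kr) (@cvgr_expR R)).
  apply/cvgrPdist_lt => e e0; near=> n.
  rewrite sub0r normrN; apply: (le_lt_trans (kernel_bound _ _)).
  - by apply/ltW; near: n; exact: nbhs_infty_gtr.
  - by apply/ltW; near: n; exact: nbhs_infty_gtr.
  - by near: n; exact: (cvgr_lt _ b).
have e : \int[mu]_(t in D) (step t * d t) = 0.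
  by rewrite -(cvg_lim _ h1)//; apply: cvg_lim.
rewrite -[RHS]e -/I -[X in \int[mu]_(t in X) _]DI Rintegral_mkcondr -indic_patch.
have i1 : mu.-integrable D (EFin \o (fun t => \1_I t * d t)).
  apply: (@mulexp_integrable _ 1); first exact: measurable_indic.
  by move=> t _; rewrite indicE; case: (_ \in _); rewrite ?normr1 ?normr0.
have i2 : mu.-integrable D (EFin \o (fun t => \1_P t * (- expR (- 1) * d t))).
  apply: (dominated_integrable (g := fun t => expR (- 1) * `|d t|)) => //.
  - apply: measurable_funM; first exact: measurable_indic.
    by apply: measurable_funM => //; exact: integrable_measurable jdD.
  - by apply: RintegrableZ => //; exact: integrable_norm.
  - move=> t _; rewrite indicE; case: (_ \in _).
      by rewrite mul1r normrM normrN (ger0_norm (expR_ge0 _)).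
    by rewrite mul0r normr0 mulr_ge0// expR_ge0.
have -> : \int[mu]_(t in D) (step t * d t) =
    \int[mu]_(t in D) (\1_I t * d t) + \int[mu]_(t in D) (\1_P t * (- expR (- 1) * d t)).
  rewrite -RintegralD//; apply: eq_Rintegral => t; rewrite inE => /stepE ->; ring.
rewrite [X in _ + X](_ : _ = 0) ?addr0//.
by rewrite indic_patch -Rintegral_mkcondr DP Rintegral_set1.
Unshelve. all: end_near. Qed.

End laplace_uniqueness.

(** All integrals of d over the intervals [0, x] vanish, so d is the derivative of a
constant. *)
Lemma laplace_uniqueness (R : realType) (d : R -> R) (T C s0 : R) :
  0 <= C -> (@lebesgue_measure R).-integrable `[0, T] (EFin \o d) ->
  (forall s, s0 <= s ->
    `|\int[@lebesgue_measure R]_(t in `[0, T]) (expR (- (s * t)) * d t)| <=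
    C * s ^+ 2 * expR (- (s * T))) ->
  (forall t, 0 < t < T -> {for t, continuous d}) ->
  forall t, 0 < t < T -> d t = 0.
Proof.
move=> C0 jd lap cd t /andP[t0 tT].
pose F x := (\int[lebesgue_measure]_(t in [set` `[0, x]]) d t)%R.
have [dF <-] := @continuous_FTC1_closed R d 0 t T tT jd t0 (cd t (introT andP (conj t0 tT))).
have F0 : \forall x \near t, F x = 0.
  have : \forall x \near t, x \in `]0, T[ by apply: near_in_itvoo; rewrite in_itv /= t0.
  apply: filterS => x; rewrite in_itv /= => /andP[x0 xT].
  exact: (laplace_uniqueness_primitive C0 jd lap x0 xT).
rewrite derive1E (near_eq_derive _ (F0 : \forall x \near t, F x = cst 0 x)) ?derive_cst//.
Qed.

(** * Complex differentiability *)
Section complex_derivative.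
Variable R : realType.
Implicit Types (f g : R[i] -> R[i]) (z w d : R[i]).

(** The usual topology of the plane, presented by the real-valued modulus. *)
Definition cnbhs z : set_system R[i] :=
  [set P | exists2 e : R, 0 < e & forall w, cmod (w - z) < e -> P w].

Global Instance cnbhs_filter z : ProperFilter (cnbhs z).
Proof.
split; first by move=> [e e0 h]; apply: (h z); rewrite subrr cmod0.
split.
- by exists 1.
- move=> P Q [e e0 h] [e' e'0 h']; exists (Num.min e e'); first by rewrite lt_min e0.
  by move=> w; rewrite lt_min => /andP[we we']; split; [exact: h|exact: h'].
- by move=> P Q PQ [e e0 h]; exists e => // w we; apply: PQ; exact: h.
Qed.

Lemma near_cmod z (e : R) : 0 < e -> \forall w \near cnbhs z, cmod (w - z) < e.
Proof. by move=> e0; exists e. Qed.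

Lemma cnbhs_singleton z (P : set R[i]) : cnbhs z P -> P z.
Proof. by move=> [e e0 h]; apply: h; rewrite subrr cmod0. Qed.

Definition ccont f z := forall e : R, 0 < e -> \forall w \near cnbhs z, cmod (f w - f z) < e.

Lemma ccont_near f z (P : set R[i]) : ccont f z -> cnbhs (f z) P ->
  \forall w \near cnbhs z, P (f w).
Proof. by move=> cf [e e0 h]; have := cf e e0; apply: filterS => w; exact: h. Qed.

Lemma ccont_cst (c : R[i]) z : ccont (fun=> c) z.
Proof. by move=> e e0; exists 1 => // w _; rewrite subrr cmod0. Qed.

Lemma ccont_id z : ccont id z.
Proof. by move=> e e0; exists e. Qed.

Lemma ccontD f g z : ccont f z -> ccont g z -> ccont (fun w => f w + g w) z.
Proof.
move=> cf cg e e0; have e2 : 0 < e / 2 by rewrite divr_gt0.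
have hf := cf _ e2; have hg := cg _ e2.
near=> w; rewrite opprD addrACA (le_lt_trans (cmodD _ _))// [e]splitr ltrD//.
  exact: (near hf w).
exact: (near hg w).
Unshelve. all: end_near. Qed.

Lemma ccontM f g z : ccont f z -> ccont g z -> ccont (fun w => f w * g w) z.
Proof.
move=> cf cg e e0; pose K := cmod (f z) + cmod (g z) + 1.
have K0 : 0 < K by rewrite ltr_wpDl ?addr_ge0 ?cmod_ge0.
have e1 : 0 < Num.min 1 (e / (2 * K)) by rewrite lt_min ltr01 divr_gt0 ?mulr_gt0.
have hf := cf _ e1; have hg := cg _ e1.
near=> w.
have : cmod (f w - f z) < Num.min 1 (e / (2 * K)) by exact: (near hf w).
have : cmod (g w - g z) < Num.min 1 (e / (2 * K)) by exact: (near hg w).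
rewrite !lt_min => /andP[g1 g2] /andP[f1 f2].
have -> : f w * g w - f z * g z = (f w - f z) * (g w - g z + g z) + f z * (g w - g z) by ring.
have gw : cmod (g w - g z + g z) <= K.
  by rewrite (le_trans (cmodD _ _))// /K; have := cmod_ge0 (f z); lra.
have fK : cmod (f z) <= K by rewrite /K -addrA lerDl addr_ge0 ?cmod_ge0.
rewrite (le_lt_trans (cmodD _ _))// !cmodM [e]splitr.
have K2 : e / (2 * K) * K = e / 2 by field; exact: lt0r_neq0.
rewrite -K2 ltr_leD//.
  rewrite (le_lt_trans (ler_wpM2l (cmod_ge0 _) gw))// ltr_pM2r//.
by rewrite mulrC ler_pM ?cmod_ge0// ltW.
Unshelve. all: end_near. Qed.

Lemma ccontN f z : ccont f z -> ccont (fun w => - f w) z.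
Proof.
by move=> cf e e0; have := cf e e0; apply: filterS => w; rewrite -opprD cmodN.
Qed.

Lemma ccont_neq0 f z : ccont f z -> f z != 0 -> \forall w \near cnbhs z, f w != 0.
Proof.
move=> cf fz; have fz0 : 0 < cmod (f z) by rewrite cmod_gt0.
have := cf _ fz0; apply: filterS => w; apply: contraTneq => ->.
by rewrite sub0r cmodN ltxx.
Qed.

Lemma ccontV f z : f z != 0 -> ccont f z -> ccont (fun w => (f w)^-1) z.
Proof.
move=> fz cf e e0; have fz0 : 0 < cmod (f z) by rewrite cmod_gt0.
have e1 : 0 < cmod (f z) / 2 by rewrite divr_gt0.
have e2 : 0 < e * (cmod (f z) / 2 * cmod (f z)) by rewrite !mulr_gt0.
have h1 := cf _ e1; have h2 := cf _ e2; have h3 := ccont_neq0 cf fz.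
near=> w.
have fw0 : f w != 0 by exact: (near h3 w).
have w1 : cmod (f w - f z) < cmod (f z) / 2 by exact: (near h1 w).
have w2 : cmod (f w - f z) < e * (cmod (f z) / 2 * cmod (f z)) by exact: (near h2 w).
have fw : cmod (f z) / 2 <= cmod (f w).
  have := cmodB (f w) (f w - f z); rewrite opprB addrC subrK; lra.
have -> : (f w)^-1 - (f z)^-1 = - (f w - f z) / (f w * f z) by field; rewrite fw0 fz.
rewrite cmodM cmodN cmodV cmodM ltr_pdivrMr ?mulr_gt0 ?cmod_gt0// (lt_le_trans w2)//.
by rewrite ler_wpM2l ?(ltW e0)// ler_wpM2r ?cmod_ge0.
Unshelve. all: end_near. Qed.

Lemma ccont_comp f g z : ccont g z -> ccont f (g z) -> ccont (fun w => f (g w)) z.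
Proof. by move=> cg cf e e0; exact: (ccont_near cg (cf e e0)). Qed.

(** Caratheodory's form of complex differentiability: the difference quotient extends
to a function continuous at z. It makes the rules of calculus purely algebraic, and
it bounds the quotient near z. *)
Definition cderiv f z d := exists2 phi : R[i] -> R[i],
  ccont phi z /\ phi z = d &
  \forall w \near cnbhs z, f w - f z = phi w * (w - z).

Lemma cderiv_continuous f z d : cderiv f z d -> ccont f z.
Proof.
move=> [phi [cphi _] E] e e0.
have c : ccont (fun w => phi w * (w - z)) z.
  by apply: ccontM => //; apply: ccontD; [exact: ccont_id|exact: ccont_cst].
have := c e e0; rewrite subrr mulr0 => H.
by near=> w; rewrite (near E w)// -[X in cmod X]subr0; exact: (near H w).
Unshelve. all: end_near. Qed.

Lemma cderiv_cst (c : R[i]) z : cderiv (fun=> c) z 0.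
Proof.
by exists (fun=> 0); [split => //; exact: ccont_cst|apply: nearW => w; rewrite subrr mul0r].
Qed.

Lemma cderiv_id z : cderiv id z 1.
Proof. by exists (fun=> 1); [split => //; exact: ccont_cst|apply: nearW => w; rewrite mul1r]. Qed.

Lemma cderivD f g z df dg : cderiv f z df -> cderiv g z dg ->
  cderiv (fun w => f w + g w) z (df + dg).
Proof.
move=> [p [cp <-] Ep] [q [cq <-] Eq]; exists (fun w => p w + q w).
  by split => //; apply: ccontD.
by near=> w; rewrite mulrDl -(near Ep w)// -(near Eq w)//; ring.
Unshelve. all: end_near. Qed.

Lemma cderivM f g z df dg : cderiv f z df -> cderiv g z dg ->
  cderiv (fun w => f w * g w) z (df * g z + f z * dg).
Proof.
move=> [p [cp <-] Ep] hg; have cg := cderiv_continuous hg.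
case: hg => [q [cq <-] Eq]; exists (fun w => p w * g w + f z * q w).
  split => //; apply: ccontD; first exact: ccontM.
  by apply: ccontM => //; exact: ccont_cst.
near=> w.
have -> : (p w * g w + f z * q w) * (w - z) = p w * (w - z) * g w + f z * (q w * (w - z)).
  by ring.
by rewrite -(near Ep w)// -(near Eq w)//; ring.
Unshelve. all: end_near. Qed.

Lemma cderiv_comp f g z df dg : cderiv g z dg -> cderiv f (g z) df ->
  cderiv (fun w => f (g w)) z (df * dg).
Proof.
move=> hg [p [cp <-] Ep]; have cg := cderiv_continuous hg.
case: hg => [q [cq <-] Eq]; exists (fun w => p (g w) * q w).
  by split => //; apply: ccontM => //; exact: ccont_comp.
have Ep' := ccont_near cg Ep.
near=> w; rewrite -mulrA -(near Eq w)//; exact: (near Ep' w).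
Unshelve. all: end_near. Qed.

Lemma cderivV f z df : f z != 0 -> cderiv f z df ->
  cderiv (fun w => (f w)^-1) z (- df / f z ^+ 2).
Proof.
move=> fz0 hf; have cf := cderiv_continuous hf.
have nz : \forall w \near cnbhs z, f w != 0 by exact: ccont_neq0.
case: hf => [p [cp <-] Ep]; exists (fun w => - p w / (f w * f z)).
  split; last by rewrite expr2.
  apply: ccontM; first exact: ccontN.
  apply: ccontV; first by rewrite mulf_neq0.
  by apply: ccontM => //; exact: ccont_cst.
near=> w; have fw0 : f w != 0 by exact: (near nz w).
rewrite mulrAC mulNr -(near Ep w)//; field; by rewrite fw0 fz0.
Unshelve. all: end_near. Qed.

(** This is how the logarithm inherits its derivative from the exponential. *)
Lemma cderiv_inverse f g z d : d != 0 -> ccont g z -> cderiv f (g z) d ->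
  (\forall w \near cnbhs z, f (g w) = w) -> cderiv g z d^-1.
Proof.
move=> d0 cg [p [cp pd] Ep] fg.
have cpg : ccont (fun w => p (g w)) z by exact: ccont_comp.
have nz : \forall w \near cnbhs z, p (g w) != 0.
  by apply: (ccont_neq0 cpg); rewrite pd.
have Ep' := ccont_near cg Ep.
have fgz : f (g z) = z by exact: cnbhs_singleton fg.
exists (fun w => (p (g w))^-1).
  by split; [apply: ccontV => //; rewrite pd|rewrite pd].
near=> w; have pw0 : p (g w) != 0 by exact: (near nz w).
have : f (g w) - f (g z) = p (g w) * (g w - g z) by exact: (near Ep' w).
rewrite (near fg w)// fgz => ->; by rewrite mulrA mulVf// mul1r.
Unshelve. all: end_near. Qed.

Lemma cderiv_unique f z d1 d2 : cderiv f z d1 -> cderiv f z d2 -> d1 = d2.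
Proof.
move=> [p [cp <-] Ep] [q [cq <-] Eq].
apply/eqP; rewrite -subr_eq0; apply/eqP; apply: contrapT => pq.
have pq0 : 0 < cmod (p z - q z) by rewrite cmod_gt0; apply/eqP.
have c : ccont (fun w => p w - q w) z by apply: ccontD => //; exact: ccontN.
have [e e0 h] : \forall w \near cnbhs z,
    [/\ cmod (p w - q w - (p z - q z)) < cmod (p z - q z),
    f w - f z = p w * (w - z) & f w - f z = q w * (w - z)].
  have H := c _ pq0.
  by near=> w; split; [exact: (near H w)|exact: (near Ep w)|exact: (near Eq w)].
have e2 : 0 < e / 2 by rewrite divr_gt0.
have [] := h (z + (e / 2)%:C).
  by rewrite addrC addKr cmod_real ger0_norm ?ltW// ltr_pdivrMr// ltr_pMr// ltr1n.
rewrite [z + _ - z]addrC addKr => h1 h2 h3.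
have h4 : p (z + (e / 2)%:C) = q (z + (e / 2)%:C).
  apply: (@mulIf _ (e / 2)%:C); last by rewrite -h2 -h3.
  by rewrite -cmod_gt0 cmod_real normr_gt0 gt_eqF.
by move: h1; rewrite h4 subrr sub0r cmodN ltxx.
Unshelve. all: end_near. Qed.

Lemma cderiv_eps f z d : (forall e : R, 0 < e -> exists2 del : R, 0 < del &
    forall h, h != 0 -> cmod h < del -> cmod (f (z + h) - f z - h * d) <= e * cmod h) ->
  cderiv f z d.
Proof.
move=> H; exists (fun w => if w == z then d else (f w - f z) / (w - z)).
  split; last by rewrite eqxx.
  move=> e e0; rewrite eqxx.
  have e2 : 0 < e / 2 by rewrite divr_gt0.
  have [del del0 hdel] := H _ e2.
  apply: filterS (near_cmod z del0) => w wz.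
  case: eqVneq => [_|wz0]; first by rewrite subrr cmod0.
  have h0 : w - z != 0 by rewrite subr_eq0.
  have zw : z + (w - z) = w by ring.
  have := hdel _ h0 wz; rewrite zw => hh.
  have -> : (f w - f z) / (w - z) - d = (f w - f z - (w - z) * d) / (w - z) by field.
  rewrite cmodM cmodV ltr_pdivrMr ?cmod_gt0// (le_lt_trans hh)//.
  by rewrite ltr_pM2r ?cmod_gt0// ltr_pdivrMr// ltr_pMr// ltr1n.
apply: nearW => w; case: eqVneq => [->|wz0]; first by rewrite !subrr mulr0.
by rewrite divfK// subr_eq0.
Qed.

Lemma cderiv_cexp z : cderiv (@cexp R) z (cexp z).
Proof.
apply: cderiv_eps => e e0.
have K0 : 0 < cmod (cexp z) * expR 1 by rewrite mulr_gt0 ?expR_gt0// cmod_gt0 cexp_neq0.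
exists (Num.min 1 (e / (cmod (cexp z) * expR 1))); first by rewrite lt_min ltr01 divr_gt0.
move=> h h0; rewrite lt_min => /andP[h1 h2].
have -> : cexp (z + h) - cexp z - h * cexp z = cexp z * (cexp h - 1 - h).
  by rewrite cexpD; ring.
rewrite cmodM (le_trans (ler_wpM2l (cmod_ge0 _) (cexp_taylor2 h)))//.
have E1 : expR (cmod h) <= expR 1 by rewrite ler_expR ltW.
rewrite (le_trans (ler_wpM2l (cmod_ge0 _) (ler_wpM2l (sqr_ge0 _) E1)))//.
have -> : cmod (cexp z) * (cmod h ^+ 2 * expR 1) =
  cmod h * (cmod (cexp z) * expR 1) * cmod h by ring.
rewrite ler_wpM2r ?cmod_ge0//.
by rewrite -ler_pdivlMr// ltW.
Qed.

(** Continuity of the derivative allows differentiation under integral signs without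
appeal to the regularity of holomorphic functions. *)
Definition C1at f z := exists f' : R[i] -> R[i],
  (\forall w \near cnbhs z, cderiv f w (f' w)) /\ ccont f' z.

Lemma C1at_cderiv f z : C1at f z -> exists d, cderiv f z d.
Proof. by move=> [f' [+ _]] => /cnbhs_singleton h; exists (f' z). Qed.

Lemma C1at_continuous f z : C1at f z -> ccont f z.
Proof. by move=> /C1at_cderiv[d]; exact: cderiv_continuous. Qed.

Lemma C1at_cst (c : R[i]) z : C1at (fun=> c) z.
Proof. by exists (fun=> 0); split; [apply: nearW => w; exact: cderiv_cst|exact: ccont_cst]. Qed.

Lemma C1at_id z : C1at id z.
Proof. by exists (fun=> 1); split; [apply: nearW => w; exact: cderiv_id|exact: ccont_cst]. Qed.

Lemma C1atD f g z : C1at f z -> C1at g z -> C1at (fun w => f w + g w) z.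
Proof.
move=> [f' [hf cf]] [g' [hg cg]]; exists (fun w => f' w + g' w); split; last exact: ccontD.
by near=> w; apply: cderivD; [exact: (near hf w)|exact: (near hg w)].
Unshelve. all: end_near. Qed.

Lemma C1atM f g z : C1at f z -> C1at g z -> C1at (fun w => f w * g w) z.
Proof.
move=> hf0 hg0; have cf0 := C1at_continuous hf0; have cg0 := C1at_continuous hg0.
move: hf0 hg0 => [f' [hf cf]] [g' [hg cg]].
exists (fun w => f' w * g w + f w * g' w); split.
  by near=> w; apply: cderivM; [exact: (near hf w)|exact: (near hg w)].
by apply: ccontD; exact: ccontM.
Unshelve. all: end_near. Qed.

Lemma C1at_comp f g z : C1at g z -> C1at f (g z) -> C1at (fun w => f (g w)) z.
Proof.
move=> hg0; have cg0 := C1at_continuous hg0.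
move: hg0 => [g' [hg cg]] [f' [hf cf]].
exists (fun w => f' (g w) * g' w); split.
  have hf' := ccont_near cg0 hf.
  by near=> w; apply: cderiv_comp; [exact: (near hg w)|exact: (near hf' w)].
by apply: ccontM => //; exact: ccont_comp.
Unshelve. all: end_near. Qed.

Lemma C1atV f z : f z != 0 -> C1at f z -> C1at (fun w => (f w)^-1) z.
Proof.
move=> fz0 hf0; have cf0 := C1at_continuous hf0.
have nz : \forall w \near cnbhs z, f w != 0 by exact: ccont_neq0.
move: hf0 => [f' [hf cf]]; exists (fun w => - f' w / f w ^+ 2); split.
  by near=> w; apply: cderivV; [exact: (near nz w)|exact: (near hf w)].
apply: ccontM; first exact: ccontN.
by apply: ccontV; [rewrite expf_neq0|exact: ccontM].
Unshelve. all: end_near. Qed.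

Lemma C1at_cexp z : C1at (@cexp R) z.
Proof.
exists (@cexp R); split; first by apply: nearW => w; exact: cderiv_cexp.
exact: cderiv_continuous (cderiv_cexp z).
Qed.

Lemma C1at_sum (I : Type) (s : seq I) (F : I -> R[i] -> R[i]) z :
  (forall i, C1at (F i) z) -> C1at (fun w => \sum_(i <- s) F i w) z.
Proof.
move=> hF; elim: s => [|i s ih].
  by under eq_fun do rewrite big_nil; exact: C1at_cst.
by under eq_fun do rewrite big_cons; exact: C1atD.
Qed.

(** Derivatives are unique, so a derivative function chosen once agrees with the
one that is continuous near any given point. *)
Lemma C1at_derivative f (U : set R[i]) : (forall z, U z -> C1at f z) ->
  exists f' : R[i] -> R[i], forall z, U z -> cderiv f z (f' z) /\ ccont f' z.
Proof.
move=> hf.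
have ex z : exists d, (exists d, cderiv f z d) -> cderiv f z d.
  have [[d hd]|nh] := pselect (exists d, cderiv f z d); first by exists d.
  by exists 0.
have [f' hf'] := choice ex; exists f' => z /hf hz; split.
  exact/hf'/C1at_cderiv.
case: hz => [g [hg cg]].
have E : \forall w \near cnbhs z, g w = f' w.
  apply: filterS hg => w gw; apply: (cderiv_unique gw).
  by apply: hf'; exists (g w).
move=> e e0; have H := cg e e0.
by near=> w; rewrite -(near E w)// -(cnbhs_singleton E); exact: (near H w).
Unshelve. all: end_near. Qed.

End complex_derivative.

Section paths.
Variable R : realType.
Implicit Types (f : R[i] -> R[i]) (gamma : R -> R[i]).

Lemma ccont_path f gamma (t : R) : ccont f (gamma t) ->
  {for t, continuous (fun r => complex.Re (gamma r))} ->
  {for t, continuous (fun r => complex.Im (gamma r))} ->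
  {for t, continuous (fun r => complex.Re (f (gamma r)))} /\
  {for t, continuous (fun r => complex.Im (f (gamma r)))}.
Proof.
move=> cf cr ci.
have key (e : R) : 0 < e -> \forall r \near t, cmod (f (gamma r) - f (gamma t)) < e.
  move=> e0; have [d d0 hd] := cf e e0; have d2 : 0 < d / 2 by rewrite divr_gt0.
  have h1 : \forall r \near t, `|complex.Re (gamma t) - complex.Re (gamma r)| < d / 2.
    by move/cvgrPdist_lt: cr; apply.
  have h2 : \forall r \near t, `|complex.Im (gamma t) - complex.Im (gamma r)| < d / 2.
    by move/cvgrPdist_lt: ci; apply.
  near=> r; apply: hd; rewrite (le_lt_trans (cmod_le_ReIm _))// [d]splitr.
  rewrite cReD cReN cImD cImN; apply: ltrD; rewrite distrC.
    exact: (near h1 r).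
  exact: (near h2 r).
split; apply/cvgrPdist_lt => e /key; apply: filterS => r; apply: le_lt_trans.
- by rewrite distrC -cReN -cReD Re_le_cmod.
- by rewrite distrC -cImN -cImD Im_le_cmod.
Unshelve. all: end_near. Qed.

(** A difference quotient that combines two slopes with continuous coefficients. *)
Lemma is_derive_slopes (g u v A B : R -> R) (t a b : R) :
  {for t, continuous u} -> {for t, continuous v} ->
  is_derive t 1 A a -> is_derive t 1 B b ->
  (\forall r \near t, g r - g t = u r * (A r - A t) + v r * (B r - B t)) ->
  is_derive t 1 g (u t * a + v t * b).
Proof.
move=> cu cv dA dB gE.
have slope F l : is_derive t 1 F l -> (fun h : R => h^-1 * (F (h + t) - F t)) @ 0^' --> l.
  move=> dF; have := @ex_derive _ _ _ _ _ _ _ dF; move=> /cvg_ex[l' hl'].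
  have e := derive_val; have hv := @derive_val _ _ _ _ _ _ _ dF.
  have : 'D_1 F t = l' by apply/cvg_lim.
  rewrite hv => ->; apply: cvg_trans hl'; apply: near_eq_cvg; apply: nearW => h.
  by rewrite /GRing.scale /= mulr1.
have sh : (fun h : R => h + t) @ 0^' --> t.
  have : (fun h : R => h + t) @ nbhs 0 --> 0 + t by apply: cvgD; [exact: cvg_id|exact: cvg_cst].
  by rewrite add0r; exact: cvg_within_filter.
have H : (fun h : R => h^-1 *: (g (h *: 1 + t) - g t)) @ 0^' --> u t * a + v t * b.
  have H1 : (fun h : R => u (h + t) * (h^-1 * (A (h + t) - A t)) +
      v (h + t) * (h^-1 * (B (h + t) - B t))) @ 0^' --> u t * a + v t * b.
    apply: cvgD; apply: cvgM; [exact: (cvg_comp _ _ sh cu)|exact: slope|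
      exact: (cvg_comp _ _ sh cv)|exact: slope].
  apply: cvg_trans H1; apply: near_eq_cvg.
  have gE' : \forall h \near (0 : R)^', g (h + t) - g t =
      u (h + t) * (A (h + t) - A t) + v (h + t) * (B (h + t) - B t) by exact: (sh _ gE).
  apply: filterS gE' => h e.
  by rewrite /GRing.scale /= mulr1 e; ring.
have dv : derivable g t 1 by apply/cvg_ex; exists (u t * a + v t * b).
by apply: DeriveDef => //; apply/cvg_lim.
Qed.

(** The chain rule along a path, split into the real and imaginary parts in which
integrals are computed. *)
Lemma path_derive f gamma (t a b : R) d : cderiv f (gamma t) d ->
  is_derive t 1 (fun r => complex.Re (gamma r)) a ->
  is_derive t 1 (fun r => complex.Im (gamma r)) b ->
  is_derive t 1 (fun r => complex.Re (f (gamma r))) (complex.Re (d * (a +i* b))) /\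
  is_derive t 1 (fun r => complex.Im (f (gamma r))) (complex.Im (d * (a +i* b))).
Proof.
move=> [phi [cphi <-] E] da db.
have cr := is_derive_continuous da; have ci := is_derive_continuous db.
have [cu cv] := ccont_path cphi cr ci.
have E' : \forall r \near t, f (gamma r) - f (gamma t) = phi (gamma r) * (gamma r - gamma t).
  have [e e0 he] := E; have e2 : 0 < e / 2 by rewrite divr_gt0.
  have h1 : \forall r \near t, `|complex.Re (gamma t) - complex.Re (gamma r)| < e / 2.
    by move/cvgrPdist_lt: cr; apply.
  have h2 : \forall r \near t, `|complex.Im (gamma t) - complex.Im (gamma r)| < e / 2.
    by move/cvgrPdist_lt: ci; apply.
  near=> r; apply: he; rewrite (le_lt_trans (cmod_le_ReIm _))// [e]splitr.
  rewrite cReD cReN cImD cImN; apply: ltrD; rewrite distrC.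
    exact: (near h1 r).
  exact: (near h2 r).
have cNv : {for t, continuous (fun r => - complex.Im (phi (gamma r)))} by apply: cvgN.
split.
- have := is_derive_slopes (g := fun r => complex.Re (f (gamma r))) cu cNv da db.
  rewrite cReM /= -mulNr; apply.
  near=> r; have /(congr1 (@complex.Re R)) : f (gamma r) - f (gamma t) =
    phi (gamma r) * (gamma r - gamma t) by exact: (near E' r).
  by rewrite cReM !cReD !cImD !cReN !cImN => ->; ring.
- have := is_derive_slopes (g := fun r => complex.Im (f (gamma r))) cv cu da db.
  rewrite cImM /= addrC; apply.
  near=> r; have /(congr1 (@complex.Im R)) : f (gamma r) - f (gamma t) =
    phi (gamma r) * (gamma r - gamma t) by exact: (near E' r).
  by rewrite cImM !cReD !cImD !cReN !cImN => ->; ring.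
Unshelve. all: end_near. Qed.

End paths.

(** * The logarithm on the slit plane *)
Section complex_logarithm.
Variable R : realType.
Implicit Types (z w : R[i]).

(** The plane cut along the negative real axis. *)
Definition slit z := 0 < cmod z + complex.Re z.

(** The half-angle formula keeps the principal argument differentiable across the
   positive real axis. *)
Definition slit_arg z : R := 2 * atan (complex.Im z / (cmod z + complex.Re z)).

Definition clog z : R[i] := ln (cmod z) +i* slit_arg z.

Lemma slit_cmod_gt0 z : slit z -> 0 < cmod z.
Proof.
rewrite /slit => h; have := le_trans (ler_norm _) (Re_le_cmod z); lra.
Qed.

Lemma slit_neq0 z : slit z -> z != 0.
Proof. by move=> /slit_cmod_gt0; rewrite cmod_gt0. Qed.

Lemma slit_Re z : 0 < complex.Re z -> slit z.
Proof. by move=> h; rewrite /slit ltr_wpDl ?cmod_ge0. Qed.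

Lemma slit_Im z : complex.Im z != 0 -> slit z.
Proof.
move=> i0; rewrite /slit -[X in _ + X]opprK subr_gt0.
have i2 : 0 < complex.Im z ^+ 2 by rewrite lt_def sqr_ge0 sqrf_eq0 i0.
rewrite (le_lt_trans (ler_norm _))// normrN.
rewrite -(ltr_pXn2r (n := 2))// ?nnegrE ?cmod_ge0// sqr_cmod real_normK ?num_real//.
by rewrite ltrDl.
Qed.

Lemma slit_arg_cos_sin z : slit z ->
  cmod z * cos (slit_arg z) = complex.Re z /\ cmod z * sin (slit_arg z) = complex.Im z.
Proof.
move=> sz; rewrite /slit_arg mulr_natl cos_mulr2n sin_mulr2n.
set x := _ / _; have r0 := slit_cmod_gt0 sz; rewrite /slit in sz.
have c0 : cos (atan x) != 0.
  by apply: lt0r_neq0; apply: cos_gt0_pihalf; rewrite atan_gtNpi2 atan_ltpi2.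
have sE : sin (atan x) = x * cos (atan x).
  by rewrite -{2}(atanK x) /tan divfK.
have x2 : 1 + x ^+ 2 != 0 by rewrite gt_eqF// ltr_pwDl// sqr_ge0.
have cE : cos (atan x) ^+ 2 = (1 + x ^+ 2)^-1.
  apply: (mulIf x2); rewrite mulVf//.
  have := cos2Dsin2 (atan x); rewrite sE => e; rewrite -[RHS]e; ring.
have rE : cmod z ^+ 2 = complex.Re z ^+ 2 + complex.Im z ^+ 2 := sqr_cmod z.
have xE : 1 + x ^+ 2 = 2 * cmod z / (cmod z + complex.Re z).
  rewrite /x; move: rE sz; set a := complex.Re z; set b := complex.Im z; set r := cmod z.
  move=> rE /lt0r_neq0 sz; have -> : (b / (r + a)) ^+ 2 = b ^+ 2 / (r + a) ^+ 2 by field.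
  have -> : b ^+ 2 = r ^+ 2 - a ^+ 2 by rewrite rE; ring.
  by field.
have sz0 := lt0r_neq0 sz; have r00 := lt0r_neq0 r0.
split.
- rewrite cE xE; field; by rewrite sz0 r00.
- have -> : (cos (atan x) * sin (atan x)) *+ 2 = 2 * (x * cos (atan x) ^+ 2).
    by rewrite sE; ring.
  by rewrite cE xE /x; field; rewrite sz0 r00.
Qed.

Lemma cexp_clog z : slit z -> cexp (clog z) = z.
Proof.
move=> sz; have [h1 h2] := slit_arg_cos_sin sz.
rewrite /cexp /clog /= lnK ?posrE ?slit_cmod_gt0//.
by apply: complex_eq; rewrite ?cRe_realM ?cIm_realM.
Qed.

Lemma slit_arg_lt z : - pi < slit_arg z < pi.
Proof.
rewrite /slit_arg; set x := _ / _.
have h1 := atan_gtNpi2 x; have h2 := atan_ltpi2 x.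
apply/andP; split; lra.
Qed.

Lemma slit_arg_ge0 z : slit z -> 0 <= complex.Im z -> 0 <= slit_arg z.
Proof.
move=> sz i0; rewrite /slit_arg mulr_ge0//.
by rewrite -[leLHS]atan0; apply: le_atan; rewrite divr_ge0// ltW.
Qed.

Lemma clog_real (x : R) : 0 < x -> clog x%:C = (ln x)%:C.
Proof.
by move=> x0; rewrite /clog /slit_arg cmod_real gtr0_norm// mul0r atan0 mulr0.
Qed.

Lemma ccont_real (F : R[i] -> R) z : (forall e : R, 0 < e ->
  \forall w \near cnbhs z, `|F w - F z| < e) <-> F w @[w --> cnbhs z] --> F z.
Proof.
split=> [h|/cvgrPdist_lt h e /h]; last by apply: filterS => w; rewrite distrC.
by apply/cvgrPdist_lt => e /h; apply: filterS => w; rewrite distrC.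
Qed.

Lemma cmod_cvg z : cmod w @[w --> cnbhs z] --> cmod z.
Proof.
apply/ccont_real => e e0; apply: filterS (near_cmod z e0) => w; apply: le_lt_trans.
exact: (@rnorm_dist R R[i]^o).
Qed.

Lemma Re_cvg z : complex.Re w @[w --> cnbhs z] --> complex.Re z.
Proof.
apply/ccont_real => e e0; apply: filterS (near_cmod z e0) => w; apply: le_lt_trans.
by rewrite -cReN -cReD Re_le_cmod.
Qed.

Lemma Im_cvg z : complex.Im w @[w --> cnbhs z] --> complex.Im z.
Proof.
apply/ccont_real => e e0; apply: filterS (near_cmod z e0) => w; apply: le_lt_trans.
by rewrite -cImN -cImD Im_le_cmod.
Qed.

Lemma slit_near z : slit z -> \forall w \near cnbhs z, slit w.
Proof.
move=> sz; have h : cmod w + complex.Re w @[w --> cnbhs z] --> cmod z + complex.Re z.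
  by apply: cvgD; [exact: cmod_cvg|exact: Re_cvg].
exact: (cvgr_gt _ h).
Qed.

Lemma ccont_ReIm (f : R[i] -> R[i]) z :
  complex.Re (f w) @[w --> cnbhs z] --> complex.Re (f z) ->
  complex.Im (f w) @[w --> cnbhs z] --> complex.Im (f z) -> ccont f z.
Proof.
move=> /(@ccont_real (fun w => complex.Re (f w))) hr.
move=> /(@ccont_real (fun w => complex.Im (f w))) hi e e0.
have e2 : 0 < e / 2 by rewrite divr_gt0.
have h1 := hr _ e2; have h2 := hi _ e2.
near=> w; rewrite (le_lt_trans (cmod_le_ReIm _))// [e]splitr.
rewrite cReD cReN cImD cImN ltrD//; [exact: (near h1 w)|exact: (near h2 w)].
Unshelve. all: end_near. Qed.

Lemma ccont_clog z : slit z -> ccont clog z.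
Proof.
move=> sz; apply: ccont_ReIm => /=.
  apply: (cvg_comp _ _ (cmod_cvg (z:=z))); apply: continuous_ln; exact: slit_cmod_gt0.
rewrite /slit_arg; apply: cvgM; first exact: cvg_cst.
have h : complex.Im w / (cmod w + complex.Re w) @[w --> cnbhs z] -->
    complex.Im z / (cmod z + complex.Re z).
  apply: cvgM; first exact: Im_cvg.
  apply: cvgV; first exact: lt0r_neq0.
  by apply: cvgD; [exact: cmod_cvg|exact: Re_cvg].
exact: (cvg_comp _ _ h (@continuous_atan R _)).
Qed.

Lemma cderiv_clog z : slit z -> cderiv clog z z^-1.
Proof.
move=> sz; apply: (cderiv_inverse (f := @cexp R)); first exact: slit_neq0.
- exact: ccont_clog.
- by rewrite -[in X in cderiv _ _ X](cexp_clog sz); exact: cderiv_cexp.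
- by apply: filterS (slit_near sz) => w; exact: cexp_clog.
Qed.

Lemma C1at_clog z : slit z -> C1at clog z.
Proof.
move=> sz; exists (fun w => w^-1); split.
  by apply: filterS (slit_near sz) => w; exact: cderiv_clog.
by apply: ccontV; [exact: slit_neq0|exact: ccont_id].
Qed.

End complex_logarithm.

(** * Rays issued from 1 *)
Section rays.
Variable R : realType.
Implicit Types (r th om : R).

(** The ray issued from 1 in the direction th. *)
Definition ray r th : R[i] := (1 + r * cos th) +i* (r * sin th).

Lemma ray0 r : ray r 0 = (1 + r)%:C.
Proof. by rewrite /ray cos0 sin0 mulr1 mulr0. Qed.

Lemma cos_decreasing x y : 0 <= x -> x <= y -> y <= pi -> cos y <= cos x :> R.
Proof.
move=> x0; rewrite le_eqVlt => /predU1P[->//|xy] yp.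
by apply/ltW; rewrite ltr_cos// in_itv /=; apply/andP; split; lra.
Qed.

Lemma sin_increasing x y : 0 <= x -> x <= y -> y <= pi / 2 -> sin x <= sin y :> R.
Proof.
move=> x0; rewrite le_eqVlt => /predU1P[->//|xy] yp; have p0 := pi_gt0 R.
by apply/ltW; rewrite ltr_sin// in_itv /=; apply/andP; split; lra.
Qed.

Lemma ray_slit r th : 0 <= r -> 0 <= th < pi -> slit (ray r th).
Proof.
move=> r0 /andP[t0 tp].
have [->|rn0] := eqVneq r 0.
  by apply: slit_Re; rewrite /= mul0r addr0.
have [->|tn0] := eqVneq th 0.
  by apply: slit_Re; rewrite ray0 /= ltr_wpDr.
have s0 : 0 < sin th by apply: sin_gt0_pi; rewrite lt_def tn0 t0.
by apply: slit_Im; rewrite /= mulf_neq0// gt_eqF.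
Qed.

Lemma ray_arg r th : 0 <= r -> 0 <= th < pi -> 0 <= slit_arg (ray r th) <= th.
Proof.
move=> r0 thp; have sl := ray_slit r0 thp; have /andP[t0 tp] := thp.
have s0 : 0 <= sin th by apply: sin_ge0_pi; rewrite t0 ltW.
apply/andP; split; first by apply: slit_arg_ge0 => //=; rewrite mulr_ge0.
rewrite leNgt; apply/negP => lt.
have [h1 h2] := slit_arg_cos_sin sl.
have /andP[_ ap] := slit_arg_lt (ray r th).
have : 0 < cmod (ray r th) * sin (slit_arg (ray r th) - th).
  rewrite mulr_gt0 ?slit_cmod_gt0// sin_gt0_pi// subr_gt0 lt /=.
  by rewrite ltrBlDr (lt_le_trans ap)// lerDl.
rewrite sinB mulrBr !mulrA h1 h2 /=.
have -> : r * sin th * cos th - (1 + r * cos th) * sin th = - sin th by ring.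
by rewrite oppr_gt0 ltNge s0.
Qed.

Lemma sqr_cmod_ray r th : cmod (ray r th) ^+ 2 = 1 + 2 * r * cos th + r ^+ 2.
Proof.
rewrite sqr_cmod /=; have := cos2Dsin2 th => e.
transitivity (1 + 2 * r * cos th + r ^+ 2 * (cos th ^+ 2 + sin th ^+ 2)); first by ring.
by rewrite e mulr1.
Qed.

Lemma cos_obtuse_lt0 th : pi / 2 < th < pi -> cos th < 0 :> R.
Proof.
move=> /andP[h1 h2]; have -> : th = (th - pi) + pi by rewrite subrK.
by rewrite cosDpi oppr_lt0; apply: cos_gt0_pihalf; apply/andP; split; lra.
Qed.

Lemma mul_cosB (a x y : R) : a * cos x * cos y + a * sin x * sin y = a * cos (x - y).
Proof. by rewrite cosB; ring. Qed.

Lemma mul_sinB (a x y : R) : a * sin x * cos y - a * cos x * sin y = a * sin (x - y).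
Proof. by rewrite sinB; ring. Qed.

Lemma cos_half th : cos th = 2 * cos (th / 2) ^+ 2 - 1.
Proof.
rewrite [in LHS](_ : th = (th / 2) *+ 2); last by rewrite -mulr_natl; field.
by rewrite cos_mulr2n mulr_natl.
Qed.

Lemma cos_half' th : cos th = 1 - 2 * sin (th / 2) ^+ 2.
Proof.
rewrite cos_half; have := cos2Dsin2 (th / 2); lra.
Qed.

(** |1 + r e^(i th)|^2 - cos(th/2)^2 (1 + r)^2 = (1 - r)^2 sin(th/2)^2. *)
Lemma ray_cmod_ge r th om : 0 <= r -> 0 <= th <= om -> om < pi ->
  cos (om / 2) * (1 + r) <= cmod (ray r th).
Proof.
move=> r0 /andP[t0 to] op.
have p0 := pi_gt0 R.
have co : 0 <= cos (om / 2).
  by apply: cos_ge0_pihalf; apply/andP; split; lra.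
have ct : cos (om / 2) <= cos (th / 2).
  by apply: cos_decreasing; lra.
rewrite -(ler_pXn2r (n := 2))// ?nnegrE ?cmod_ge0 ?mulr_ge0 ?addr_ge0//.
rewrite sqr_cmod_ray exprMn.
have c2 : cos (om / 2) ^+ 2 <= cos (th / 2) ^+ 2.
  by rewrite ler_pXn2r ?nnegrE// (le_trans co).
rewrite (le_trans (ler_wpM2r (sqr_ge0 _) c2))//.
rewrite (cos_half th) -subr_ge0.
have -> : 1 + 2 * r * (2 * cos (th / 2) ^+ 2 - 1) + r ^+ 2 - cos (th / 2) ^+ 2 * (1 + r) ^+ 2 =
  (1 - r) ^+ 2 * (1 - cos (th / 2) ^+ 2) by ring.
by rewrite mulr_ge0 ?sqr_ge0// subr_ge0.
Qed.

(** The distance from 1 + a to the ray is that of a to r e^(i th), bounded below in the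
same way by the half-angle. *)
Lemma pole_cmod_ge (a : R) r th eta : 0 <= a -> 0 <= r -> 0 <= eta <= th -> th <= pi ->
  sin (eta / 2) * (a + r) <= cmod ((1 + a)%:C - ray r th).
Proof.
move=> a0 r0 /andP[e0 et] tp; have p0 := pi_gt0 R.
have se : 0 <= sin (eta / 2) by apply: sin_ge0_pi; apply/andP; split; lra.
have st : sin (eta / 2) <= sin (th / 2).
  by apply: sin_increasing; lra.
rewrite -(ler_pXn2r (n := 2))// ?nnegrE ?cmod_ge0 ?mulr_ge0 ?addr_ge0//.
have s2 : sin (eta / 2) ^+ 2 <= sin (th / 2) ^+ 2.
  by rewrite ler_pXn2r ?nnegrE// (le_trans se).
rewrite exprMn (le_trans (ler_wpM2r (sqr_ge0 _) s2))//.
have -> : cmod ((1 + a)%:C - ray r th) ^+ 2 = a ^+ 2 - 2 * a * r * cos th + r ^+ 2.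
  rewrite sqr_cmod cReD cImD cReN cImN /=; have e := cos2Dsin2 th.
  transitivity (a ^+ 2 - 2 * a * r * cos th + r ^+ 2 * (cos th ^+ 2 + sin th ^+ 2)); first by ring.
  by rewrite e mulr1.
rewrite (cos_half' th) -subr_ge0.
have -> : a ^+ 2 - 2 * a * r * (1 - 2 * sin (th / 2) ^+ 2) + r ^+ 2 -
    sin (th / 2) ^+ 2 * (a + r) ^+ 2 = (a - r) ^+ 2 * (1 - sin (th / 2) ^+ 2) by ring.
by rewrite mulr_ge0 ?sqr_ge0// subr_ge0.
Qed.

End rays.

(** * The symbol and its square root *)
Section generalized_symbol.
Variables (R : realType) (n : nat) (C e : 'I_n.+1 -> R) (alpha : R).
Hypotheses (C0 : forall i, 0 < C i) (e_bounds : forall i, 0 <= e i <= alpha).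
Implicit Types (mu : R[i]).

(** The leading term is treated on the same footing as the others; only the bounds on
the exponents matter for the sector estimates. *)
Definition gsym mu : R[i] := \sum_(i < n.+1) (C i)%:C * cexp ((e i)%:C * clog mu).

Let k mu i : R := C i * expR (e i * ln (cmod mu)).

Let k_gt0 mu i : 0 < k mu i. Proof. by rewrite mulr_gt0// expR_gt0. Qed.

Let Re_sum (I : Type) (s : seq I) (F : I -> R[i]) :
  complex.Re (\sum_(i <- s) F i) = \sum_(i <- s) complex.Re (F i).
Proof. by elim/big_rec2 : _ => //= i x y _ <-; rewrite cReD. Qed.

Let Im_sum (I : Type) (s : seq I) (F : I -> R[i]) :
  complex.Im (\sum_(i <- s) F i) = \sum_(i <- s) complex.Im (F i).
Proof. by elim/big_rec2 : _ => //= i x y _ <-; rewrite cImD. Qed.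

Let gsym_Re mu : complex.Re (gsym mu) = \sum_i k mu i * cos (e i * slit_arg mu).
Proof.
rewrite /gsym Re_sum; apply: eq_bigr => i _.
by rewrite cRe_realM /cexp cRe_realM cRe_realM cIm_realM /k /= mulrA.
Qed.

Let gsym_Im mu : complex.Im (gsym mu) = \sum_i k mu i * sin (e i * slit_arg mu).
Proof.
rewrite /gsym Im_sum; apply: eq_bigr => i _.
by rewrite cIm_realM /cexp cIm_realM cRe_realM cIm_realM /k /= mulrA.
Qed.

Section upper_region.
Variable mu : R[i].
Hypotheses (arg0 : 0 <= slit_arg mu) (argpi : alpha * slit_arg mu < pi).
Let beta := slit_arg mu.

Let e_arg i : 0 <= e i * beta <= alpha * beta.
Proof. by have /andP[e0 ea] := e_bounds i; rewrite mulr_ge0//= ler_wpM2r. Qed.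

Let ab_ge0 : 0 <= alpha * beta.
Proof. by have /andP[h1 h2] := e_arg ord0; exact: le_trans h2. Qed.

Let e_mid i : - (pi / 2) < e i * beta - alpha * beta / 2 < pi / 2.
Proof.
move: (e_arg i) argpi; rewrite -/beta; move: (e i * beta) (alpha * beta) => x y.
by move=> /andP[h1 h2] h3; apply/andP; split; lra.
Qed.

Let gsym_Im_ge0 : 0 <= complex.Im (gsym mu).
Proof.
rewrite gsym_Im sumr_ge0// => i _; rewrite mulr_ge0 ?(ltW (k_gt0 _ _))//.
by apply: sin_ge0_pi; have /andP[-> h] := e_arg i; rewrite (le_trans h)// ltW.
Qed.

Let gsym_mid : 0 < complex.Re (gsym mu) * cos (alpha * beta / 2) +
  complex.Im (gsym mu) * sin (alpha * beta / 2).
Proof.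
rewrite gsym_Re gsym_Im !mulr_suml -big_split /= big_ord_recl ltr_pwDl//.
  by rewrite mul_cosB mulr_gt0// cos_gt0_pihalf// e_mid.
apply: sumr_ge0 => i _.
rewrite mul_cosB mulr_ge0 ?(ltW (k_gt0 _ _))// cos_ge0_pihalf//.
by have /andP[h1 h2] := e_mid (lift ord0 i); rewrite !ltW.
Qed.

(** The half-plane around the direction alpha * arg / 2 contains every term of the
   sum and misses the cut. *)
Lemma gsym_slit : slit (gsym mu).
Proof.
have [i0|] := eqVneq (complex.Im (gsym mu)) 0; last exact: slit_Im.
apply: slit_Re; move: gsym_mid; rewrite i0 mul0r addr0.
have c0 : 0 < cos (alpha * beta / 2).
  apply: cos_gt0_pihalf; move: ab_ge0 argpi (pi_gt0 R); rewrite -/beta.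
  by move: (alpha * beta) => y h1 h2 h3; apply/andP; split; lra.
by rewrite pmulr_lgt0.
Qed.

(** If the argument of the sum exceeded alpha * beta, then its imaginary part would be
positive after a rotation by - alpha * beta, whereas every term has then a
nonpositive one. *)
Lemma gsym_arg : 0 <= slit_arg (gsym mu) <= alpha * beta.
Proof.
have sg := gsym_slit; rewrite slit_arg_ge0//=.
rewrite leNgt; apply/negP => lt.
have [h1 h2] := slit_arg_cos_sin sg.
have /andP[_ ap] := slit_arg_lt (gsym mu).
have ab0 := ab_ge0.
have : 0 < cmod (gsym mu) * sin (slit_arg (gsym mu) - alpha * beta).
  rewrite mulr_gt0 ?slit_cmod_gt0// sin_gt0_pi// subr_gt0 lt /=.
  by rewrite ltrBlDr (lt_le_trans ap)// lerDl.
rewrite sinB mulrBr [X in X - _]mulrA [X in _ - X]mulrA h1 h2 gsym_Re gsym_Im !mulr_suml -sumrB.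
rewrite ltNge => /negP; apply; apply: sumr_le0 => i _.
rewrite mul_sinB pmulr_rle0// -oppr_ge0 -sinN opprB.
have /andP[h3 h4] := e_arg i.
apply: sin_ge0_pi; apply/andP; split; first by rewrite subr_ge0; exact: h4.
by rewrite (le_trans _ (ltW argpi))// gerBl; exact: h3.
Qed.

End upper_region.

Lemma C1at_gsym mu : slit mu -> C1at gsym mu.
Proof.
move=> smu; apply: C1at_sum => i; apply: C1atM; first exact: C1at_cst.
apply: (C1at_comp (f := @cexp R)); last exact: C1at_cexp.
by apply: C1atM; [exact: C1at_cst|exact: C1at_clog].
Qed.

(** The branch of the square root with values in the right half-plane. *)
Definition gsqrt mu : R[i] := cexp (2^-1%:C * clog (gsym mu)).

Lemma gsqrt_neq0 mu : gsqrt mu != 0.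
Proof. exact: cexp_neq0. Qed.

Lemma C1at_gsqrt mu : slit mu -> slit (gsym mu) -> C1at gsqrt mu.
Proof.
move=> smu sg; apply: (C1at_comp (f := @cexp R)); last exact: C1at_cexp.
apply: C1atM; first exact: C1at_cst.
by apply: (C1at_comp (f := @clog R)); [exact: C1at_gsym|exact: C1at_clog].
Qed.

Lemma gsqrt_Re_ge mu om : 0 <= slit_arg mu <= om -> 0 <= alpha -> alpha * om < pi ->
  cos (alpha * om / 2) * cmod (gsqrt mu) <= complex.Re (gsqrt mu).
Proof.
move=> /andP[a0 ao] al0 aop.
have aa : alpha * slit_arg mu <= alpha * om by rewrite ler_wpM2l.
have /andP[g0 g1] := gsym_arg a0 (le_lt_trans aa aop).
rewrite /gsqrt cmod_cexp /cexp [leRHS]cRe_realM mulrC ler_wpM2l ?expR_ge0//.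
rewrite cIm_realM [complex.Im (clog _)]/= [complex.Re (_ +i* _)]/=.
by apply: cos_decreasing; lra.
Qed.

Definition gsym_real (s : R) : R := \sum_i C i * s `^ e i.

Lemma gsym_real_gt0 s : 0 < s -> 0 < gsym_real s.
Proof.
move=> s0; rewrite /gsym_real big_ord_recl ltr_pwDl ?mulr_gt0 ?powR_gt0//.
by apply: sumr_ge0 => i _; rewrite mulr_ge0 ?powR_ge0// ltW.
Qed.

Lemma gsym_realE s : 0 < s -> gsym s%:C = (gsym_real s)%:C.
Proof.
move=> s0; rewrite /gsym /gsym_real rmorph_sum /=; apply: eq_bigr => i _.
rewrite clog_real// -rmorphM /= cexp_real -rmorphM /=; congr (_ * _)%:C.
by rewrite /powR gt_eqF.
Qed.

Definition gsqrt_real (s : R) : R := expR (2^-1 * ln (gsym_real s)).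

Lemma gsqrt_realE s : 0 < s -> gsqrt s%:C = (gsqrt_real s)%:C.
Proof.
move=> s0; rewrite /gsqrt gsym_realE// clog_real ?gsym_real_gt0//.
by rewrite -rmorphM /= cexp_real.
Qed.

Lemma gsqrt_real_sqr s : 0 < s -> gsqrt_real s ^+ 2 = gsym_real s.
Proof.
move=> s0; rewrite /gsqrt_real -expRM_natl mulrA divff// mul1r lnK// posrE.
exact: gsym_real_gt0.
Qed.

Lemma gsqrt_real_le s : 1 <= s -> alpha <= 2 -> gsqrt_real s <= (1 + \sum_i C i) * s.
Proof.
move=> s1 a2; have s0 : 0 < s by rewrite (lt_le_trans ltr01).
have K0 : 0 <= \sum_i C i by apply: sumr_ge0 => i _; exact: ltW.
rewrite -(ler_pXn2r (n := 2))// ?nnegrE ?expR_ge0 ?mulr_ge0 ?addr_ge0 ?(ltW s0)//.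
rewrite gsqrt_real_sqr// exprMn.
apply: (@le_trans _ _ ((\sum_i C i) * s ^+ 2)).
  rewrite mulr_suml; apply: ler_sum => i _; rewrite ler_wpM2l ?(ltW (C0 _))//.
  rewrite -powR_mulrn ?(ltW s0)// ler_powR//.
  by have /andP[_ h] := e_bounds i; exact: le_trans h a2.
rewrite ler_wpM2r ?sqr_ge0// expr2.
rewrite (le_trans (_ : _ <= 1 + \sum_i C i))// ?lerDr//.
by rewrite ler_peMl ?addr_ge0// lerDl.
Qed.

End generalized_symbol.

(** * Explicit integrals on the half-line *)
Section explicit_integrals.
Variable R : realType.
Notation mu := (@lebesgue_measure R).
Notation Rp := (`[0%R, +oo[%classic : set R).

Lemma ge0_integral_primitive (f F : R -> R) (l : R) :
  (forall x, 0 <= x -> 0 <= f x) -> {within Rp, continuous f} ->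
  F x @[x --> +oo] --> l -> (forall x : R, 0 <= x -> is_derive x 1 F (f x)) ->
  mu.-integrable Rp (EFin \o f) /\ \int[mu]_(x in Rp) f x = l - F 0.
Proof.
move=> f0 cf Fl dF.
have e : (\int[mu]_(x in Rp) (f x)%:E = l%:E - (F 0)%:E)%E.
  apply: ge0_continuous_FTC2y => //.
  - by move=> x x0; apply: ex_derive; apply: dF; exact: ltW.
  - by apply: cvg_at_right_filter; exact: is_derive_continuous (dF 0 (lexx 0)).
  - by move=> x; rewrite in_itv /= andbT => x0; apply: derive1_is_derive; apply: dF; exact: ltW.
split; last by rewrite /Rintegral e.
apply/integrableP; split.
  by apply/measurable_EFinP; apply: subspace_continuous_measurable_fun => //; exact: measurable_itv.
rewrite (@eq_integral _ _ _ mu Rp (EFin \o f)); first by rewrite e -EFinB ltry.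
by move=> x; rewrite inE => /Rpos_itv x0 /=; rewrite ger0_norm ?f0.
Qed.

Lemma cvg_atan_affine (a b : R) : 0 < b -> atan ((x - a) / b) @[x --> +oo] --> pi / 2.
Proof.
move=> b0; have h : (x - a) / b @[x --> +oo] --> +oo.
  apply: gt0_cvgMly; first by rewrite invr_gt0.
  apply/cvgryPge => A; near=> x.
  by rewrite lerBrDr; near: x; exact: nbhs_pinfty_ge.
exact: (cvg_comp _ _ h (@cvgy_atan R)).
Unshelve. all: end_near. Qed.

(** The mass of the Poisson kernel on a half-line; only the sum of two such masses,
where the arctangents cancel, is used for Cauchy's formula. *)
Lemma Cauchy_density_integral (a b : R) : 0 < b ->
  mu.-integrable Rp (EFin \o (fun r => b / (b ^+ 2 + (r - a) ^+ 2))) /\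
  \int[mu]_(r in Rp) (b / (b ^+ 2 + (r - a) ^+ 2)) = pi / 2 + atan (a / b).
Proof.
move=> b0; have d0 (x : R) : 0 < b ^+ 2 + (x - a) ^+ 2.
  by rewrite ltr_pwDl ?exprn_gt0// sqr_ge0.
have d (x : R) : is_derive x 1 (fun r => atan ((r - a) / b)) (b / (b ^+ 2 + (x - a) ^+ 2)).
  have d1 : is_derive x 1 (fun r : R => (r - a) / b) b^-1.
    apply: is_derive_eq; rewrite /GRing.scale /=; ring.
  have d2 := @is_derive1_comp R atan (fun r => (r - a) / b) x _ _ (is_derive1_atan _) d1.
  have b1 : b != 0 by rewrite gt_eqF.
  have d3 : b ^+ 2 + (x - a) ^+ 2 != 0 by rewrite gt_eqF.
  have -> : b / (b ^+ 2 + (x - a) ^+ 2) = (1 + ((x - a) / b) ^+ 2)^-1 * b^-1.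
    have -> : 1 + ((x - a) / b) ^+ 2 = (b ^+ 2 + (x - a) ^+ 2) / b ^+ 2 by field.
    by field; rewrite b1 d3.
  exact: d2.
have [||h1 h2] := ge0_integral_primitive (f := fun r => b / (b ^+ 2 + (r - a) ^+ 2))
  _ _ (cvg_atan_affine a b0) (fun x _ => d x).
- by move=> x _; rewrite divr_ge0 ?(ltW b0)// ltW.
- apply: continuous_subspaceT => x; apply: cvgM; first exact: cvg_cst.
  apply: cvgV; first by rewrite gt_eqF.
  apply: cvgD; first exact: cvg_cst.
  rewrite expr2; apply: cvgM; apply: cvgB; [exact: cvg_id|exact: cvg_cst|exact: cvg_id|exact: cvg_cst].
split => //; rewrite h2 sub0r mulNr atanN opprK//.
Qed.

Lemma inv_sqr_integral :
  mu.-integrable Rp (EFin \o (fun r : R => (1 + r) ^- 2)) /\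
  \int[mu]_(r in Rp) (1 + r) ^- 2 = 1.
Proof.
have p (x : R) : 0 <= x -> 0 < 1 + x by move=> x0; rewrite ltr_pwDl.
pose F (r : R) := - (1 + r)^-1.
have d (x : R) : 0 <= x -> is_derive x 1 F ((1 + x) ^- 2).
  move=> /p x0; have n0 : 1 + x != 0 by rewrite gt_eqF.
  have dv : is_derive x 1 (fun r : R => (1 + r)^-1) (- (1 + x) ^- 2).
    have d1 : is_derive x 1 (fun r : R => 1 + r) 1.
      by have := is_deriveD (is_derive_cst (1 : R) x 1) (is_derive_id x 1); rewrite add0r.
    by have := @is_deriveV R (fun r => 1 + r) x 1 1 n0 d1; rewrite /GRing.scale /= mulr1.
  by rewrite /F -[X in is_derive _ _ _ X]opprK; exact: is_deriveN.
have F0 : F x @[x --> +oo] --> 0.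
  apply/cvgrPdist_lt => e e0; near=> x.
  have x0 : 0 <= x by near: x; apply: nbhs_pinfty_ge; exact: num_real.
  have xe : e^-1 < x by near: x; apply: nbhs_pinfty_gt; exact: num_real.
  rewrite sub0r opprK ger0_norm ?invr_ge0 ?(ltW (p _ x0))// invf_plt ?posrE ?p//.
  by rewrite (lt_le_trans xe)// lerDr.
have [||h1 h2] := ge0_integral_primitive (f := fun r : R => (1 + r) ^- 2) _ _ F0 d.
- by move=> x x0; rewrite invr_ge0 sqr_ge0.
- apply/within_contP => t /Rpos_itv t0 e e0.
  have c : {for t, continuous (fun r : R => (1 + r) ^- 2)}.
    apply: cvgV; first by rewrite expf_neq0// gt_eqF// p.
    by rewrite expr2; apply: cvgM; (apply: cvgD; [exact: cvg_cst|exact: cvg_id]).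
  move/cvgrPdist_lt: c => /(_ e e0)/nbhs_ballP[dl /= dl0 h]; exists dl => // u _ ut.
  by rewrite distrC; apply: h; rewrite /ball /= distrC.
by split => //; rewrite h2 /F addr0 invr1 sub0r opprK.
Unshelve. all: end_near. Qed.

End explicit_integrals.

(** * Cauchy's theorem: rotation of the ray *)
Section ray_paths.
Variable R : realType.
Implicit Types (f : R[i] -> R[i]).

Definition edir (th : R) : R[i] := cos th +i* sin th.

Lemma cmod_edir th : cmod (edir th) = 1.
Proof. exact: cmod_cos_sin. Qed.

Lemma rayE (r th : R) : ray r th = 1 + r%:C * edir th.
Proof. by apply: complex_eq; rewrite /ray /edir /= !mul0r ?subr0 ?addr0 ?add0r. Qed.

Lemma ray_sub1 (r th : R) : ray r th - 1 = r%:C * edir th.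
Proof. by rewrite rayE addrAC subrr add0r. Qed.

Lemma ccont_filter {T : Type} (F : set_system T) {FF : Filter F} f (gamma : T -> R[i]) z :
  ccont f z -> complex.Re (gamma t) @[t --> F] --> complex.Re z ->
  complex.Im (gamma t) @[t --> F] --> complex.Im z ->
  forall e : R, 0 < e -> \forall t \near F, cmod (f (gamma t) - f z) < e.
Proof.
move=> cf cr ci e e0; have [d d0 hd] := cf e e0; have d2 : 0 < d / 2 by rewrite divr_gt0.
have h1 : \forall t \near F, `|complex.Re z - complex.Re (gamma t)| < d / 2.
  by move/cvgrPdist_lt: cr; apply.
have h2 : \forall t \near F, `|complex.Im z - complex.Im (gamma t)| < d / 2.
  by move/cvgrPdist_lt: ci; apply.
apply: filterS2 h1 h2 => t t1 t2; apply: hd; rewrite (le_lt_trans (cmod_le_ReIm _))// [d]splitr.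
by rewrite cReD cReN cImD cImN; apply: ltrD; rewrite distrC.
Qed.

Lemma ray_derive_r (r th : R) :
  is_derive r 1 (fun r => complex.Re (ray r th)) (cos th) /\
  is_derive r 1 (fun r => complex.Im (ray r th)) (sin th).
Proof.
by split; rewrite /ray /=; apply: is_derive_eq; rewrite /GRing.scale /=; ring.
Qed.

Lemma ray_derive_th (r th : R) :
  is_derive th 1 (fun th => complex.Re (ray r th)) (- (r * sin th)) /\
  is_derive th 1 (fun th => complex.Im (ray r th)) (r * cos th).
Proof.
by split; rewrite /ray /=; apply: is_derive_eq; rewrite /GRing.scale /=; ring.
Qed.

Lemma ray_continuous_r f (r th : R) : ccont f (ray r th) ->
  {for r, continuous (fun r => complex.Re (f (ray r th)))} /\
  {for r, continuous (fun r => complex.Im (f (ray r th)))}.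
Proof.
move=> cf; have [d1 d2] := ray_derive_r r th.
exact: (ccont_path (gamma := fun r => ray r th) cf (is_derive_continuous d1) (is_derive_continuous d2)).
Qed.

Lemma compact_rect_bounded (g : R * R -> R) (a b c d : R) :
  (forall x, a <= x.1 <= b -> c <= x.2 <= d -> {for x, continuous g}) ->
  exists B : R, forall r t, a <= r <= b -> c <= t <= d -> `|g (r, t)| <= B.
Proof.
move=> cg; pose A : set (R * R) := (`[a, b]%classic : set R) `*` (`[c, d]%classic : set R).
have cA : compact A by apply: compact_setX; exact: (@segment_compact R _ _).
have cgA : {within A, continuous g}.
  apply: continuous_in_subspaceT => x; rewrite inE /A /= !in_itv /= => -[h1 h2].
  exact: cg.
have [M [_ hM]] := compact_bounded (continuous_compact cgA cA).
exists (M + 1) => r t rab tcd; apply: (hM (M + 1)); first by rewrite ltrDl.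
by exists (r, t) => //; rewrite /A /= !in_itv /=.
Qed.

Lemma Rintegral_FTC (F g : R -> R) (P : R) : 0 < P ->
  (forall r : R, 0 <= r -> is_derive r 1 F (g r)) -> {within `[0, P], continuous g} ->
  \int[@lebesgue_measure R]_(r in `[0, P]) g r = F P - F 0.
Proof.
move=> P0 dF cg.
rewrite /Rintegral (@continuous_FTC2 _ _ F)//.
- split.
  + by move=> r; rewrite in_itv /= => /andP[r0 _]; apply: ex_derive; exact: dF (ltW r0).
  + by apply: cvg_at_right_filter; exact: is_derive_continuous (dF _ (lexx 0)).
  + by apply: cvg_at_left_filter; exact: is_derive_continuous (dF _ (ltW P0)).
- move=> r; rewrite in_itv /= => /andP[r0 _]; apply: derive1_is_derive.
  exact: dF (ltW r0).
Qed.

End ray_paths.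

Section cauchy_rays.
Variables (R : realType) (h : R[i] -> R[i]) (om' Ch : R).
Notation mu := (@lebesgue_measure R).
Notation Rp := (`[0%R, +oo[%classic : set R).
Hypotheses (om'pi : om' < pi) (Ch0 : 0 <= Ch).
Hypothesis hC1 : forall r th : R, 0 <= r -> 0 <= th < om' -> C1at h (ray r th).
Hypothesis hb : forall r th : R, 0 <= r -> 0 <= th < om' -> cmod (h (ray r th)) <= Ch / (1 + r).
Variable a : R.
Hypothesis a0 : 0 < a.
Let s : R[i] := (1 + a)%:C.

(** The difference of the Cauchy integrals over two conjugate rays, for a function that
commutes with conjugation, is 2 i times the integral of this imaginary part. *)
Definition ray_integrand (th r : R) : R :=
  complex.Im (h (ray r th) * edir th / (s - ray r th)).
Let N := ray_integrand.

Let sin_half_gt0 (th : R) : 0 < th < om' -> 0 < sin (th / 2).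
Proof.
by move=> /andP[t0 to]; apply: sin_gt0_pi; move: (pi_gt0 R) om'pi => *; apply/andP; split; lra.
Qed.

Let pole_ge (r th eta : R) : 0 <= r -> 0 < eta <= th -> th < om' ->
  sin (eta / 2) * (a + r) <= cmod (s - ray r th).
Proof.
move=> r0 /andP[e0 et] to; apply: pole_cmod_ge => //; [exact: ltW|by rewrite ltW|].
by rewrite ltW// (lt_trans to).
Qed.

Let pole_neq0 (r th : R) : 0 <= r -> 0 < th < om' -> s - ray r th != 0.
Proof.
move=> r0 tho; have /andP[t0 to] := tho; rewrite -cmod_gt0.
apply: lt_le_trans (pole_ge r0 _ to (eta := th)); last by rewrite t0 lexx.
by rewrite mulr_gt0 ?sin_half_gt0// ltr_wpDr.
Qed.

Let weak (th : R) : 0 < th < om' -> 0 <= th < om'.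
Proof. by move=> /andP[/ltW -> ->]. Qed.

Let C1at_pole (r th : R) : 0 <= r -> 0 < th < om' -> C1at (fun w => (s - w)^-1) (ray r th).
Proof.
move=> r0 tho; apply: (C1atV (f := fun w => s - w)); first exact: pole_neq0.
have -> : (fun w => s - w) = (fun w => s + (-1) * w) by apply/funext => w; rewrite mulN1r.
by apply: C1atD; [exact: C1at_cst|apply: C1atM; [exact: C1at_cst|exact: C1at_id]].
Qed.

Let m := Num.min a 1.
Let m0 : 0 < m. Proof. by rewrite lt_min a0 ltr01. Qed.
Let m_le r : 0 <= r -> m * (1 + r) <= a + r.
Proof.
move=> r0; rewrite mulrDr mulr1 lerD ?ge_min ?lexx//.
by rewrite -{2}(mul1r r) ler_wpM2r// ge_min lexx orbT.
Qed.

Let N_bound (r th eta : R) : 0 <= r -> 0 < eta <= th -> th < om' ->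
  `|N th r| <= Ch / (sin (eta / 2) * m) * (1 + r) ^- 2.
Proof.
move=> r0 et to; have /andP[e0 e1] := et; have t0 := lt_le_trans e0 e1.
have se := sin_half_gt0 (introT andP (conj e0 (le_lt_trans e1 to))).
have r1 : 0 < 1 + r by rewrite ltr_pwDl.
rewrite (le_trans (Im_le_cmod _))// !cmodM cmod_edir mulr1 cmodV.
have p0 : 0 < sin (eta / 2) * (m * (1 + r)) by rewrite !mulr_gt0.
have p1 : sin (eta / 2) * (m * (1 + r)) <= cmod (s - ray r th).
  by rewrite (le_trans _ (pole_ge r0 et to))// ler_wpM2l ?(ltW se)// m_le.
have -> : Ch / (sin (eta / 2) * m) * (1 + r) ^- 2 = (Ch / (1 + r)) * (sin (eta / 2) * (m * (1 + r)))^-1.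
  by field; rewrite !gt_eqF.
rewrite ler_pM ?cmod_ge0 ?invr_ge0 ?cmod_ge0//; first by apply: hb => //; rewrite (ltW t0).
by rewrite lef_pV2 ?posrE// (lt_le_trans p0).
Qed.

Let N_continuous th : 0 < th < om' -> {within Rp, continuous (N th)}.
Proof.
move=> tho; apply/within_contP => r /Rpos_itv r0 e e0.
have c : ccont (fun w => h w * edir th / (s - w)) (ray r th).
  apply: C1at_continuous; apply: C1atM; last exact: C1at_pole.
  by apply: C1atM; [apply: hC1 => //; exact: weak|exact: C1at_cst].
have [_ /cvgrPdist_lt/(_ e e0)/nbhs_ballP[d /= d0 hd]] := ray_continuous_r c.
by exists d => // u _ ur; rewrite distrC; apply: hd; rewrite /ball /= distrC.
Qed.

Lemma ray_integrand_integrable th : 0 < th < om' -> mu.-integrable Rp (EFin \o N th).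
Proof.
move=> tho; have /andP[t0 to] := tho.
apply: (dominated_integrable (g := fun r => Ch / (sin (th / 2) * m) * (1 + r) ^- 2)).
- exact: measurable_itv.
- apply: subspace_continuous_measurable_fun; [exact: measurable_itv|exact: N_continuous].
- by apply: RintegrableZ; [exact: measurable_itv|exact: (inv_sqr_integral R).1].
- by move=> r /Rpos_itv r0; apply: N_bound => //; rewrite t0 lexx.
Qed.

(** q vanishes at the vertex of the ray, and dividing it by w - 1 = r e^(i th) gives
back the integrand: this puts the integrand in the form Im q / r, whose derivative in
th is a derivative in r. *)
Let q w := h w * (w - 1) / (s - w).

Let N_q (th r : R) : 0 < r -> N th r = complex.Im (q (ray r th)) / r.
Proof.
move=> r0; rewrite /N /ray_integrand /q ray_sub1.
have -> : h (ray r th) * (r%:C * edir th) / (s - ray r th) =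
  r%:C * (h (ray r th) * edir th / (s - ray r th)) by ring.
by rewrite cIm_realM; move: (complex.Im _) => I; field; rewrite gt_eqF.
Qed.

Let q_C1 (r th : R) : 0 <= r -> 0 < th < om' -> C1at q (ray r th).
Proof.
move=> r0 tho; apply: C1atM; last exact: C1at_pole.
apply: C1atM; first by apply: hC1 => //; exact: weak.
by apply: C1atD; [exact: C1at_id|exact: C1at_cst].
Qed.

Let U : set R[i] := [set z | exists r th, [/\ 0 <= r, 0 < th < om' & z = ray r th]].

Let q_bound P th eta : 0 <= P -> 0 < eta <= th -> th < om' ->
  `|complex.Re (q (ray P th))| <= Ch / sin (eta / 2) * (1 + P)^-1.
Proof.
move=> P0 et to; have /andP[e0 e1] := et; have t0 := lt_le_trans e0 e1.
have se := sin_half_gt0 (introT andP (conj e0 (le_lt_trans e1 to))).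
have P1 : 0 < 1 + P by rewrite ltr_pwDl.
have aP : 0 < a + P by rewrite ltr_wpDr.
rewrite (le_trans (Re_le_cmod _))// /q ray_sub1.
rewrite !cmodM cmod_edir mulr1 cmodV cmod_real ger0_norm//.
have p0 : 0 < sin (eta / 2) * (a + P) by rewrite mulr_gt0.
have hP : cmod (h (ray P th)) <= Ch / (1 + P) by apply: hb => //; rewrite (ltW t0).
apply: (@le_trans _ _ (Ch / (1 + P) * (a + P) * (sin (eta / 2) * (a + P))^-1)).
  rewrite ler_pM ?mulr_ge0 ?cmod_ge0 ?invr_ge0 ?cmod_ge0//.
    by rewrite ler_pM ?cmod_ge0// lerDr ltW.
  have p1 := pole_ge P0 et to.
  by rewrite lef_pV2 ?posrE// (lt_le_trans p0).
rewrite le_eqVlt; apply/orP; left; apply/eqP; field; by rewrite !gt_eqF.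
Qed.

Section with_derivative.
Variable q' : R[i] -> R[i].
Hypothesis hq' : forall z, U z -> cderiv q z (q' z) /\ ccont q' z.

Let D r th := complex.Re (q' (ray r th) * edir th).

Let UE (r th : R) : 0 <= r -> 0 < th < om' -> U (ray r th).
Proof. by move=> r0 tho; exists r, th. Qed.

(** Together with [dQ], the Cauchy-Riemann equation in polar coordinates. *)
Let dN th r : 0 < r -> 0 < th < om' -> is_derive th 1 (N^~ r) (D r th).
Proof.
move=> r0 tho; have [cd _] := hq' (UE (ltW r0) tho).
rewrite (_ : N^~ r = fun t => r^-1 * complex.Im (q (ray r t))); last first.
  by apply/funext => t; rewrite N_q// mulrC.
have [d1 d2] := ray_derive_th r th.
have [_ dI] := path_derive (gamma := fun t => ray r t) cd d1 d2.
have := @is_deriveZ _ _ _ _ r^-1 _ _ _ dI; rewrite /GRing.scale /=.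
congr (is_derive _ _ _ _); rewrite /D cImM cReM /edir /=.
by field; rewrite gt_eqF.
Qed.

Let dQ (r th : R) : 0 <= r -> 0 < th < om' ->
  is_derive r 1 (fun r => complex.Re (q (ray r th))) (D r th).
Proof.
move=> r0 tho; have [cd _] := hq' (UE r0 tho).
have [d1 d2] := ray_derive_r r th.
by have [dR _] := path_derive (gamma := fun r => ray r th) cd d1 d2.
Qed.

Let D_continuous th : 0 < th < om' -> {within Rp, continuous (D^~ th)}.
Proof.
move=> tho; apply/within_contP => r /Rpos_itv r0 e e0.
have [_ cq'] := hq' (UE r0 tho).
have c : ccont (fun w => q' w * edir th) (ray r th).
  by apply: ccontM => //; exact: ccont_cst.
have [/cvgrPdist_lt/(_ e e0)/nbhs_ballP[d /= d0 hd] _] := ray_continuous_r c.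
by exists d => // u _ ur; rewrite distrC; apply: hd; rewrite /ball /= distrC.
Qed.

Let D_bounded P t1 t2 : 0 < t1 -> t2 < om' ->
  exists B : R, forall r th, 0 <= r <= P -> t1 <= th <= t2 -> `|D r th| <= B.
Proof.
move=> t10 t2o.
have [|B hB] := @compact_rect_bounded R (fun x => cmod (q' (ray x.1 x.2))) 0 P t1 t2.
  move=> [r th] /= /andP[r0 _] /andP[t1t tt2].
  have tho : 0 < th < om' by rewrite (lt_le_trans t10)// (le_lt_trans tt2).
  have [_ cq'] := hq' (UE r0 tho).
  apply/cvgrPdist_lt => e e0.
  have cr : complex.Re (ray x.1 x.2) @[x --> (r, th)] --> complex.Re (ray r th).
    rewrite /ray /=; apply: cvgD; first exact: cvg_cst.
    apply: cvgM; first exact: cvg_fst.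
    have ct : {for (r, th), continuous (@cos R \o snd)}.
      by apply: continuous_comp; [exact: cvg_snd|exact: continuous_cos].
    exact: ct.
  have ci : complex.Im (ray x.1 x.2) @[x --> (r, th)] --> complex.Im (ray r th).
    rewrite /ray /=; apply: cvgM; first exact: cvg_fst.
    have ct : {for (r, th), continuous (@sin R \o snd)}.
      by apply: continuous_comp; [exact: cvg_snd|exact: continuous_sin].
    exact: ct.
  apply: filterS (ccont_filter cq' cr ci e0) => x; apply: le_lt_trans.
  by rewrite distrC; exact: (@rnorm_dist R R[i]^o).
exists B => r th rP tt; apply: le_trans (hB r th rP tt).
rewrite [leRHS]ger0_norm ?cmod_ge0// /D (le_trans (Re_le_cmod _))// cmodM cmod_edir mulr1//.
Qed.

Let G P th := \int[mu]_(r in `]0%R, P]) N th r.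

(** Differentiation under the integral sign over a bounded segment, followed by the
fundamental theorem of calculus in r. *)
Let G_derive P th : 0 < P -> 0 < th < om' ->
  is_derive th 1 (G P) (complex.Re (q (ray P th))).
Proof.
move=> P0 tho; have /andP[t0 to] := tho.
pose u := th / 2; pose v := (th + om') / 2.
have u0 : 0 < u by rewrite divr_gt0.
have vo : v < om' by rewrite /v; lra.
have ut : u < th by rewrite /u; lra.
have tv : th < v by rewrite /v; lra.
have Ith : (`]u, v[%classic : set R) th by rewrite /= in_itv /= ut.
have inI x : (`]u, v[%classic : set R) x -> 0 < x < om'.
  rewrite /= in_itv /= => /andP[h1 h2].
  by rewrite (lt_trans u0)// (lt_trans h2).
have mB : measurable (`]0%R, P]%classic : set R) by exact: measurable_itv.
have sub : `]0%R, P] `<=` Rp by move=> r /=; rewrite !in_itv /= => /andP[/ltW ->].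
have iN x : (`]u, v[%classic : set R) x -> mu.-integrable `]0%R, P] (EFin \o N x).
  move=> /inI xo.
  have i0 := ray_integrand_integrable xo.
  by apply: (integrableS _ _ _ i0) => //; exact: measurable_itv.
have [B hB] := D_bounded P u0 vo.
have B0 : 0 <= B.
  apply: (le_trans (normr_ge0 (D 0 th))); apply: hB; first by rewrite lexx ltW.
  by rewrite !ltW.
have dN' x y : (`]u, v[%classic : set R) x -> (`]0%R, P]%classic : set R) y ->
    is_derive x 1 (N^~ y) (D y x).
  by move=> /inI xo; rewrite /= in_itv /= => /andP[y0 _]; exact: dN.
have derN x y : (`]u, v[%classic : set R) x -> (`]0%R, P]%classic : set R) y ->
    derivable (N^~ y) x 1 by move=> Ix By; apply: ex_derive; exact: dN'.
have iB : mu.-integrable `]0%R, P] (EFin \o (fun=> B)).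
  apply: (integrableS _ _ _ (integrable_itv_cst 0 P B)); try exact: measurable_itv.
  exact: subset_itv_oc_cc.
have ub x y : (`]u, v[%classic : set R) x -> (`]0%R, P]%classic : set R) y ->
    `|partial1of2 N x y| <= B.
  move=> Ix By; rewrite /partial1of2 (derive1_is_derive (dN' x y Ix By)).
  move: Ix By; rewrite /= !in_itv /= => /andP[x1 x2] /andP[y1 y2].
  by apply: hB; rewrite ?(ltW x1) ?(ltW x2) ?(ltW y1).
have dv := @derivable_under_integral R _ _ mu N _ mB th u v Ith iN derN (fun=> B)
  (fun=> B0) iB ub.
have ev := @differentiation_under_integral R _ _ mu N _ mB th u v Ith iN derN (fun=> B)
  (fun=> B0) iB ub.
have -> : complex.Re (q (ray P th)) = (fun th => \int[mu]_(r in `]0%R, P]) N th r)^`()%classic th.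
  rewrite ev.
  have -> : \int[mu]_(y in `]0%R, P]) (partial1of2 N)^~ y th = \int[mu]_(y in `]0%R, P]) D y th.
    by apply: eq_Rintegral => y; rewrite inE => By; rewrite /partial1of2 (derive1_is_derive (dN' th y Ith By)).
  have cD : {within `[0%R, P], continuous (D^~ th)}.
    apply: continuous_subspaceW (D_continuous tho) => r /=.
    by rewrite !in_itv /= => /andP[->].
  have iD : mu.-integrable `[0%R, P] (EFin \o (D^~ th)).
    by apply: continuous_compact_integrable; [exact: segment_compact|exact: cD].
  rewrite Rintegral_itv_obnd_cbnd; last first.
    by apply: (integrableS _ _ _ iD); try exact: measurable_itv; exact: subset_itv_oc_cc.
  have dQ' (r : R) : 0 <= r -> is_derive r 1 (fun r => complex.Re (q (ray r th))) (D r th).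
    by move=> r0; exact: dQ.
  rewrite (Rintegral_FTC P0 dQ' cD).
  have -> : complex.Re (q (ray 0 th)) = 0 by rewrite /q ray_sub1 rmorph0 mul0r mulr0 mul0r.
  by rewrite subr0.
by rewrite derive1E; apply/derivableP.
Qed.

(** By the mean value theorem in the angle, the integrals over the segments of length n
differ by a boundary term of size 1/n. *)
Lemma ray_rotation_aux eta om : 0 < eta < om -> om < om' ->
  \int[mu]_(r in Rp) N om r = \int[mu]_(r in Rp) N eta r.
Proof.
move=> /andP[e0 eo] oo'.
have Gc th : 0 < th < om' -> G n%:R th @[n --> \oo] --> \int[mu]_(r in Rp) N th r.
  move=> tho; have h1 := Rintegral_itv_cvg (ray_integrand_integrable tho).
  apply: cvg_trans h1; apply: near_eq_cvg; apply: nearW => n.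
  rewrite /G Rintegral_itv_obnd_cbnd//.
  apply: (integrableS _ _ _ (ray_integrand_integrable tho)); try exact: measurable_itv.
  by move=> r /=; rewrite !in_itv /= => /andP[/ltW ->].
have tho1 : 0 < om < om' by rewrite (lt_trans e0).
have tho2 : 0 < eta < om' by rewrite e0 (lt_trans eo).
have h1 := cvgB (Gc _ tho1) (Gc _ tho2).
have se := sin_half_gt0 tho2.
have bound n : (0 < n)%N -> `|G n%:R om - G n%:R eta| <= Ch / sin (eta / 2) * (om - eta) * n%:R^-1.
  move=> n0; have n0' : 0 < n%:R :> R by rewrite ltr0n.
  have dG x : x \in `]eta, om[ -> is_derive x 1 (G n%:R) (complex.Re (q (ray n%:R x))).
    rewrite in_itv /= => /andP[x1 x2]; apply: G_derive => //.
    by rewrite (lt_trans e0)// (lt_trans x2).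
  have cG : {within `[eta, om], continuous (G n%:R)}.
    apply: continuous_in_subspaceT => x; rewrite inE /= in_itv /= => /andP[x1 x2].
    apply: is_derive_continuous; apply: G_derive => //.
    by rewrite (lt_le_trans e0)// (le_lt_trans x2).
  have [x] := MVT eo dG cG; rewrite in_itv /= => /andP[x1 x2] ->.
  rewrite normrM (ger0_norm (_ : 0 <= om - eta)) ?subr_ge0 ?(ltW eo)//.
  rewrite mulrAC ler_wpM2r ?subr_ge0 ?(ltW eo)//.
  rewrite (le_trans (q_bound (eta := eta) (ltW n0') _ _))//.
  - by rewrite e0 ltW.
  - by rewrite (lt_trans x2).
  - rewrite ler_wpM2l ?divr_ge0 ?(ltW se)//.
    by rewrite lef_pV2 ?posrE// ?lerDr// ltr_pwDl.
have h2 : G n%:R om - G n%:R eta @[n --> \oo] --> 0.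
  have b : Ch / sin (eta / 2) * (om - eta) * n%:R^-1 @[n --> \oo] --> 0.
    rewrite -(mulr0 (Ch / sin (eta / 2) * (om - eta))); apply: cvgM; first exact: cvg_cst.
    apply/cvgrPdist_lt => e ee; near=> n; rewrite sub0r normrN.
    have : e^-1 < n%:R by near: n; exact: nbhs_infty_gtr.
    move=> en; have n0 : 0 < n%:R :> R by rewrite (lt_trans _ en)// invr_gt0.
    by rewrite ger0_norm ?invr_ge0 ?ltW// invf_plt.
  apply/cvgrPdist_lt => e ee; near=> n; rewrite sub0r normrN.
  apply: (le_lt_trans (bound n _)); first by near: n; exists 1%N.
  by near: n; exact: (cvgr_lt _ b).
apply/eqP; rewrite -subr_eq0; apply/eqP.
exact: (cvg_unique _ (h1 _) h2).
Unshelve. all: end_near. Qed.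

End with_derivative.

Lemma ray_rotation eta om : 0 < eta < om -> om < om' ->
  \int[mu]_(r in Rp) ray_integrand om r = \int[mu]_(r in Rp) ray_integrand eta r.
Proof.
have [q' hq'] : exists q' : R[i] -> R[i], forall z, U z -> cderiv q z (q' z) /\ ccont q' z.
  by apply: C1at_derivative => z [r [th [r0 tho ->]]]; exact: q_C1.
exact: ray_rotation_aux hq' _ _.
Qed.

End cauchy_rays.

(** * Cauchy's formula for the rays *)
Section cauchy_formula.
Variables (R : realType) (h : R[i] -> R[i]) (om' Ch : R).
Notation mu := (@lebesgue_measure R).
Notation Rp := (`[0%R, +oo[%classic : set R).
Hypotheses (om'pi : om' < pi) (Ch0 : 0 <= Ch).
Hypothesis hC1 : forall r th : R, 0 <= r -> 0 <= th < om' -> C1at h (ray r th).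
Hypothesis hb : forall r th : R, 0 <= r -> 0 <= th < om' -> cmod (h (ray r th)) <= Ch / (1 + r).
Hypothesis hreal : forall r : R, 0 <= r -> complex.Im (h (1 + r)%:C) = 0.
Variables (a om : R).
Hypotheses (a0 : 0 < a) (om0 : 0 < om) (omom' : om < om').
Let s : R[i] := (1 + a)%:C.
Let c := complex.Re (h s).
Let N := ray_integrand h a.

Lemma cIm_div (x y : R[i]) :
  complex.Im (x / y) = (complex.Im x * complex.Re y - complex.Re x * complex.Im y) / cmod y ^+ 2.
Proof.
case: x y => x1 x2 [y1 y2]; rewrite sqr_cmod /=; ring.
Qed.

(** The imaginary part of s e^(i th) / (ray (s - ray)), decomposed into the partial
fractions 1 / ray and 1 / (s - ray): two Poisson kernels. *)
Let Pk th r := sin th / (sin th ^+ 2 + (r - - cos th) ^+ 2) +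
  a * sin th / ((a * sin th) ^+ 2 + (r - a * cos th) ^+ 2).

Let sin_gt0' th : 0 < th <= om -> 0 < sin th.
Proof. by move=> /andP[t0 to]; apply: sin_gt0_pi; move: om'pi omom' => *; apply/andP; split; lra. Qed.

Let Pk_integral th : 0 < th <= om ->
  mu.-integrable Rp (EFin \o Pk th) /\ \int[mu]_(r in Rp) Pk th r = pi.
Proof.
move=> /sin_gt0' st; have sa : 0 < a * sin th by rewrite mulr_gt0.
have [i1 e1] := Cauchy_density_integral (- cos th) st.
have [i2 e2] := Cauchy_density_integral (a * cos th) sa.
split; first by apply: RintegrableD => //; exact: measurable_itv.
rewrite /Pk RintegralD//; first rewrite e1 e2.
rewrite mulNr atanN (_ : a * cos th / (a * sin th) = cos th / sin th); last by field; rewrite !gt_eqF.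
by move: (atan _) => A; field.
Qed.

Let s_neq0 : s != 0. Proof. by rewrite /s -cmod_gt0 cmod_real normr_gt0 gt_eqF// addr_gt0. Qed.

Let ray_gt0 th r : 0 < th <= om -> 0 <= r -> ray r th != 0.
Proof.
move=> /andP[t0 to] r0; apply: slit_neq0; apply: ray_slit => //.
by rewrite ltW//= (le_lt_trans to)// (lt_trans omom').
Qed.

Let pole_gt0 th r : 0 < th <= om -> 0 <= r -> s - ray r th != 0.
Proof.
move=> tho r0; have st := sin_gt0' tho; have /andP[t0 to] := tho; apply/eqP => e.
have := congr1 (@complex.Im R) e; rewrite /= sub0r => /eqP; rewrite oppr_eq0 mulf_eq0 (gt_eqF st) orbF.
move=> /eqP r00; move: e; rewrite r00 => /(congr1 (@complex.Re R)) /= /eqP.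
by rewrite mul0r addr0 [1 + a]addrC addrK gt_eqF.
Qed.

(** Subtracting c s / w removes the value of h at the pole and keeps the decay at
infinity. *)
Let f w := h w - c%:C * s / w.
Let E th r := complex.Im (f (ray r th) * edir th / (s - ray r th)).

Let E_eq th r : 0 < th <= om -> 0 <= r -> N th r = E th r + c * Pk th r.
Proof.
move=> tho r0; have m0 := ray_gt0 tho r0; have p0 := pole_gt0 tho r0.
have -> : Pk th r = complex.Im (edir th / ray r th) + complex.Im (edir th / (s - ray r th)).
  have e1 : sin th ^+ 2 = 1 - cos th ^+ 2 by rewrite -(cos2Dsin2 th); ring.
  rewrite !cIm_div !sqr_cmod /Pk; congr (_ / _ + _ / _); rewrite /=; try ring.
    transitivity (sin th ^+ 2 + (r + cos th) ^+ 2); first by rewrite opprK.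
    by rewrite [(r * sin th) ^+ 2]exprMn e1; ring.
  rewrite sub0r sqrrN [(r * sin th) ^+ 2]exprMn [(a * sin th) ^+ 2]exprMn e1; ring.
rewrite -cImD -cIm_realM /N /ray_integrand /E -cImD; congr complex.Im; rewrite /f -/s.
by field; apply/andP; split=> //; move: p0; rewrite /s rmorphD rmorph1; apply.
Qed.

Let mRp : measurable Rp. Proof. exact: measurable_itv. Qed.

Let iN th : 0 < th <= om -> mu.-integrable Rp (EFin \o N th).
Proof.
move=> /andP[t0 to]; apply: (ray_integrand_integrable om'pi hC1 hb a0).
by rewrite t0 (le_lt_trans to).
Qed.

Let E_integral th : 0 < th <= om ->
  mu.-integrable Rp (EFin \o E th) /\
  \int[mu]_(r in Rp) E th r = \int[mu]_(r in Rp) N om r - c * pi.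
Proof.
move=> tho; have [iP eP] := Pk_integral tho.
have iE : mu.-integrable Rp (EFin \o (fun r => N th r + - c * Pk th r)).
  by apply: RintegrableD => //; [exact: iN|exact: RintegrableZ].
have eE r : r \in Rp -> N th r + - c * Pk th r = E th r.
  by rewrite inE => /Rpos_itv r0; rewrite E_eq//; ring.
split; first by apply: eq_integrable iE => // r /eE /= ->.
rewrite -(@eq_Rintegral _ _ _ mu Rp _ _ eE) RintegralD//; [|exact: iN|exact: RintegrableZ].
rewrite RintegralZl// eP mulNr; congr (_ - _).
have /andP[t0] := tho; rewrite le_eqVlt => /predU1P[->//|to].
by apply/esym; apply: (ray_rotation om'pi Ch0 hC1 hb a0) => //; rewrite t0.
Qed.

Let sE : s = ray a 0. Proof. by rewrite ray0. Qed.

Let om'0 : 0 < om'. Proof. exact: lt_trans omom'. Qed.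

Let fs : f s = 0.
Proof.
rewrite /f -mulrA divff// mulr1; apply/eqP; rewrite subr_eq0; apply/eqP.
by apply: complex_eq => //=; rewrite /s hreal// ltW.
Qed.

Let f_C1 r th : 0 <= r -> 0 <= th < om' -> C1at f (ray r th).
Proof.
move=> r0 tho; have -> : f = fun w => h w + - (c%:C * s) * w^-1.
  by apply/funext => w; rewrite /f mulNr.
apply: C1atD; first exact: hC1.
apply: C1atM; first exact: C1at_cst.
apply: C1atV; last exact: C1at_id.
apply: slit_neq0; apply: ray_slit => //; have /andP[-> /= to] := tho.
exact: lt_trans to om'pi.
Qed.

(** Near the pole the zero of f at s compensates it; away from it both factors decay. *)
Let E_bound : exists2 K : R, 0 <= K & forall th r, 0 < th <= om -> 0 <= r ->
  `|E th r| <= K * (1 + r) ^- 2.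
Proof.
have [d [phi [cphi phis] Ef]] : exists d, cderiv f s d.
  by apply: C1at_cderiv; rewrite sE; apply: f_C1; [exact: ltW|rewrite lexx].
have [del del0 hdel] : \forall w \near cnbhs s, f w = phi w * (w - s) /\ cmod (phi w) <= cmod (phi s) + 1.
  apply: filterS2 Ef (cphi _ (@ltr01 R)) => w; rewrite fs subr0 => -> h1; split => //.
  rewrite -[phi w](subrK (phi s)) (le_trans (cmodD _ _))// addrC lerD2l ltW//.
pose K0 := cmod (phi s) + 1; have K00 : 0 <= K0 by rewrite addr_ge0 ?cmod_ge0.
pose co := cos (om / 2).
have co0 : 0 < co.
  by apply: cos_gt0_pihalf; move: om'pi omom' om0 => *; apply/andP; split; lra.
pose K1 := Ch + `|c| * (1 + a) / co.
have a1 : 0 < 1 + a by rewrite addr_gt0.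
have K10 : 0 <= K1 by rewrite addr_ge0// divr_ge0 ?mulr_ge0// ltW.
pose K2 := (1 + a) / del + 1.
have K20 : 0 <= K2 by rewrite addr_ge0// divr_ge0// ltW.
exists (K0 * (1 + a + del) ^+ 2 + K1 * K2).
  by apply: addr_ge0; apply: mulr_ge0 => //; exact: sqr_ge0.
move=> th r tho r0; have r1 : 0 < 1 + r by rewrite ltr_pwDl.
have m0 := ray_gt0 tho r0; have p0 := pole_gt0 tho r0; have /andP[t0 to] := tho.
have pa : `|r - a| <= cmod (s - ray r th).
  rewrite -(ler_pXn2r (n := 2)) ?nnegrE ?cmod_ge0 ?normr_ge0// real_normK ?num_real//.
  rewrite sqr_cmod /= sub0r sqrrN [(r * sin th) ^+ 2]exprMn.
  have -> : sin th ^+ 2 = 1 - cos th ^+ 2 by rewrite -(cos2Dsin2 th); ring.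
  rewrite -subr_ge0.
  have -> : (1 + a - (1 + r * cos th)) ^+ 2 + r ^+ 2 * (1 - cos th ^+ 2) - (r - a) ^+ 2 =
    2 * (a * r) * (1 - cos th) by ring.
  by rewrite !mulr_ge0 ?(ltW a0)// subr_ge0 cos_le1.
rewrite (le_trans (Im_le_cmod _))// /E !cmodM cmod_edir mulr1 cmodV.
have q0 : 0 < cmod (s - ray r th) by rewrite cmod_gt0.
have [near|far] := ltP (cmod (ray r th - s)) del.
- have [-> ph] := hdel _ near.
  rewrite cmodM -[cmod (_ - s)]cmodN opprB mulfK ?gt_eqF// (le_trans ph)//.
  rewrite ler_pdivlMr ?exprn_gt0// -/K0 (le_trans (y := K0 * (1 + a + del) ^+ 2))//.
    rewrite ler_wpM2l// ler_pXn2r ?nnegrE ?ltW// ?addr_gt0//.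
    have := ler_norm (r - a); move: near pa; rewrite -cmodN opprB.
    move: (cmod _) `|_| => x y; lra.
  by rewrite lerDl mulr_ge0.
- have -> : (K0 * (1 + a + del) ^+ 2 + K1 * K2) * (1 + r) ^- 2 =
    K0 * (1 + a + del) ^+ 2 * (1 + r) ^- 2 + K1 / (1 + r) * (K2 / (1 + r)).
    by field; rewrite gt_eqF.
  apply: ler_wpDl.
    apply: mulr_ge0; first by apply: mulr_ge0 => //; exact: sqr_ge0.
    by rewrite invr_ge0; exact: sqr_ge0.
  have hc : cmod (ray r th) >= co * (1 + r).
    by apply: ray_cmod_ge => //; [rewrite ltW|exact: lt_trans om'pi].
  apply: ler_pM; rewrite ?invr_ge0 ?cmod_ge0//.
    rewrite /f (le_trans (cmodB _ _))// /K1 mulrDl lerD//.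
      by apply: hb => //; rewrite ltW//= (le_lt_trans to).
    have cs : cmod s = 1 + a by rewrite /s cmod_real gtr0_norm.
    rewrite !cmodM cmodV cmod_real cs -!mulrA.
    apply: ler_wpM2l => //; apply: ler_wpM2l; first exact: ltW.
    by rewrite -invfM lef_pV2 ?posrE ?mulr_gt0// cmod_gt0.
  rewrite -[_^-1]mul1r ler_pdivrMr// mulrAC ler_pdivlMr// mul1r /K2 mulrDl mul1r.
  have far' : del <= cmod (s - ray r th) by rewrite -cmodN opprB.
  have h1 : 1 + a <= (1 + a) / del * cmod (s - ray r th).
    by rewrite mulrAC ler_pdivlMr// ler_pM2l.
  have := ler_norm (r - a); move: h1 pa.
  move: (_ * _) (cmod _) `|_| => x y z; lra.
Qed.

Let mD : measurable (Rp `\ a). Proof. by apply: measurableD => //; exact: measurable_set1. Qed.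

(** At r = a the integrand has no reason to converge as the ray approaches the real
axis; this point is removed. *)
Let E_setD th : 0 < th <= om ->
  measurable_fun (Rp `\ a) (E th) /\ \int[mu]_(r in Rp `\ a) E th r = \int[mu]_(r in Rp) E th r.
Proof.
move=> tho; have [iE _] := E_integral tho.
have mE : measurable_fun (Rp `\ a) (E th).
  by apply: measurable_funS (integrable_measurable iE) => //; exact: subDsetl.
split => //; rewrite /Rintegral; congr fine; apply: integral_setD1_EFin => //.
exact/measurable_EFinP.
Qed.

Let eta (n : nat) : R := om / n.+1%:R.

Let eta_itv n : 0 < eta n <= om.
Proof.
rewrite /eta divr_gt0//= ler_pdivrMr// ler_peMr ?(ltW om0)// ler1n//.
Qed.

Let eta_cvg : eta n @[n --> \oo] --> 0.
Proof.
rewrite -(mulr0 om); apply: cvgM; first exact: cvg_cst.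
exact: cvg_harmonic.
Qed.

Let f_real r : 0 <= r -> complex.Im (f (1 + r)%:C) = 0.
Proof.
move=> r0; have -> : f (1 + r)%:C = h (1 + r)%:C - (c * (1 + a) / (1 + r))%:C.
  by rewrite /f /s !rmorphM fmorphV.
by rewrite cImD cImN hreal//= subr0.
Qed.

Let E_cvg r : (Rp `\ a) r -> E (eta n) r @[n --> \oo] --> 0.
Proof.
move=> [/Rpos_itv r0 /eqP ra];
have sr : s - ray r 0 != 0.
  by rewrite ray0 /s -rmorphB -cmod_gt0 cmod_real normr_gt0 opprD addrACA subrr add0r subr_eq0 eq_sym.
have fc : ccont f (ray r 0) by apply: C1at_continuous; apply: f_C1; rewrite ?lexx.
have ge : ccont (fun w => f w / (s - w)) (ray r 0).
  apply: ccontM => //; apply: (ccontV (f := fun w => s - w)) => //.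
  apply: (ccontD (f := fun=> s) (g := fun w => - w)); first exact: ccont_cst.
  by apply: ccontN; exact: ccont_id.
have c1 : cos (eta n) @[n --> \oo] --> (1 : R).
  by rewrite -(@cos0 R); apply: cvg_comp eta_cvg (@continuous_cos R 0).
have s1 : sin (eta n) @[n --> \oo] --> (0 : R).
  rewrite -[X in _ --> X](@sin0 R); apply: cvg_comp eta_cvg (@continuous_sin R 0).
have cr : complex.Re (ray r (eta n)) @[n --> \oo] --> complex.Re (ray r 0).
  by rewrite /ray /= cos0; apply: cvgD; [exact: cvg_cst|apply: cvgM => //; exact: cvg_cst].
have ci : complex.Im (ray r (eta n)) @[n --> \oo] --> complex.Im (ray r 0).
  by rewrite /ray /= sin0; apply: cvgM => //; exact: cvg_cst.
pose z n := f (ray r (eta n)) / (s - ray r (eta n)).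
pose z0 := f (ray r 0) / (s - ray r 0).
have zc (e : R) : 0 < e -> \forall n \near \oo, cmod (z n - z0) < e.
  exact: (ccont_filter ge cr ci).
have zr : complex.Re (z n) @[n --> \oo] --> complex.Re z0.
  apply/cvgrPdist_lt => e /zc; apply: filterS => n; apply: le_lt_trans.
  by rewrite distrC -cReN -cReD Re_le_cmod.
have zi : complex.Im (z n) @[n --> \oo] --> complex.Im z0.
  apply/cvgrPdist_lt => e /zc; apply: filterS => n; apply: le_lt_trans.
  by rewrite distrC -cImN -cImD Im_le_cmod.
have z00 : complex.Im z0 = 0.
  rewrite /z0 ray0 /s -rmorphB cIm_div f_real// mul0r.
  by rewrite [complex.Im (_%:C)]/= mulr0 subr0 mul0r.
have -> : (fun n => E (eta n) r) = fun n => complex.Re (z n) * sin (eta n) + complex.Im (z n) * cos (eta n).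
  by apply/funext => n; rewrite /E mulrAC -/(z n) cImM.
rewrite -[X in _ --> X](_ : complex.Re z0 * 0 + complex.Im z0 * 1 = 0); last first.
  by rewrite z00 mulr0 mul0r addr0.
by apply: cvgD; apply: cvgM.
Qed.

(** The ray is rotated to the real axis along a sequence of angles: the Poisson kernels
have constant mass pi, and the remainder tends to 0 by dominated convergence, since
it is real on the axis. *)
Lemma ray_cauchy_formula : \int[mu]_(r in Rp) N om r = pi * complex.Re (h s).
Proof.
have [K K0 EK] := E_bound.
have h1 : \int[mu]_(r in Rp `\ a) E (eta n) r @[n --> \oo] --> \int[mu]_(r in Rp `\ a) (cst 0) r.
  apply: (Rdominated_convergence (g := fun r => K * (1 + r) ^- 2)) => //.
  - by move=> n; have [] := E_setD (eta_itv n).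
  - apply: RintegrableZ => //.
    by apply: (integrableS _ _ _ (inv_sqr_integral R).1) => //; exact: subDsetl.
  - by move=> n r [/Rpos_itv r0 _]; apply: EK => //; exact: eta_itv.
have h2 : \int[mu]_(r in Rp `\ a) E (eta n) r @[n --> \oo] --> \int[mu]_(r in Rp) N om r - c * pi.
  apply: cvg_near_cst; apply: nearW => n.
  by rewrite (E_setD (eta_itv n)).2 (E_integral (eta_itv n)).2.
have h3 : \int[mu]_(r in Rp `\ a) (cst 0) r = \int[mu]_(r in Rp) N om r - c * pi.
  exact: (cvg_unique _ h1 h2).
move: h3; rewrite Rintegral_cst// mul0r => /esym/eqP.
by rewrite subr_eq0 mulrC => /eqP.
Qed.

End cauchy_formula.

(** * Laplace transform of the contour integral *)
Lemma integrable_of_indicM (R : realType) (D : set R) (g : R -> R) : measurable D ->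
  (@lebesgue_measure R).-integrable setT (EFin \o (fun x => \1_D x * g x)) ->
  (@lebesgue_measure R).-integrable D (EFin \o g).
Proof.
move=> mD i; have i' : (@lebesgue_measure R).-integrable D (EFin \o (fun x => \1_D x * g x)).
  by apply: (integrableS _ _ _ i).
by apply: eq_integrable i' => // x Dx /=; rewrite indicE Dx mul1r.
Qed.

Section laplace_inversion.
Variables (R : realType) (h : R[i] -> R[i]) (om' Ch : R).
Notation mu := (@lebesgue_measure R).
Notation Rp := (`[0%R, +oo[%classic : set R).
Hypotheses (om'pi : om' < pi) (Ch0 : 0 <= Ch).
Hypothesis hC1 : forall r th : R, 0 <= r -> 0 <= th < om' -> C1at h (ray r th).
Hypothesis hb : forall r th : R, 0 <= r -> 0 <= th < om' -> cmod (h (ray r th)) <= Ch / (1 + r).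
Hypothesis hreal : forall r : R, 0 <= r -> complex.Im (h (1 + r)%:C) = 0.
Variables (om T : R).
Hypotheses (om_pi2 : pi / 2 < om) (omom' : om < om') (T0 : 0 < T).

Definition ray_exponential (t r : R) : R :=
  complex.Im (cexp (t%:C * ray r om) * (edir om * h (ray r om))).
Let psi := ray_exponential.

Definition ray_inversion (t : R) : R := \int[mu]_(r in Rp) psi t r.

Let om0 : 0 < om.
Proof. by move: (pi_gt0 R) om_pi2 => *; lra. Qed.

Let omo : 0 <= om < om'. Proof. by rewrite ltW. Qed.

Let w r := edir om * h (ray r om).
Let k := Num.min (- cos om) 1.

Let k0 : 0 < k.
Proof.
rewrite lt_min ltr01 andbT oppr_gt0.
by apply: cos_obtuse_lt0; rewrite om_pi2 (lt_trans omom').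
Qed.

Let w_bound r : 0 <= r -> cmod (w r) <= Ch / (1 + r).
Proof. by move=> r0; rewrite /w cmodM cmod_edir mul1r hb. Qed.

Let mRp : measurable Rp. Proof. exact: measurable_itv. Qed.
Let D : set R := `]0, T]%classic.
Let D_itv t : D t -> 0 < t <= T. Proof. by rewrite /D /= in_itv. Qed.
Let mD : measurable D. Proof. exact: measurable_itv. Qed.

Let w_measurable : measurable_fun setT (fun r => \1_Rp r * complex.Re (w r)) /\
  measurable_fun setT (fun r => \1_Rp r * complex.Im (w r)).
Proof.
have cw r : 0 <= r -> ccont (fun z => edir om * h z) (ray r om).
  by move=> r0; apply: ccontM; [exact: ccont_cst|apply: C1at_continuous; exact: hC1].
split; rewrite indic_patch; apply/(measurable_restrictT _ _).1 => //;
  apply: subspace_continuous_measurable_fun => //;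
  apply: continuous_in_subspaceT => r; rewrite inE => /Rpos_itv r0;
  by have [] := ray_continuous_r (cw r r0).
Qed.

Section fixed_s.
Variable s : R.
Hypothesis s2 : 2 <= s.

Let f (x : R * R) := \1_D x.1 * (\1_Rp x.2 * (expR (- (s * x.1)) * psi x.1 x.2)).

Let psiE t r : psi t r = expR (t * (1 + r * cos om)) *
  (cos (t * (r * sin om)) * complex.Im (w r) + sin (t * (r * sin om)) * complex.Re (w r)).
Proof.
rewrite /psi /ray_exponential -/(w r) cImM /cexp /ray /=.
by rewrite !(mul0r, subr0, addr0); ring.
Qed.

Let mf : measurable_fun setT f.
Proof.
have [mR mI] := w_measurable.
have m1 : measurable_fun setT (fun x : R * R => x.1) by exact: measurable_fst.
have m2 : measurable_fun setT (fun x : R * R => x.2) by exact: measurable_snd.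
have mcont (g : R -> R) (u : R * R -> R) : continuous g -> measurable_fun setT u ->
    measurable_fun setT (fun x => g (u x)).
  by move=> cg mu'; apply: measurableT_comp => //; exact: continuous_measurable_fun.
have -> : f = (fun x => \1_D x.1 * (expR (- (s * x.1)) * (expR (x.1 * (1 + x.2 * cos om)) *
  (cos (x.1 * (x.2 * sin om)) * (\1_Rp x.2 * complex.Im (w x.2)) +
   sin (x.1 * (x.2 * sin om)) * (\1_Rp x.2 * complex.Re (w x.2)))))).
  by apply/funext => x; rewrite /f psiE; ring.
apply: measurable_funM.
  by apply: (@measurableT_comp _ _ _ _ _ _ (\1_D : R -> R)) => //; exact: measurable_indic.
have mt : measurable_fun setT (fun x : R * R => x.1 * (x.2 * sin om)).
  by apply: measurable_funM => //; apply: measurable_funM.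
apply: measurable_funM.
  apply: mcont; first exact: continuous_expR.
  by apply: measurableT_comp => //; exact: measurable_funM.
apply: measurable_funM.
  apply: mcont; first exact: continuous_expR.
  apply: measurable_funM => //; apply: measurable_funD => //; exact: measurable_funM.
apply: measurable_funD; apply: measurable_funM.
- by apply: mcont => //; exact: continuous_cos.
- exact: (measurableT_comp mI).
- by apply: mcont => //; exact: continuous_sin.
- exact: (measurableT_comp mR).
Qed.

(** For t > 0 this decays exponentially in r, but not uniformly as t tends to 0: the
integral over r is only O(log (1/t)), hence the half-open interval ]0, T] below. *)
Let kernel_bound t r : 0 <= t -> 0 <= r ->
  `|expR (- (s * t)) * psi t r| <= expR (- (k * (1 + r) * t)) * (Ch / (1 + r)).
Proof.
move=> t0 r0; rewrite normrM ger0_norm ?expR_ge0//.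
have h1 : `|psi t r| <= expR (t * (1 + r * cos om)) * (Ch / (1 + r)).
  rewrite /psi /ray_exponential (le_trans (Im_le_cmod _))// cmodM cmod_cexp cRe_realM /=.
  by rewrite ler_wpM2l ?expR_ge0// w_bound.
rewrite (le_trans (ler_wpM2l (expR_ge0 _) h1))//.
rewrite [expR _ * (expR _ * _)]mulrA -expRD.
rewrite ler_wpM2r ?divr_ge0 ?addr_ge0// ler_expR.
have -> : - (s * t) + t * (1 + r * cos om) = - (t * ((s - 1) + r * - cos om)) by ring.
rewrite lerN2 mulrC ler_wpM2l// mulrDr mulr1 lerD//.
  by rewrite ge_min; apply/orP; right; move: s2; lra.
by rewrite mulrC ler_wpM2l// ge_min lexx.
Qed.

Let indic_le (A : set R) x (u v : R) : (A x -> u <= v) -> \1_A x * u <= \1_A x * v.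
Proof.
by rewrite indicE; case: (boolP (x \in A)) => [/set_mem Ax /(_ Ax)|_ _]; rewrite ?mul1r ?mul0r.
Qed.

Let norm_indicM (A : set R) x (u : R) : `|\1_A x * u| = \1_A x * `|u|.
Proof. by rewrite normrM indicE ger0_norm. Qed.

Let f_bound t r : `|f (t, r)| <= \1_D t * (\1_Rp r * (expR (- (k * (1 + r) * t)) * (Ch / (1 + r)))).
Proof.
rewrite /f norm_indicM; apply: indic_le => /D_itv/andP[t0 _].
rewrite norm_indicM; apply: indic_le => /Rpos_itv r0; apply: kernel_bound => //; exact: ltW.
Qed.

Let fx t : mu.-integrable setT (EFin \o (fun r => f (t, r))).
Proof.
have [Dt|nDt] := pselect (D t); last first.
  have -> : (fun r => f (t, r)) = (fun=> 0).
    by apply/funext => r; rewrite /f /= indicE memNset// mul0r.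
  exact: (integrable0 _ setT).
have /D_itv/andP[t0 _] := Dt.
apply: (dominated_integrable (g := fun r => \1_Rp r * (Ch * expR (- (k * t * r))))) => //.
- by apply: (measurableT_comp mf); exact: measurable_pair1.
- apply: integrable_indicM => //; apply: RintegrableZ => //; apply: integrable_expRN.
  by rewrite mulr_gt0.
- move=> r _; rewrite (le_trans (f_bound t r))// [\1_D t]indicE mem_set// mul1r.
  apply: indic_le => /Rpos_itv r0; rewrite mulrC ler_pM ?expR_ge0// ?divr_ge0 ?addr_ge0//.
    by rewrite ler_pdivrMr ?ltr_pwDl// ler_peMr// lerDl.
  rewrite ler_expR lerN2.
  have -> : k * (1 + r) * t = k * t * r + k * t by ring.
  by rewrite lerDl mulr_ge0// ltW.
Qed.

Let iDc (c : R) : mu.-integrable setT (EFin \o (fun t => \1_D t * c)).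
Proof.
apply: integrable_indicM => //.
by apply: (integrableS _ _ _ (integrable_itv_cst 0 T c)) => //; exact: subset_itv_oc_cc.
Qed.

Let fy r : mu.-integrable setT (EFin \o (fun t => f (t, r))).
Proof.
apply: (dominated_integrable _ _ (iDc Ch)) => //.
  by apply: (measurableT_comp mf); exact: measurable_pair2.
move=> t _; rewrite (le_trans (f_bound t r))//.
apply: indic_le => /D_itv/andP[t0 _].
rewrite indicE; case: (boolP (r \in Rp)) => [/set_mem/Rpos_itv r0|_]; rewrite ?mul0r// mul1r.
rewrite (@le_trans _ _ (Ch / (1 + r)))//.
  by rewrite ler_piMl ?divr_ge0 ?addr_ge0// expRN_le1// ?mulr_ge0 ?addr_ge0 ?(ltW k0) ?(ltW t0).
by rewrite ler_pdivrMr ?ltr_pwDl// ler_peMr// lerDl.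
Qed.

Let fG r : \int[mu]_t `|f (t, r)| <= \1_Rp r * (Ch / k * (1 + r) ^- 2).
Proof.
have [Rr|nRr] := pselect (Rp r); last first.
  rewrite [X in X <= _](_ : _ = 0).
    by rewrite mulr_ge0 ?indicE// mulr_ge0 ?divr_ge0 ?(ltW k0)// invr_ge0 sqr_ge0.
  under eq_Rintegral do rewrite /f /= [\1_Rp r]indicE memNset// mul0r mulr0 normr0.
  by rewrite Rintegral_cst// mul0r.
have r0 : 0 <= r by apply/Rpos_itv.
have kr : 0 < k * (1 + r) by rewrite mulr_gt0// ltr_pwDl.
rewrite indicE mem_set// mul1r.
have -> : Ch / k * (1 + r) ^- 2 =
    \int[mu]_t (\1_Rp t * (Ch / (1 + r) * expR (- (k * (1 + r) * t)))).
  rewrite -Rintegral_indicM RintegralZl//; last exact: integrable_expRN.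
  rewrite Rintegral_expRN//; field; rewrite !gt_eqF// ltr_pwDl//.
apply: le_Rintegral => //.
- exact: integrable_norm.
- by apply: integrable_indicM => //; apply: RintegrableZ => //; exact: integrable_expRN.
- move=> t _; rewrite (le_trans (f_bound t r))//.
  rewrite [in \1_Rp r]indicE mem_set// mul1r [_ * (Ch / _)]mulrC.
  rewrite !indicE; case: (boolP (t \in D)) => [|_]; last first.
    rewrite mul0r mulr_ge0// mulr_ge0 ?expR_ge0// divr_ge0// addr_ge0//.
  move=> /set_mem/D_itv/andP[t0 _]; rewrite mem_set//= in_itv /= andbT ltW//.
Qed.

Let G_integrable : mu.-integrable setT (EFin \o (fun r => \1_Rp r * (Ch / k * (1 + r) ^- 2))).
Proof. by apply: integrable_indicM => //; apply: RintegrableZ => //; exact: (inv_sqr_integral R).1. Qed.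

Let a := s - 1.
Let a0 : 0 < a. Proof. by move: s2; rewrite /a; lra. Qed.
Let sE : s%:C = (1 + a)%:C. Proof. by rewrite /a; congr _%:C; ring. Qed.

Let tail r := complex.Im (w r * cexp ((ray r om - s%:C) * T%:C) / (s%:C - ray r om)).

Let pole_ge r : 0 <= r -> sin (om / 2) * (1 + r) <= cmod (s%:C - ray r om).
Proof.
move=> r0.
have h1 : sin (om / 2) * (a + r) <= cmod (s%:C - ray r om).
  by rewrite sE; apply: pole_cmod_ge; rewrite ?(ltW a0) ?(ltW om0)//= ltW// (lt_trans omom').
apply: le_trans h1; rewrite ler_wpM2l//; last by rewrite lerD2r /a; move: s2; lra.
by apply: sin_ge0_pi; move: om0 omom' om'pi => *; apply/andP; split; lra.
Qed.

Let so0 : 0 < sin (om / 2).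
Proof. by apply: sin_gt0_pi; move: om0 omom' om'pi => *; apply/andP; split; lra. Qed.

Let pole_neq0 r : 0 <= r -> s%:C - ray r om != 0.
Proof.
move=> r0; rewrite -cmod_gt0; apply: lt_le_trans (pole_ge r0).
by rewrite mulr_gt0// ltr_pwDl.
Qed.

Let tail_bound r : 0 <= r ->
  `|tail r| <= Ch / sin (om / 2) * expR ((1 - s) * T) * (1 + r) ^- 2.
Proof.
move=> r0; have r1 : 0 < 1 + r by rewrite ltr_pwDl.
rewrite /tail (le_trans (Im_le_cmod _))// cmodM cmodV [cmod (w r * _)]cmodM cmod_cexp.
have -> : Ch / sin (om / 2) * expR ((1 - s) * T) * (1 + r) ^- 2 =
    Ch / (1 + r) * expR ((1 - s) * T) * (sin (om / 2) * (1 + r))^-1.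
  by field; rewrite !gt_eqF.
rewrite ler_pM ?mulr_ge0 ?invr_ge0 ?cmod_ge0 ?expR_ge0//.
  rewrite ler_pM ?cmod_ge0 ?expR_ge0//; first exact: w_bound.
  rewrite ler_expR mulrC cRe_realM mulrC ler_pM2r// cReD cReN /= lerD2r gerDl.
  rewrite mulr_ge0_le0//; move: k0; rewrite lt_min oppr_gt0 => /andP[/ltW].
  by [].
by rewrite lef_pV2 ?posrE ?pole_ge// ?mulr_gt0// cmod_gt0 pole_neq0.
Qed.

(** The transform of e^(t ray) over ]0, T] is (1 - e^((ray - s) T)) / (s - ray). *)
Let J_eq r : 0 <= r -> \int[mu]_(t in D) (expR (- (s * t)) * psi t r) =
  ray_integrand h a om r - tail r.
Proof.
move=> r0; have p0 := pole_neq0 r0.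
pose ii : R[i] := 0 +i* (- 1).
have iiE z : complex.Re (ii * z) = complex.Im z.
  by case: z => x y; rewrite /ii /=; ring.
pose W := ray r om - s%:C.
have W0 : W != 0 by rewrite /W -oppr_eq0 opprB.
pose F (t : R) := complex.Re (ii * (w r / W) * cexp (W * t%:C)).
pose g (t : R) := complex.Re (ii * (w r / W) * W * cexp (W * t%:C)).
have dF (t : R) : is_derive t 1 F (g t) by exact: is_derive_Re_cexp.
have cg : {within `[0, T], continuous g}.
  apply: continuous_subspaceT => t.
  exact: is_derive_continuous (@is_derive_Re_cexp R (ii * (w r / W) * W) W t).
have gE t : expR (- (s * t)) * psi t r = g t.
  have -> : g t = complex.Re (ii * (w r * cexp (W * t%:C))).
    rewrite /g; congr complex.Re; move: (cexp _) => z; by field.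
  rewrite iiE /psi /ray_exponential -/(w r) -cIm_realM; congr complex.Im.
  have -> : W * t%:C = (- (s * t))%:C + t%:C * ray r om.
    by rewrite /W rmorphN rmorphM /=; ring.
  rewrite cexpD cexp_real; move: (expR _)%:C (cexp _) => x y; ring.
under eq_Rintegral do rewrite gE.
rewrite Rintegral_itv_obnd_cbnd; last first.
  apply: (integrableS _ _ _ (continuous_compact_integrable (@segment_compact R 0 T) cg)); try exact: measurable_itv.
  exact: subset_itv_oc_cc.
rewrite (Rintegral_FTC T0 (fun r _ => dF r) cg) /F -!mulrA !iiE.
rewrite /ray_integrand /tail -sE -cImN -cImD -cImN -cImD; congr complex.Im.
rewrite mulr0 cexp0 mulr1 /W -/W.
have -> : s%:C - ray r om = - W by rewrite /W opprB.
rewrite /w; field => //.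
Qed.

Let fxE t : \int[mu]_r f (t, r) = \1_D t * (expR (- (s * t)) * ray_inversion t).
Proof.
rewrite indicE; case: (boolP (t \in D)) => Dt; last first.
  rewrite mul0r; under eq_Rintegral do rewrite /f /= indicE (negbTE Dt) mul0r.
  by rewrite Rintegral_cst// mul0r.
rewrite mul1r /ray_inversion -RintegralZl//.
  by rewrite [RHS]Rintegral_indicM; apply: eq_Rintegral => r _; rewrite /f /= indicE Dt mul1r.
have i1 : mu.-integrable Rp (EFin \o (fun r => f (t, r))) by apply: (integrableS _ _ _ (fx t)).
apply: eq_integrable (RintegrableZ (expR (s * t)) mRp i1) => // r Rr /=.
rewrite /f /= !indicE Dt Rr !mul1r mulrA -expRD.
by rewrite (_ : s * t + - (s * t) = 0) ?expR0 ?mul1r// subrr.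
Qed.

Let fyE r : \int[mu]_t f (t, r) = \1_Rp r * (ray_integrand h a om r - tail r).
Proof.
rewrite indicE; case: (boolP (r \in Rp)) => Rr; last first.
  rewrite mul0r; under eq_Rintegral do rewrite /f /= [\1_Rp r]indicE (negbTE Rr) mul0r mulr0.
  by rewrite Rintegral_cst// mul0r.
rewrite mul1r -J_eq; last by apply/Rpos_itv; move: Rr; rewrite inE.
rewrite [RHS]Rintegral_indicM; apply: eq_Rintegral => t _.
by rewrite /f /= [\1_Rp r]indicE Rr mul1r.
Qed.

Let Fubini : [/\ mu.-integrable setT (EFin \o (fun t => \1_D t * (expR (- (s * t)) * ray_inversion t))),
  mu.-integrable setT (EFin \o (fun r => \1_Rp r * (ray_integrand h a om r - tail r))) &
  \int[mu]_t (\1_D t * (expR (- (s * t)) * ray_inversion t)) =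
  \int[mu]_r (\1_Rp r * (ray_integrand h a om r - tail r))].
Proof. by have := Rfubini mf fx fy G_integrable fG; rewrite (funext fxE) (funext fyE). Qed.

Lemma ray_inversion_integrable_aux :
  mu.-integrable D (EFin \o (fun t => expR (- (s * t)) * ray_inversion t)).
Proof. by have [i1 _ _] := Fubini; exact: integrable_of_indicM mD i1. Qed.

Let J_integrable : mu.-integrable Rp (EFin \o (fun r => ray_integrand h a om r - tail r)).
Proof. by have [_ i2 _] := Fubini; exact: integrable_of_indicM mRp i2. Qed.

(** After exchanging the integrals, the untruncated part is Cauchy's integral for
h at s, and the truncation costs e^((ray - s) T), which is at most e^((1 - s) T)
since the ray goes to the left of its vertex. *)
Lemma ray_inversion_laplace :
  `|\int[mu]_(t in D) (expR (- (s * t)) * ray_inversion t) - pi * complex.Re (h s%:C)| <=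
  Ch / sin (om / 2) * expR ((1 - s) * T).
Proof.
have -> : \int[mu]_(t in D) (expR (- (s * t)) * ray_inversion t) =
    \int[mu]_(r in Rp) (ray_integrand h a om r - tail r).
  by rewrite [LHS]Rintegral_indicM [RHS]Rintegral_indicM; have [_ _ e] := Fubini.
rewrite sE -(ray_cauchy_formula om'pi Ch0 hC1 hb hreal a0 om0 omom').
have iN : mu.-integrable Rp (EFin \o ray_integrand h a om).
  by apply: (ray_integrand_integrable om'pi hC1 hb a0); rewrite om0.
have iJ := J_integrable.
have mt : measurable_fun Rp tail.
  have -> : tail = (fun r => ray_integrand h a om r - (ray_integrand h a om r - tail r)).
    by apply/funext => r; ring.
  by apply: measurable_funB; [exact: integrable_measurable iN|exact: integrable_measurable iJ].
rewrite -RintegralB// (_ : \int[mu]_(r in Rp) _ = \int[mu]_(r in Rp) - tail r); last first.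
  by apply: eq_Rintegral => r _; ring.
have -> : Ch / sin (om / 2) * expR ((1 - s) * T) =
    \int[mu]_(r in Rp) (Ch / sin (om / 2) * expR ((1 - s) * T) * (1 + r) ^- 2).
  by rewrite RintegralZl ?(inv_sqr_integral R).2 ?mulr1//; exact: (inv_sqr_integral R).1.
apply: Rintegral_bound => //.
- by apply: measurableT_comp.
- by apply: RintegrableZ => //; exact: (inv_sqr_integral R).1.
- by move=> r /Rpos_itv r0; rewrite normrN tail_bound.
Qed.

End fixed_s.

Lemma ray_inversion_integrable : mu.-integrable D (EFin \o ray_inversion).
Proof.
have i := ray_inversion_integrable_aux (lexx 2).
apply: (dominated_integrable (g := fun t => expR (2 * T) * `|expR (- (2 * t)) * ray_inversion t|)) => //.
- have -> : ray_inversion = fun t => expR (2 * t) * (expR (- (2 * t)) * ray_inversion t).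
    by apply/funext => t; rewrite mulrA -expRD subrr expR0 mul1r.
  apply: measurable_funM; last exact: integrable_measurable i.
  have -> : (fun t : R => expR (2 * t)) = (fun t => expR (- (- 2 * t))).
    by apply/funext => t; congr expR; ring.
  exact: measurable_expRN.
- by apply: RintegrableZ => //; exact: integrable_norm.
- move=> t /D_itv/andP[t0 tT].
  rewrite normrM mulrA ger0_norm ?expR_ge0// -expRD ler_peMl//.
  by rewrite -{1}expR0 ler_expR -mulrBr mulr_ge0// subr_ge0.
Qed.

End laplace_inversion.

(** * Scalar holomorphic functions from conjugate operators *)
Section conjugate_pairing.
Variables (R : realType) (X : normedModType R[i]).
Implicit Types (l : rfun X) (x y : X) (a : R[i]).

(** For x = a u and y = conj a * u with u independent of a and l real on u, this is
a l(u): the complex number that a real functional cannot see. It extends l to a map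
which is complex-linear when the second argument is transformed by the conjugate
scalar. *)
Definition pairing l x y : R[i] :=
  ((l x + l y) / 2) +i* ((l ('i *: y) - l ('i *: x)) / 2).

Lemma pairingB l x x' y y' :
  pairing l (x - x') (y - y') = pairing l x y - pairing l x' y'.
Proof.
by apply: complex_eq; rewrite ?cReD ?cImD ?cReN ?cImN /= ?scalerBr !rfB; ring.
Qed.

Lemma pairing_scale l a x y : pairing l (a *: x) (a^* *: y) = a * pairing l x y.
Proof.
have ii z : l ('i *: (a *: z)) = complex.Re a * l ('i *: z) - complex.Im a * l z.
  by rewrite scalerA mulrC -scalerA rf_scale scalerA -expr2 sqr_i scaleN1r rfN; ring.
have ii' z : l ('i *: (a^* *: z)) = complex.Re a * l ('i *: z) + complex.Im a * l z.
  rewrite scalerA mulrC -scalerA rf_scale cReJ cImJ scalerA -expr2 sqr_i scaleN1r rfN; ring.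
apply: complex_eq; rewrite ?cReM ?cImM /= ?ii ?ii' ?(rf_scale l a) ?(rf_scale l a^*) ?cReJ ?cImJ; by field.
Qed.

Lemma cmod_pairing l x y : cmod (pairing l x y) <= rf_norm l * (rnorm x + rnorm y).
Proof.
rewrite (le_trans (cmod_le_ReIm _))//=.
have ni (z : X) : rnorm ('i *: z) = rnorm z.
  by rewrite rnormZ (_ : cmod 'i = 1) ?mul1r// cmodE /= expr0n expr1n add0r sqrtr1.
have h1 : `|l x + l y| <= rf_norm l * (rnorm x + rnorm y).
  by rewrite (le_trans (ler_normD _ _))// mulrDr lerD// rf_bound.
have h2 : `|l ('i *: y) - l ('i *: x)| <= rf_norm l * (rnorm x + rnorm y).
  rewrite (le_trans (ler_normB _ _))// mulrDr addrC -[rnorm x]ni -[rnorm y]ni.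
  by rewrite lerD// rf_bound.
rewrite !normrM [`|2^-1|]ger0_norm//.
by move: h1 h2; move: `|_ + _| `|_ - _| => u v; lra.
Qed.

Lemma pairing_diag l x : pairing l x x = (l x)%:C.
Proof. by apply: complex_eq => /=; field. Qed.

(** The scalar 0 +i* (- 2^-1) is 1 / (2 i). *)
Lemma Im_pairing l x y : complex.Im (pairing l x y) = l ((0 +i* (- 2^-1)) *: (x - y)).
Proof. by rewrite [RHS]rf_scale /= scalerBr !rfB; field. Qed.

End conjugate_pairing.

Section paired_laplace.
Variables (R : realType) (X : completeNormedModType R[i]) (l : rfun X) (v : X).

(** The conjugate vector sits at the conjugate point, so that the result is holomorphic
in z. *)
Definition paired_laplace (B : R -> X -> X) (z : R[i]) : R[i] :=
  pairing l (laplace_op B 0 (-1) z v) (laplace_op B 0 (-1) z^* v).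

Lemma cderiv_paired_laplace B z : subexp_family B -> 0 < complex.Re z ->
  cderiv (paired_laplace B) z (paired_laplace (fun u w => affine 0 (-1) u *: B u w) z).
Proof.
move=> sB z0; apply: cderiv_eps => e e0.
have zn : complex.Re (z * -1) < 0 by rewrite mulrN1 cReN oppr_lt0.
have zn' : complex.Re (z^* * -1) < 0 by rewrite mulrN1 cReN cReJ oppr_lt0.
pose K := rf_norm l * (2 * rnorm v) + 1.
have K0 : 0 < K by rewrite ltr_wpDl// mulr_ge0 ?rf_norm_ge0// mulr_ge0 ?rnorm_ge0.
have eK : 0 < e / K by rewrite divr_gt0.
have [d1 d10 h1] := laplace_op_derive 0 sB zn eK.
have [d2 d20 h2] := laplace_op_derive 0 sB zn' eK.
exists (Num.min d1 d2); first by rewrite lt_min d10.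
move=> h h0; rewrite lt_min => /andP[hd1 hd2].
have h0' : h^* != 0 by rewrite -cmod_gt0 cmodJ cmod_gt0.
have hd2' : cmod h^* < d2 by rewrite cmodJ.
have E1 := h1 h h0 hd1 v; have E2 := h2 h^* h0' hd2' v.
rewrite /paired_laplace rmorphD /= -pairing_scale -!pairingB.
rewrite (le_trans (cmod_pairing _ _ _))//.
have s1 (k : R[i]) (x y w : X) : k != 0 -> rnorm (k^-1 *: (x - y) - w) <= e / K * rnorm v ->
    rnorm (x - y - k *: w) <= cmod k * (e / K * rnorm v).
  move=> k0; have -> : x - y - k *: w = k *: (k^-1 *: (x - y) - w).
    by rewrite scalerBr scalerA divff// scale1r.
  by rewrite rnormZ; apply: ler_wpM2l; rewrite cmod_ge0.
have := lerD (s1 _ _ _ _ h0 E1) (s1 _ _ _ _ h0' E2); rewrite cmodJ => b.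
rewrite (le_trans (ler_wpM2l (rf_norm_ge0 l) b))//.
have -> : rf_norm l * (cmod h * (e / K * rnorm v) + cmod h * (e / K * rnorm v)) =
  e * cmod h * (rf_norm l * (2 * rnorm v) / K) by field; rewrite gt_eqF.
by rewrite ler_piMr ?mulr_ge0 ?cmod_ge0 ?(ltW e0)// ler_pdivrMr// mul1r lerDl.
Qed.

Lemma near_Re_gt0 (z : R[i]) : 0 < complex.Re z -> \forall w \near cnbhs z, 0 < complex.Re w.
Proof.
move=> z0; apply: filterS (near_cmod z z0) => w hw.
have := le_lt_trans (Re_le_cmod _) hw; rewrite cReD cReN ltr_norml => /andP[]; lra.
Qed.

Lemma C1at_paired_laplace B z : subexp_family B -> 0 < complex.Re z ->
  C1at (paired_laplace B) z.
Proof.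
move=> sB z0; have sB' := subexp_affine 0 (-1) sB.
exists (paired_laplace (fun u w => affine 0 (-1) u *: B u w)); split.
  by apply: filterS (near_Re_gt0 z0) => w; exact: cderiv_paired_laplace.
exact: cderiv_continuous (cderiv_paired_laplace sB' z0).
Qed.

End paired_laplace.

(** * The contour operator *)
Section operator_derivatives.
Variables (R : realType) (X : completeNormedModType R[i]).

(** Derivatives in operator norm give continuity at each vector. *)
Lemma op_derive_continuous (F : R[i] -> {linear X -> X}) z G v : is_op_derive F z G ->
  forall eps : R, 0 < eps -> exists2 d : R, 0 < d &
    forall w, cmod (w - z) < d -> rnorm (F w v - F z v) < eps.
Proof.
move=> dF eps eps0; have [d d0 hd] := dF 1 ltr01.
pose K := rnorm (G v) + rnorm v + 1.
have K0 : 0 < K by rewrite ltr_wpDl// addr_ge0 ?rnorm_ge0.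
exists (Num.min d (eps / K)); first by rewrite lt_min d0 divr_gt0.
move=> w; rewrite lt_min => /andP[w1 w2].
have [->|wz] := eqVneq w z; first by rewrite subrr rnorm0.
have h0 : w - z != 0 by rewrite subr_eq0.
have := hd _ h0 w1 v; rewrite mul1r [z + _]addrC subrK => b.
have -> : F w v - F z v = (w - z) *: ((w - z)^-1 *: (F w v - F z v)).
  by rewrite scalerA divff// scale1r.
rewrite rnormZ (le_lt_trans (y := cmod (w - z) * K))//.
  rewrite ler_wpM2l ?cmod_ge0// -[_ *: _](subrK (G v)) (le_trans (rnormD _ _))//.
  by rewrite addrC /K -addrA lerD2l (le_trans b)// lerDl.
by rewrite -ltr_pdivlMr.
Qed.

Lemma subrBB (V : zmodType) (a b c d : V) : a - b - (c - d) = a - c - (b - d).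
Proof. by rewrite !opprB addrACA [RHS]addrACA [- b + _]addrC. Qed.

Lemma op_derive_scaleB (F F1 F2 : R[i] -> {linear X -> X}) z (G G1 G2 : {linear X -> X}) (c : R[i]) :
  (forall w v, F w v = c *: (F1 w v - F2 w v)) ->
  (forall v, G v = c *: (G1 v - G2 v)) ->
  is_op_derive F1 z G1 -> is_op_derive F2 z G2 -> is_op_derive F z G.
Proof.
move=> FE GE d1 d2 eps eps0.
pose K := cmod c * 2 + 1; have K0 : 0 < K by rewrite ltr_wpDl// mulr_ge0 ?cmod_ge0.
have eK : 0 < eps / K by rewrite divr_gt0.
have [e1 e10 h1] := d1 _ eK; have [e2 e20 h2] := d2 _ eK.
exists (Num.min e1 e2); first by rewrite lt_min e10.
move=> h h0; rewrite lt_min => /andP[hl1 hl2] v.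
have := lerD (h1 h h0 hl1 v) (h2 h h0 hl2 v).
rewrite !FE GE.
set a1 := F1 _ _; set b1 := F1 _ _; set a2 := F2 _ _; set b2 := F2 _ _ => b.
have -> : h^-1 *: (c *: (a1 - a2) - c *: (b1 - b2)) - c *: (G1 v - G2 v) =
    c *: ((h^-1 *: (a1 - b1) - G1 v) - (h^-1 *: (a2 - b2) - G2 v)).
  rewrite -scalerBr scalerA [h^-1 * c]mulrC -scalerA -scalerBr; congr (_ *: _).
  by rewrite subrBB scalerBr subrBB.
rewrite rnormZ (le_trans (ler_wpM2l (cmod_ge0 c) (rnormB _ _)))//.
rewrite (le_trans (ler_wpM2l (cmod_ge0 c) b))//.
have -> : cmod c * (eps / K * rnorm v + eps / K * rnorm v) = eps * rnorm v * (cmod c * 2 / K).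
  by field; rewrite gt_eqF.
by rewrite ler_piMr ?mulr_ge0 ?rnorm_ge0 ?(ltW eps0)// ler_pdivrMr// mul1r lerDl.
Qed.

Lemma scaleB_linear (F1 F2 : {linear X -> X}) (c : R[i]) :
  exists F : {linear X -> X}, forall v, F v = c *: (F1 v - F2 v).
Proof.
apply: pack_linear => a x y; rewrite (linearP F1) (linearP F2) opprD addrACA -scalerBr scalerDr.
by rewrite !scalerA mulrC.
Qed.

End operator_derivatives.

Section transfer.
Variables (R : realType) (X : completeNormedModType R[i]).
Notation mu := (@lebesgue_measure R).
Notation Rp := (`[0%R, +oo[%classic : set R).
Variables (A : unbounded_operator X) (Cs : R -> {linear X -> X}) (M : R).
Hypotheses (hC : cosine_family A Cs) (M0 : 0 <= M).
Hypothesis CM : forall t v, 0 <= t -> rnorm (Cs t v) <= M * rnorm v.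
Variables (n : nat) (C e : 'I_n.+1 -> R) (alpha om' : R).
Hypotheses (C0 : forall i, 0 < C i) (e_bounds : forall i, 0 <= e i <= alpha).
Hypotheses (alpha1 : 1 < alpha) (om'0 : 0 < om') (aom' : alpha * om' < pi).
Notation lam := (gsqrt C e).
Notation L := (cosine_laplace Cs).

Let al0 : 0 <= alpha. Proof. by rewrite ltW// (lt_trans ltr01). Qed.

Let om'pi : om' < pi.
Proof. by apply: lt_trans aom'; rewrite ltr_pMl. Qed.

Let co := cos (alpha * om' / 2).
Let co0 : 0 < co.
Proof.
have h : 0 < alpha * om' by rewrite mulr_gt0// (lt_trans ltr01).
by apply: cos_gt0_pihalf; move: aom' h => *; apply/andP; split; lra.
Qed.
Let cr := cos (om' / 2).
Let cr0 : 0 < cr.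
Proof. by apply: cos_gt0_pihalf; move: om'0 om'pi => *; apply/andP; split; lra. Qed.

(** The admissible region: the logarithms of the symbol are defined and its square root
stays in a proper subsector of the right half-plane. *)
Lemma ray_sectorial (r th : R) : 0 <= r -> 0 <= th < om' ->
  [/\ slit (ray r th), slit (gsym C e (ray r th)),
      0 < complex.Re (lam (ray r th)) &
      co * cmod (lam (ray r th)) <= complex.Re (lam (ray r th))].
Proof.
move=> r0 /andP[t0 to].
have tp : 0 <= th < pi by rewrite t0 (lt_trans to).
have sl := ray_slit r0 tp; have /andP[a0 ath] := ray_arg r0 tp.
have aa : alpha * slit_arg (ray r th) < pi.
  by apply: le_lt_trans aom'; rewrite ler_wpM2l// (le_trans ath)// ltW.
have h : co * cmod (lam (ray r th)) <= complex.Re (lam (ray r th)).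
  by apply: gsqrt_Re_ge => //; rewrite a0 (le_trans ath)// ltW.
split => //; first exact: (gsym_slit C0 e_bounds a0 aa).
by apply: lt_le_trans h; rewrite mulr_gt0// cmod_gt0 gsqrt_neq0.
Qed.

Let lam_C1 r th : 0 <= r -> 0 <= th < om' -> C1at lam (ray r th).
Proof. by move=> r0 tho; have [s1 s2 _ _] := ray_sectorial r0 tho; exact: C1at_gsqrt. Qed.

(** The scalar counterpart of (lam/z) L lam, the Laplace transform of the solution
operator. *)
Definition transfer (l : rfun X) (v : X) (z : R[i]) : R[i] :=
  lam z / z * paired_laplace l v Cs (lam z).

Let sC : subexp_family Cs. Proof. exact: cosine_subexp hC CM M0. Qed.

Lemma transfer_C1 (l : rfun X) (v : X) (r th : R) : 0 <= r -> 0 <= th < om' -> C1at (transfer l v) (ray r th).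
Proof.
move=> r0 tho; have [s1 s2 s3 _] := ray_sectorial r0 tho.
apply: C1atM.
  by apply: C1atM; [exact: lam_C1|apply: C1atV; [exact: slit_neq0|exact: C1at_id]].
apply: (C1at_comp (f := paired_laplace l v Cs)); first exact: lam_C1.
exact: C1at_paired_laplace.
Qed.

Lemma transfer_bound (l : rfun X) (v : X) (r th : R) : 0 <= r -> 0 <= th < om' ->
  cmod (transfer l v (ray r th)) <=
  rf_norm l * (2 * (M * rnorm v)) / (co * cr) / (1 + r).
Proof.
move=> r0 tho; have [s1 s2 s3 s4] := ray_sectorial r0 tho.
have /andP[t0 to] := tho; have r1 : 0 < 1 + r by rewrite ltr_pwDl.
have m0 : 0 < cmod (ray r th) by rewrite cmod_gt0; exact: slit_neq0.
have la0 : 0 < cmod (lam (ray r th)) by rewrite cmod_gt0 gsqrt_neq0.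
have mge : cr * (1 + r) <= cmod (ray r th) by apply: ray_cmod_ge; rewrite // t0 ltW.
have L1 : rnorm (L (lam (ray r th)) v) <= M / complex.Re (lam (ray r th)) * rnorm v.
  exact: (cosine_laplace_bound hC CM M0).
have L2 : rnorm (L (lam (ray r th))^* v) <= M / complex.Re (lam (ray r th)) * rnorm v.
  by rewrite -(cReJ (lam _)); apply: (cosine_laplace_bound hC CM M0); rewrite cReJ.
rewrite /transfer cmodM (le_trans (ler_wpM2l (cmod_ge0 _) (cmod_pairing _ _ _)))//.
rewrite cmodM cmodV.
set la := cmod (lam (ray r th)) in la0 s4 *; set m := cmod (ray r th) in m0 mge *.
set re := complex.Re (lam (ray r th)) in s3 s4 L1 L2 *.
apply: (@le_trans _ _ (la / m * (rf_norm l * (2 * (M * rnorm v) / re)))).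
  apply: ler_wpM2l; first by rewrite divr_ge0 ?ltW.
  apply: ler_wpM2l; first exact: rf_norm_ge0.
  apply: (le_trans (lerD L1 L2)).
  by rewrite le_eqVlt; apply/orP; left; apply/eqP; field; rewrite gt_eqF.
have -> : la / m * (rf_norm l * (2 * (M * rnorm v) / re)) =
  rf_norm l * (2 * (M * rnorm v)) * (la / re) * m^-1 by field; rewrite !gt_eqF.
have -> : rf_norm l * (2 * (M * rnorm v)) / (co * cr) / (1 + r) =
  rf_norm l * (2 * (M * rnorm v)) * co^-1 * (cr * (1 + r))^-1 by field; rewrite !gt_eqF.
have nn : 0 <= rf_norm l * (2 * (M * rnorm v)).
  by rewrite !mulr_ge0 ?rf_norm_ge0 ?rnorm_ge0.
apply: ler_pM.
- by rewrite mulr_ge0// divr_ge0 ?ltW.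
- by rewrite invr_ge0 ltW.
- apply: ler_wpM2l => //; rewrite ler_pdivrMr// mulrC ler_pdivlMr// mulrC//.
- by rewrite lef_pV2 ?posrE// mulr_gt0.
Qed.

Lemma transfer_real l v (s : R) : 0 < s ->
  transfer l v s%:C = (gsqrt_real C e s / s * l (L (gsqrt_real C e s)%:C v))%:C.
Proof.
move=> s0; rewrite /transfer (gsqrt_realE e C0 s0) /paired_laplace.
have -> : ((gsqrt_real C e s)%:C)^* = (gsqrt_real C e s)%:C by apply: complex_eq; rewrite ?cReJ ?cImJ /= ?oppr0.
by rewrite pairing_diag -fmorphV -!rmorphM.
Qed.

Variable om : R.
Hypotheses (om_pi2 : pi / 2 < om) (omom' : om < om').

Let omo : 0 <= om < om'.
Proof. by apply/andP; split => //; move: (pi_gt0 R) om_pi2 => *; lra. Qed.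

Let ray_continuous (f : R[i] -> R[i]) : (forall r, 0 <= r -> ccont f (ray r om)) ->
  forall r, 0 <= r -> forall eps : R, 0 < eps -> exists2 d : R, 0 < d &
    forall u : R, `|u - r| < d -> cmod (f (ray u om) - f (ray r om)) < eps.
Proof.
move=> cf r r0 eps eps0; have [d d0 hd] := cf r r0 eps eps0.
exists d => // u ur; apply: hd; rewrite !rayE opprD addrACA subrr add0r -mulrBl -rmorphB.
by rewrite cmodM cmod_edir mulr1 cmod_real.
Qed.

Definition ray_weight (r : R) : R[i] := edir om * (lam (ray r om) / ray r om).

Let lam_cont r : 0 <= r -> ccont lam (ray r om).
Proof. by move=> r0; apply: C1at_continuous; exact: lam_C1. Qed.

Let weight_cont r : 0 <= r -> ccont (fun z => edir om * (lam z / z)) (ray r om).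
Proof.
move=> r0; have [s1 _ _ _] := ray_sectorial r0 omo.
apply: ccontM; first exact: ccont_cst.
apply: ccontM; first exact: lam_cont.
by apply: ccontV; [exact: slit_neq0|exact: ccont_id].
Qed.

(** On the rays |lam/mu| |L lam| is at most M |lam| / (|mu| Re lam), which is bounded.
The statement covers a ray and its conjugate at once. *)
Let subexp_ray (la q : R -> R[i]) :
  (forall r, 0 <= r -> forall eps : R, 0 < eps -> exists2 d : R, 0 < d &
    forall u : R, `|u - r| < d -> cmod (la u - la r) < eps) ->
  (forall r, 0 <= r -> forall eps : R, 0 < eps -> exists2 d : R, 0 < d &
    forall u : R, `|u - r| < d -> cmod (q u - q r) < eps) ->
  (forall r, 0 <= r -> complex.Re (la r) = complex.Re (lam (ray r om))) ->
  (forall r, 0 <= r -> cmod (q r) = cmod (ray_weight r)) ->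
  subexp_family (fun r v => q r *: L (la r) v).
Proof.
move=> cla cq laE qE.
have la0 r : 0 <= r -> 0 < complex.Re (la r).
  by move=> r0; rewrite laE//; have [] := ray_sectorial r0 omo.
split.
- by move=> u u0 a x y; rewrite linearP scalerDr scalerA mulrC -scalerA.
- move=> v; apply: rwithin_continuousZ.
    apply/rwithin_contP => r /Rpos_itv r0 eps eps0.
    by have [d d0 hd] := cq r r0 eps eps0; exists d => // u _; exact: hd.
  apply/rwithin_contP => r /Rpos_itv r0 eps eps0.
  have zn : complex.Re (la r * -1) < 0 by rewrite mulrN1 cReN oppr_lt0 la0.
  have [d d0 hd] := op_derive_continuous v (laplace_op_derive 0 sC zn) eps0.
  have [d' d'0 hd'] := cla r r0 d d0.
  by exists d' => // u _ ur; apply: hd; exact: hd'.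
- move=> k k0; exists (M / (co * cr)); first by rewrite divr_ge0// mulr_ge0 ?(ltW co0)// ltW.
  move=> r v r0; have [s1 s2 s3 s4] := ray_sectorial r0 omo.
  rewrite rnormZ qE// /ray_weight cmodM cmod_edir mul1r cmodM cmodV.
  have L1 : rnorm (L (la r) v) <= M / complex.Re (lam (ray r om)) * rnorm v.
    by rewrite -laE//; apply: (cosine_laplace_bound hC CM M0); exact: la0.
  have mge : cr * (1 + r) <= cmod (ray r om).
    by apply: ray_cmod_ge => //; have /andP[-> /ltW] := omo.
  have m0 : 0 < cmod (ray r om) by rewrite cmod_gt0; exact: slit_neq0.
  have la1 : 0 < cmod (lam (ray r om)) by rewrite cmod_gt0 gsqrt_neq0.
  set lr := cmod (lam (ray r om)) in la1 s4 *; set m := cmod (ray r om) in m0 mge *.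
  set re := complex.Re (lam (ray r om)) in s3 s4 L1 *.
  have q0 : 0 <= lr / m by rewrite divr_ge0 ?ltW.
  apply: (le_trans (ler_wpM2l q0 L1)).
  have -> : lr / m * (M / re * rnorm v) = M * rnorm v * (lr / re) * m^-1.
    by field; rewrite !gt_eqF.
  apply: (@le_trans _ _ (M * rnorm v * co^-1 * cr^-1)); last first.
    have -> : M / (co * cr) * expR (k * r) * rnorm v = M * rnorm v * co^-1 * cr^-1 * expR (k * r).
      by field; rewrite !gt_eqF.
    have nn : 0 <= M * rnorm v * co^-1 * cr^-1.
      by rewrite !mulr_ge0 ?rnorm_ge0 ?invr_ge0 ?(ltW co0) ?(ltW cr0).
    apply: (ler_peMr nn).
    by rewrite -expR0 ler_expR mulr_ge0// ltW.
  have nn : 0 <= M * rnorm v by rewrite mulr_ge0 ?rnorm_ge0.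
  apply: ler_pM.
  + by rewrite mulr_ge0// divr_ge0 ?ltW.
  + by rewrite invr_ge0 ltW.
  + by apply: ler_wpM2l => //; rewrite ler_pdivrMr// mulrC ler_pdivlMr// mulrC.
  + rewrite lef_pV2 ?posrE// (le_trans _ mge)// ler_peMr ?(ltW cr0)// lerDl//.
Qed.

Definition upper_ray r v := ray_weight r *: L (lam (ray r om)) v.
Definition lower_ray r v := (ray_weight r)^* *: L (lam (ray r om))^* v.

Let upper_subexp : subexp_family upper_ray.
Proof.
apply: subexp_ray => //; first exact: (ray_continuous lam_cont).
exact: (ray_continuous weight_cont).
Qed.

Let lower_subexp : subexp_family lower_ray.
Proof.
apply: subexp_ray.
- move=> r r0 eps eps0; have [d d0 hd] := ray_continuous lam_cont r0 eps0.
  by exists d => // u ur; rewrite -rmorphB cmodJ; exact: hd.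
- move=> r r0 eps eps0; have [d d0 hd] := ray_continuous weight_cont r0 eps0.
  by exists d => // u ur; rewrite -rmorphB cmodJ; exact: hd.
- by move=> r _; rewrite cReJ.
- by move=> r _; rewrite cmodJ.
Qed.

Let half_i : R[i] := 0 +i* (- 2^-1).
Let cc : R[i] := pi^-1%:C * half_i.
Let Jp := laplace_op upper_ray 1 (edir om).
Let Jm := laplace_op lower_ray 1 (edir om)^*.

Let contour_ex z : exists F : {linear X -> X}, forall v, F v = cc *: (Jp z v - Jm z v).
Proof. exact: scaleB_linear. Qed.

(** (2 pi i)^-1 times the integral of e^(z mu) (lam/mu) L lam over the boundary of the
sector with vertex 1 and directions om and - om. *)
Definition contour_op (z : R[i]) : {linear X -> X} := sval (cid (contour_ex z)).

Let contourE z v : contour_op z v = cc *: (Jp z v - Jm z v).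
Proof. by rewrite /contour_op; case: cid. Qed.

Let op_scaleB_continuous (F : {linear X -> X}) (F1 F2 : X -> X) :
  continuous F1 -> continuous F2 -> (forall v, F v = cc *: (F1 v - F2 v)) -> continuous F.
Proof.
move=> c1 c2 FE.
have -> : (F : X -> X) = (fun v => cc *: (F1 v - F2 v)) by apply/funext.
by move=> v; apply: cvgZr; apply: cvgB; [exact: c1|exact: c2].
Qed.

Lemma contour_analytic (z : R[i]) : complex.Re (z * edir om) < 0 -> complex.Re (z * (edir om)^*) < 0 ->
  continuous (contour_op z) /\
  exists2 G : {linear X -> X}, continuous G & is_op_derive contour_op z G.
Proof.
move=> z1 z2.
have up' := subexp_affine 1 (edir om) upper_subexp.
have lo' := subexp_affine 1 (edir om)^* lower_subexp.
split.
  apply: op_scaleB_continuous (contourE z); exact: laplace_op_continuous.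
set G1 := laplace_op (fun u v => affine 1 (edir om) u *: upper_ray u v) 1 (edir om) z.
set G2 := laplace_op (fun u v => affine 1 (edir om)^* u *: lower_ray u v) 1 (edir om)^* z.
have [G GE] : exists G : {linear X -> X}, forall v, G v = cc *: (G1 v - G2 v).
  exact: scaleB_linear.
exists G; first by apply: op_scaleB_continuous GE; exact: laplace_op_continuous.
apply: op_derive_scaleB contourE GE _ _; exact: laplace_op_derive.
Qed.

Let cos_om : cos om < 0.
Proof. by apply: cos_obtuse_lt0; rewrite om_pi2 (lt_trans omom'). Qed.

(** At real times the two rays contribute conjugate scalars, which [pairing] merges. *)
Lemma contour_real (l : rfun X) (v : X) (t : R) : 0 < t ->
  l (contour_op t%:C v) = pi^-1 * ray_inversion (transfer l v) om t.
Proof.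
move=> t0.
have z1 : complex.Re (t%:C * edir om) < 0 by rewrite cRe_realM pmulr_rlt0.
have z2 : complex.Re (t%:C * (edir om)^*) < 0 by rewrite cRe_realM cReJ pmulr_rlt0.
have mRp : measurable Rp by exact: measurable_itv.
have w1 := laplace_opP 1 upper_subexp z1 v.
have w2 := laplace_opP 1 lower_subexp z2 v.
have [i e1] := wintZ half_i (wintB mRp w1 w2) l.
rewrite contourE /cc -scalerA rfZ e1 /ray_inversion; congr (_ * _).
apply: eq_Rintegral => r; rewrite inE => /Rpos_itv r0.
rewrite /= /laplace_kernel /upper_ray /lower_ray /ray_exponential.
have -> : cexp (t%:C * affine 1 (edir om)^* r) = (cexp (t%:C * ray r om))^*.
  have -> : t%:C * affine 1 (edir om)^* r = (t%:C * ray r om)^*.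
    apply: complex_eq; rewrite ?cReJ ?cImJ ?cRe_realM ?cIm_realM /affine rayE.
      by rewrite !cReD !cRe_realM cReJ.
    by rewrite !cImD !cIm_realM cImJ /=; ring.
  exact: cexpJ.
rewrite -[affine _ _ _]/(1 + r%:C * edir om) -rayE !scalerA -rmorphM -Im_pairing pairing_scale.
by rewrite /transfer /ray_weight /paired_laplace; congr complex.Im; ring.
Qed.

End transfer.

(** * The symbol, the kernel and the solution operator at real points *)
Section real_symbol.
Variables (R : realType) (m : nat) (c alpha : R) (cs alphas : 'I_m -> R).

(** The leading term has index 0, the others are shifted by one. *)
Definition symbol_coef (i : 'I_m.+1) : R := if unlift ord0 i is Some j then cs j else c.
Definition symbol_exp (i : 'I_m.+1) : R := if unlift ord0 i is Some j then alphas j else alpha.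

Lemma cpow_real (s a : R) : 0 < s -> cpow s%:C a = (s `^ a)%:C.
Proof.
move=> s0; have e : carg s%:C = 0.
  by rewrite /carg /= lexx cmod_real gtr0_norm// divff ?gt_eqF// acos1.
by rewrite /cpow e mulr0 cos0 sin0 cmod_real gtr0_norm// mulr1.
Qed.

Lemma symbol_real (s : R) : 0 < s ->
  symbol c alpha cs alphas s%:C = (gsym_real symbol_coef symbol_exp s)%:C.
Proof.
move=> s0; rewrite /symbol /gsym_real big_ord_recl /symbol_coef /symbol_exp unlift_none.
rewrite rmorphD rmorph_sum rmorphM cpow_real//; congr (_ + _).
by apply: eq_bigr => j _; rewrite liftK cpow_real// rmorphM.
Qed.

End real_symbol.

Section kernel.
Variables (R : realType) (g : R[i] -> R[i]) (k : R -> R).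
Notation mu := (@lebesgue_measure R).
Notation Rp := (`[0%R, +oo[%classic : set R).
Hypothesis hk : is_kernel g k.

Let mRp : measurable Rp. Proof. exact: measurable_itv. Qed.

(** Local integrability gives measurability on each [0, n]. *)
Lemma kernel_measurable : measurable_fun Rp k.
Proof.
have -> : Rp = \bigcup_n (`[0%R, n%:R]%classic : set R).
  apply/seteqP; split => t.
    move=> /Rpos_itv t0; exists (Num.truncn t).+1 => //=; rewrite in_itv /= t0 ltW//.
    exact: truncnS_gt.
  by move=> [n _] /=; rewrite !in_itv /= => /andP[->].
apply/measurable_fun_bigcup; first by move=> n; exact: measurable_itv.
by move=> n; exact: integrable_measurable (hk.1 n%:R).
Qed.

Definition re_functional : rfun R[i]^o.
Proof.
apply: (@RFun R R[i]^o (fun z : R[i] => complex.Re z) 1).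
- by move=> x y; rewrite cReD.
- by move=> r x; exact: cRe_realM.
- exact: ler01.
- by move=> x; rewrite mul1r; exact: Re_le_cmod.
Defined.

Lemma kernel_laplace (s w : R) : 0 < s -> g s%:C = w%:C ->
  mu.-integrable Rp (EFin \o (fun t => k t * expR (- (s * t)))) /\
  \int[mu]_(t in Rp) (k t * expR (- (s * t))) = w^-1.
Proof.
move=> s0 gs; have := hk.2 s%:C s0; rewrite /is_laplace gs => b.
have E t : (k t)%:C * cexp (- (s%:C * t%:C)) = (k t * expR (- (s * t)))%:C.
  by rewrite -rmorphM -rmorphN /= cexp_real -rmorphM.
have h := @bochner_wint R R[i]^o Rp _ _ mRp _ b.
have [] := h _ re_functional.
  move=> l; have -> : l \o (fun t => (k t)%:C * cexp (- (s%:C * t%:C)) : R[i]^o) =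
      (fun t => k t * expR (- (s * t)) * l (1 : R[i]^o)).
    apply/funext => t; rewrite /= -rfZ; congr (l _).
    by rewrite /GRing.scale /= mulr1; exact: E.
  apply: measurable_funM; last exact: measurable_cst.
  by apply: measurable_funM; [exact: kernel_measurable|exact: measurable_expRN].
have -> : re_functional \o (fun t => (k t)%:C * cexp (- (s%:C * t%:C)) : R[i]^o) =
    (fun t => k t * expR (- (s * t))).
  by apply/funext => t /=; exact: (congr1 (@complex.Re R) (E t)).
move=> i e; split => //.
transitivity (complex.Re (w%:C)^-1); last by rewrite -fmorphV.
by rewrite [RHS]e; apply: eq_Rintegral => t _; exact/esym/(congr1 (@complex.Re R) (E t)).
Qed.

End kernel.

Section resolvent_family.
Variables (R : realType) (X : completeNormedModType R[i]).
Notation mu := (@lebesgue_measure R).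
Notation Rp := (`[0%R, +oo[%classic : set R).
Variables (A : unbounded_operator X) (Cs : R -> {linear X -> X}) (M : R).
Hypotheses (hC : cosine_family A Cs) (M0 : 0 <= M).
Hypothesis CM : forall t v, 0 <= t -> rnorm (Cs t v) <= M * rnorm v.
Notation L := (cosine_laplace Cs).
Variables (g : R[i] -> R[i]) (k : R -> R) (S : R -> {linear X -> X}).
Hypotheses (hk : is_kernel g k) (hS : solution_operator A k S).
Variables (l : rfun X) (v : X).
Hypothesis Av : opdom A v.

Let S_strong (u : X) : {within Rp, continuous (fun t => S t u)}.
Proof. by case: (so_scf hS). Qed.

Let S_cont (f : rfun X) (u : X) : {within Rp, continuous (fun t => f (S t u))}.
Proof. by have cu := @S_strong u; move=> t; apply: rf_cvg; exact: cu. Qed.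

Let subS t : (`[0, t]%classic : set R) `<=` Rp.
Proof. by move=> x /=; rewrite !in_itv /= => /andP[->]. Qed.

Lemma solution_wint t : 0 <= t ->
  wint `[0, t] (fun tau => (k (t - tau))%:C *: A (S tau v)) (S t v - v).
Proof.
move=> t0; have mt : measurable (`[0, t]%classic : set R) by exact: measurable_itv.
apply: bochner_wint => //; last exact: (so_volterra hS).
move=> f.
have fE tau : (`[0, t]%classic : set R) tau ->
    k (t - tau) * f (S tau (A v)) = (f \o (fun tau => (k (t - tau))%:C *: A (S tau v))) tau.
  move=> /subS/Rpos_itv tau0 /=; rewrite rfZ; congr (_ * f _).
  by rewrite (cf_comm (so_comm hS)).
apply: eq_measurable_fun (fun tau ttau => fE tau (set_mem ttau)) _.
apply: measurable_funM.
  apply: (measurable_comp (F := Rp)) => //.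
  - by move=> _ [x /= + <-]; rewrite !in_itv /= => /andP[x0 xt]; rewrite subr_ge0 xt.
  - exact: (kernel_measurable hk).
  - by apply: measurable_funB.
apply: subspace_continuous_measurable_fun => //.
exact: continuous_subspaceW (@subS t) (@S_cont f (A v)).
Qed.

Lemma solution_bounded (T : R) (u : X) : exists2 N : R, 0 <= N &
  forall t, 0 <= t <= T -> rnorm (S t u) <= N.
Proof.
have c : {within `[0, T], continuous (fun t => rnorm (S t u))}.
  apply: continuous_subspaceW (@subS T) _; apply/within_contP => t Dt e e0.
  have /rwithin_contP/(_ t Dt e e0)[d d0 hd] := @S_strong u.
  by exists d => // r Dr rt; apply: le_lt_trans (hd r Dr rt); exact: rnorm_dist.
have [B [_ hB]] := compact_bounded (continuous_compact c (@segment_compact R 0 T)).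
exists (`|B| + 1) => [|t tT]; first by rewrite addr_ge0.
have Bl : B < `|B| + 1 by rewrite (le_lt_trans (ler_norm _))// ltrDl.
have := hB _ Bl (rnorm (S t u)).
rewrite /= ger0_norm ?rnorm_ge0//; apply; exists t => //=; rewrite in_itv/=.
Qed.

Variables (n : nat) (C e : 'I_n.+1 -> R) (alpha : R).
Hypotheses (C0 : forall i, 0 < C i) (e_bounds : forall i, 0 <= e i <= alpha) (alpha2 : alpha <= 2).
Hypothesis gE : forall s : R, 0 < s -> g s%:C = (gsym_real C e s)%:C.
Notation lam := (gsqrt_real C e).

Let lam_gt0 s : 0 < lam s. Proof. exact: expR_gt0. Qed.

Let L_bound s u : rnorm (L (lam s)%:C u) <= M / lam s * rnorm u.
Proof. by apply: (@cosine_laplace_bound _ _ _ _ _ hC CM M0 (lam s)%:C); exact: lam_gt0. Qed.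

Let MlM0 s : 0 <= M / lam s. Proof. by rewrite divr_ge0 ?(ltW (lam_gt0 s)). Qed.

Let L_add s x y : L (lam s)%:C (x + y) = L (lam s)%:C x + L (lam s)%:C y.
Proof. exact: linearD. Qed.

Let L_scale s (r : R) x : L (lam s)%:C (r%:C *: x) = r%:C *: L (lam s)%:C x.
Proof. exact: linearZ. Qed.

(** Testing with l after L lam makes the unbounded operator A disappear, because
L lam A = lam^2 L lam - lam. *)
Let lL s : rfun X := @rfun_comp R X X l (L (lam s)%:C) (M / lam s)
  (L_add s) (L_scale s) (MlM0 s) (L_bound s).

Let lLE s u : lL s u = l (L (lam s)%:C u). Proof. by []. Qed.

Let itv_int (T s : R) (f : R -> R) : {within Rp, continuous f} ->
  mu.-integrable `[0, T] (EFin \o (fun t => expR (- (s * t)) * f t)).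
Proof.
move=> cf; apply: continuous_compact_integrable; first exact: segment_compact.
apply: (@continuous_subspaceW _ _ _ _ _ (@subS T)) => t.
apply: cvgM; last exact: cf.
apply: continuous_subspaceT => r.
exact: is_derive_continuous.
Qed.

Let K := \int[mu]_(t in Rp) `|k t * expR (- t)|.
Let K0 : 0 <= K. Proof. by apply: Rintegral_ge0 => t _. Qed.

Let step (T N s : R) : 0 < T -> 1 <= s ->
  (forall t, 0 <= t <= T -> rnorm (S t v) <= N) ->
  `|\int[mu]_(t in `[0, T]) (expR (- (s * t)) * l (S t v)) -
     lam s / s * l (L (lam s)%:C v)| <=
  lam s * (K * (lam s * (M + 1) * rf_norm l * N) * T * expR (- ((s - 1) * T))) +
  rf_norm l * M * rnorm v / s * expR (- (s * T)).
Proof.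
move=> T0 s1 SN; have s0 : 0 < s by rewrite (lt_le_trans ltr01).
have ls := lam_gt0 s.
have mT : measurable (`[0, T]%classic : set R) by exact: measurable_itv.
pose q t := l (S t v).
pose Q t := lL s (S t v).
pose mm tau := lam s ^+ 2 * Q tau - lam s * q tau.
pose p t := Q t - lL s v.
have cq : {within Rp, continuous q} by exact: S_cont.
have cQ : {within Rp, continuous Q} by exact: S_cont.
have cm : {within Rp, continuous mm}.
  by move=> t; apply: cvgB; apply: cvgM; try exact: cvg_cst; [exact: cQ|exact: cq].
have mmE tau : 0 <= tau -> mm tau = lL s (A (S tau v)).
  move=> tau0; have := cosine_resolvent hC CM M0 ls (cf_dom (so_comm hS) tau0 Av).
  move=> /(congr1 l); rewrite rfB !rfZ => h.
  by rewrite /mm /Q /q -h !lLE; ring.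
have ik : mu.-integrable Rp (EFin \o (fun t => k t * expR (- t))).
  have [i _] := kernel_laplace hk ltr01 (gE ltr01).
  by apply: eq_integrable i => // t _ /=; rewrite mul1r.
have mE (t : R) tau : (`[0, t]%classic : set R) tau ->
    k (t - tau) * mm tau = lL s ((k (t - tau))%:C *: A (S tau v)).
  by move=> /subS/Rpos_itv tau0; rewrite rfZ mmE.
have im t : 0 <= t -> mu.-integrable `[0, t] (EFin \o (fun tau => k (t - tau) * mm tau)).
  move=> t0; have [i _] := solution_wint t0 (lL s).
  apply: eq_integrable i; first exact: measurable_itv.
  by move=> tau /set_mem/mE h /=; rewrite h.
have pE t : 0 <= t -> p t = \int[mu]_(tau in `[0, t]) (k (t - tau) * mm tau).
  move=> t0; have [_ h] := solution_wint t0 (lL s).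
  by rewrite /p /Q -rfB h; apply: eq_Rintegral => tau /set_mem/mE <-.
have mN t : 0 <= t <= T -> `|mm t| <= lam s * (M + 1) * rf_norm l * N.
  move=> tT; have N0 := SN t tT.
  have b1 : `|Q t| <= rf_norm l * (M / lam s * N).
    rewrite /Q lLE; apply: (le_trans (rf_bound _ _)); apply: ler_wpM2l; first exact: rf_norm_ge0.
    by apply: (le_trans (L_bound _ _)); exact: (ler_wpM2l (MlM0 s)).
  have b2 : `|q t| <= rf_norm l * N.
    by apply: (le_trans (rf_bound _ _)); apply: ler_wpM2l => //; exact: rf_norm_ge0.
  rewrite /mm (le_trans (ler_normB _ _))//.
  rewrite (normrM (lam s ^+ 2)) (normrM (lam s) (q t)) (ger0_norm (sqr_ge0 _)) (gtr0_norm ls).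
  have -> : lam s * (M + 1) * rf_norm l * N =
    lam s ^+ 2 * (rf_norm l * (M / lam s * N)) + lam s * (rf_norm l * N).
    by field; rewrite gt_eqF.
  by apply: lerD; apply: ler_wpM2l => //; [exact: sqr_ge0|exact: ltW].
have := volterra_laplace T0 s1 ik cm mN im pE.
have [_ ->] := kernel_laplace hk s0 (gE s0).
rewrite -/K -(gsqrt_real_sqr e C0 s0).
have iq := itv_int T s cq; have iQ := itv_int T s cQ.
have ie : mu.-integrable `[0, T] (EFin \o (fun t => expR (- (s * t)))).
  have := itv_int T s (f := fun=> 1); rewrite (_ : (fun t => _ * 1) = (fun t => expR (- (s * t)))).
    by apply; move=> t; exact: cvg_cst.
  by apply/funext => t; rewrite mulr1.
have -> : \int[mu]_(t in `[0, T]) (expR (- (s * t)) * p t) =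
    \int[mu]_(t in `[0, T]) (expR (- (s * t)) * Q t) - lL s v * ((1 - expR (- (s * T))) / s).
  have <- : \int[mu]_(t in `[0, T]) expR (- (s * t)) = (1 - expR (- (s * T))) / s.
    have dF (t : R) : 0 <= t -> is_derive t 1 (fun t => - s^-1 * expR (- (s * t))) (expR (- (s * t))).
      by move=> _; apply: is_derive_eq; rewrite /GRing.scale /=; field; rewrite gt_eqF.
    rewrite (Rintegral_FTC T0 dF); last first.
      by apply: continuous_subspaceT => t; exact: is_derive_continuous.
    by rewrite mulr0 oppr0 expR0; field; rewrite gt_eqF.
  rewrite -RintegralZl// -RintegralB//; last exact: RintegrableZ.
  by apply: eq_Rintegral => t _; rewrite /p; ring.
have -> : \int[mu]_(t in `[0, T]) (expR (- (s * t)) * mm t) =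
    lam s ^+ 2 * \int[mu]_(t in `[0, T]) (expR (- (s * t)) * Q t) -
    lam s * \int[mu]_(t in `[0, T]) (expR (- (s * t)) * q t).
  rewrite -!RintegralZl// -RintegralB//; try exact: RintegrableZ.
  by apply: eq_Rintegral => t _; rewrite /mm; ring.
rewrite -/q -lLE.
move: (\int[mu]_(t in `[0, T]) (expR (- (s * t)) * Q t)) => IQ.
move: (\int[mu]_(t in `[0, T]) (expR (- (s * t)) * q t)) => Iq.
set E := expR (- (s * T)); set lv := lL s v; set B := K * _ * _ * _ => h.
have -> : Iq - lam s / s * lv =
  lam s * (IQ - lv * ((1 - E) / s) - (lam s ^+ 2)^-1 * (lam s ^+ 2 * IQ - lam s * Iq)) -
  lam s * lv / s * E by field; rewrite !gt_eqF.
apply: (le_trans (ler_normB _ _)); apply: lerD.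
  by rewrite normrM gtr0_norm//; apply: ler_wpM2l h; exact: ltW.
rewrite normrM (ger0_norm (expR_ge0 _)); apply: ler_wpM2r; first exact: expR_ge0.
rewrite (normrM _ s^-1) (normrM (lam s)) normfV (gtr0_norm ls) (gtr0_norm s0); apply: ler_wpM2r; first by rewrite invr_ge0 ltW.
rewrite mulrC -ler_pdivlMr//.
have -> : rf_norm l * M * rnorm v / lam s = rf_norm l * (M / lam s) * rnorm v by ring.
exact: (rf_bound (lL s) v).
Qed.

(** The Volterra equation tested with l and L lam reads p = k * m with
p = l (L lam S v) - l (L lam v) and m = lam^2 l (L lam S v) - lam l (S v); the
transform of k is 1/lam^2, so the unknown transform of l (L lam S v) cancels and
that of l (S v) remains. *)
Lemma solution_laplace (T : R) : 0 < T -> exists2 B : R, 0 <= B & forall s, 1 <= s ->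
  `|\int[mu]_(t in `[0, T]) (expR (- (s * t)) * l (S t v)) -
     lam s / s * l (L (lam s)%:C v)| <= B * s ^+ 2 * expR (- (s * T)).
Proof.
move=> T0; have [N N0 SN] := solution_bounded T v.
pose G := 1 + \sum_i C i.
have G0 : 0 <= G by rewrite addr_ge0// sumr_ge0// => i _; exact: ltW.
pose B1 := G ^+ 2 * (K * ((M + 1) * rf_norm l * N) * T * expR T).
have B10 : 0 <= B1.
  by rewrite mulr_ge0 ?sqr_ge0// !mulr_ge0 ?rf_norm_ge0 ?expR_ge0 ?addr_ge0// ltW.
pose B2 := rf_norm l * M * rnorm v.
have B20 : 0 <= B2 by rewrite !mulr_ge0 ?rf_norm_ge0 ?rnorm_ge0.
exists (B1 + B2); first by rewrite addr_ge0.
move=> s s1; have s0 : 0 < s by rewrite (lt_le_trans ltr01).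
apply: (le_trans (step T0 s1 SN)); rewrite [(B1 + B2) * _]mulrDl [leRHS]mulrDl; apply: lerD.
  have -> : expR (- ((s - 1) * T)) = expR T * expR (- (s * T)).
    by rewrite -expRD; congr expR; ring.
  have -> : lam s * (K * (lam s * (M + 1) * rf_norm l * N) * T * (expR T * expR (- (s * T)))) =
    lam s ^+ 2 * (K * ((M + 1) * rf_norm l * N) * T * expR T) * expR (- (s * T)) by ring.
  apply: ler_wpM2r; first exact: expR_ge0.
  rewrite /B1 [leRHS]mulrAC; apply: ler_wpM2r.
    by rewrite !mulr_ge0 ?rf_norm_ge0 ?expR_ge0 ?addr_ge0// ltW.
  have l0 : 0 <= lam s by rewrite ltW.
  rewrite -exprMn ler_pXn2r ?nnegrE ?l0 ?mulr_ge0 ?(ltW s0)//.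
  exact: (gsqrt_real_le C0 e_bounds s1 alpha2).
apply: ler_wpM2r; first exact: expR_ge0.
apply: ler_wpM2l => //; rewrite (@le_trans _ _ 1) ?invf_le1//.
by rewrite (le_trans s1)// expr2 ler_peMr// ltW.
Qed.

End resolvent_family.

Lemma integrable_oc_cc (R : realType) (T : R) (f : R -> R) : 0 < T ->
  (@lebesgue_measure R).-integrable `]0, T] (EFin \o f) ->
  (@lebesgue_measure R).-integrable `[0, T] (EFin \o f).
Proof.
move=> T0 jf; pose I : set R := `[0, T]%classic.
have mI : measurable I by exact: measurable_itv.
have mJ : measurable (`]0, T]%classic : set R) by exact: measurable_itv.
have m0 : measurable [set (0 : R)] by exact: measurable_set1.
have i1 : (@lebesgue_measure R).-integrable I (EFin \o (fun t => \1_(`]0, T]%classic : set R) t * f t)).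
  by apply: (integrableS _ _ _ (integrable_indicM mJ jf)).
have i2 : (@lebesgue_measure R).-integrable I (EFin \o (fun t => \1_[set (0 : R)] t * f 0)).
  by apply: (integrableS _ _ _ (integrable_indicM m0 _)) => //;
    apply: (integrableS _ _ _ (integrable_itv_cst 0 0 (f 0))) => // t ->; rewrite /= in_itv /= lexx.
apply: eq_integrable (RintegrableD mI i1 i2) => // t; rewrite inE /I /= in_itv /= => /andP[t0 tT].
rewrite !indicE; have [->|tn0] := eqVneq t 0.
  by rewrite memNset ?mem_set// ?mul0r ?add0r ?mul1r//= in_itv /= ltxx.
rewrite mem_set ?memNset ?mul0r ?addr0 ?mul1r//=; first exact/eqP.
by rewrite in_itv /= lt_neqAle eq_sym tn0 t0.
Qed.

(** * Conclusion *)

(** With z = |z| e^(i phi) this says sin (th - |phi|) > 0; it keeps z e^(i om) and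
z e^(- i om) in the left half-plane for om = pi/2 + th. *)
Lemma sector_halfplane (R : realType) (th : R) (z : R[i]) : 0 < th < pi / 2 -> sector th z ->
  `|complex.Im z| * cos th < complex.Re z * sin th.
Proof.
move=> /andP[th0 thp] [z0 zth].
have c0 : 0 < cmod z by rewrite cmod_gt0.
pose x := complex.Re z / cmod z.
have x1 : -1 <= x <= 1.
  by rewrite -ler_norml normrM normfV (gtr0_norm c0) ler_pdivrMr// mul1r Re_le_cmod.
have ax0 : 0 <= acos x by exact: acos_ge0.
have zth' : acos x < th.
  apply: le_lt_trans zth; rewrite /carg -/x; case: ifP => _.
    by rewrite ler_norm.
  by rewrite normrN ler_norm.
have cx : cos (acos x) = x by exact: acosK.
have sx : sin (acos x) = `|complex.Im z| / cmod z.
  rewrite sin_acos//; apply/eqP; rewrite -(eqrXn2 (n := 2))// ?sqrtr_ge0 ?divr_ge0 ?cmod_ge0//.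
  rewrite sqr_sqrtr; last by rewrite subr_ge0 -real_normK ?num_real// expr_le1// ler_norml.
  rewrite [(`|_| / _) ^+ 2]expr_div_n real_normK ?num_real// /x expr_div_n; apply/eqP.
  have := sqr_cmod z => e; rewrite -(divff (x := cmod z ^+ 2)) ?expf_neq0 ?gt_eqF//.
  by rewrite -mulrBl; congr (_ / _); rewrite e; ring.
have s0 : 0 < sin (th - acos x).
  by apply: sin_gt0_pi; move: (pi_gt0 R) => *; apply/andP; split; lra.
move: s0; rewrite sinB cx sx -subr_gt0.
have -> : sin th * x - cos th * (`|complex.Im z| / cmod z) =
  (complex.Re z * sin th - `|complex.Im z| * cos th) / cmod z by rewrite /x; ring.
by rewrite subr0 pmulr_lgt0 ?invr_gt0// !subr_gt0.
Qed.

Section contour_solution.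
Variables (R : realType) (X : completeNormedModType R[i]).
Notation mu := (@lebesgue_measure R).
Notation Rp := (`[0%R, +oo[%classic : set R).
Variables (A : unbounded_operator X) (Cs : R -> {linear X -> X}) (M : R).
Hypotheses (hC : cosine_family A Cs) (M0 : 0 <= M).
Hypothesis CM : forall t v, 0 <= t -> rnorm (Cs t v) <= M * rnorm v.
Variables (g : R[i] -> R[i]) (k : R -> R) (S : R -> {linear X -> X}).
Hypotheses (hk : is_kernel g k) (hS : solution_operator A k S).
Variables (n : nat) (C e : 'I_n.+1 -> R) (alpha om om' : R).
Hypotheses (C0 : forall i, 0 < C i) (e_bounds : forall i, 0 <= e i <= alpha).
Hypotheses (alpha1 : 1 < alpha) (alpha2 : alpha <= 2).
Hypothesis gE : forall s : R, 0 < s -> g s%:C = (gsym_real C e s)%:C.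
Hypotheses (om_pi2 : pi / 2 < om) (omom' : om < om') (aom' : alpha * om' < pi).
Notation F := (contour_op Cs C e om).

Let om0 : 0 < om. Proof. by move: (pi_gt0 R) om_pi2 => *; lra. Qed.
Let om'0 : 0 < om'. Proof. exact: lt_trans omom'. Qed.
Let om'pi : om' < pi.
Proof. by apply: lt_trans aom'; rewrite ltr_pMl. Qed.

Let cos_om : cos om < 0.
Proof. by apply: cos_obtuse_lt0; rewrite om_pi2 (lt_trans omom'). Qed.

Let F_analytic (t : R) : 0 < t -> continuous (F t%:C) /\
  exists2 G : {linear X -> X}, continuous G & is_op_derive F t%:C G.
Proof.
move=> t0; apply: (contour_analytic hC M0 CM C0 e_bounds alpha1 om'0 aom' om_pi2 omom').
  by rewrite cRe_realM pmulr_rlt0.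
by rewrite cRe_realM cReJ pmulr_rlt0.
Qed.

(** The difference of the two sides, tested with a functional, is continuous for t > 0
and both sides have the same truncated Laplace transform up to O(s^2 e^(-s T)). *)
Lemma contour_solution_on_domain v (t : R) : opdom A v -> 0 < t -> F t%:C v = S t v.
Proof.
move=> Av t0; apply: rf_eq => l; apply/esym/eqP; rewrite -subr_eq0; apply/eqP.
pose T := t + 1; have T0 : 0 < T by rewrite addr_gt0.
have tT : 0 < t < T by rewrite t0 /= /T ltrDl.
pose h := transfer Cs C e l v.
pose Ch := rf_norm l * (2 * (M * rnorm v)) / (cos (alpha * om' / 2) * cos (om' / 2)).
have Ch0 : 0 <= Ch.
  rewrite divr_ge0 ?mulr_ge0 ?rf_norm_ge0 ?rnorm_ge0//; apply: cos_ge0_pihalf.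
    have aom0 : 0 < alpha * om' by rewrite mulr_gt0// (lt_trans ltr01).
    by move: aom' aom0 => *; apply/andP; split; lra.
  by move: om'0 om'pi => *; apply/andP; split; lra.
have hC1 (r th : R) : 0 <= r -> 0 <= th < om' -> C1at h (ray r th).
  exact: (transfer_C1 hC M0 CM C0 e_bounds alpha1 om'0 aom').
have hb (r th : R) : 0 <= r -> 0 <= th < om' -> cmod (h (ray r th)) <= Ch / (1 + r).
  exact: (transfer_bound hC M0 CM C0 e_bounds alpha1 om'0 aom').
have hreal (r : R) : 0 <= r -> complex.Im (h (1 + r)%:C) = 0.
  by move=> r0; rewrite /h (transfer_real Cs e C0)// ltr_pwDl.
pose Psi := ray_inversion h om.
have iPsi : mu.-integrable `[0, T] (EFin \o Psi).
  apply: integrable_oc_cc => //.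
  exact: (ray_inversion_integrable om'pi Ch0 hC1 hb om_pi2 omom' T0).
have PsiE (r : R) : 0 < r -> l (F r%:C v) = pi^-1 * Psi r.
  exact: (contour_real hC M0 CM C0 e_bounds alpha1 om'0 aom' om_pi2 omom').
pose d r := l (S r v) - pi^-1 * Psi r.
rewrite PsiE// -/(d t).
have cS : {within Rp, continuous (fun r => l (S r v))}.
  have cu : {within Rp, continuous (fun r => S r v)} by case: (so_scf hS).
  by move=> r; apply: rf_cvg; exact: cu.
have sub : `[0, T] `<=` Rp by move=> r /=; rewrite !in_itv /= => /andP[->].
have mT : measurable (`[0, T]%classic : set R) by exact: measurable_itv.
have iS : mu.-integrable `[0, T] (EFin \o (fun r => l (S r v))).
  apply: continuous_compact_integrable; first exact: (@segment_compact R 0 T).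
  exact: continuous_subspaceW sub cS.
have jd : mu.-integrable `[0, T] (EFin \o d).
  apply: eq_integrable (RintegrableD mT iS (RintegrableZ (- pi^-1) mT iPsi)) => // r _ /=.
  by rewrite /d mulNr.
have [B B0 hB] := solution_laplace hC M0 CM hk hS l Av C0 e_bounds alpha2 gE T0.
pose B' := pi^-1 * (Ch / sin (om / 2) * expR T).
have so0 : 0 < sin (om / 2).
  by apply: sin_gt0_pi; move: om0 omom' om'pi => *; apply/andP; split; lra.
have B'0 : 0 <= B'.
  by rewrite /B' mulr_ge0 ?invr_ge0 ?pi_ge0// mulr_ge0 ?expR_ge0// divr_ge0// ltW.
have e_int (s : R) (f : R -> R) : mu.-integrable `[0, T] (EFin \o f) -> 0 <= s ->
    mu.-integrable `[0, T] (EFin \o (fun r => expR (- (s * r)) * f r)).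
  move=> jf s0; apply: (dominated_integrable (g := fun r => `|f r|)) => //.
  - by apply: measurable_funM; [exact: measurable_expRN|exact: integrable_measurable jf].
  - exact: integrable_norm.
  - move=> r; rewrite /= in_itv /= => /andP[r0 _].
    by rewrite normrM ger0_norm ?expR_ge0// ler_piMl// expRN_le1// mulr_ge0.
apply: (laplace_uniqueness (T := T) (C := B + B') (s0 := 2)) => //.
- by rewrite addr_ge0.
- move=> s s2; have s1 : 1 <= s by move: s2; lra.
  have s0 : 0 < s by move: s2; lra.
  have i1 := e_int s _ iS (ltW s0); have i2 := e_int s _ iPsi (ltW s0).
  have -> : \int[mu]_(r in `[0, T]) (expR (- (s * r)) * d r) =
      \int[mu]_(r in `[0, T]) (expR (- (s * r)) * l (S r v)) -
      pi^-1 * \int[mu]_(r in `[0, T]) (expR (- (s * r)) * Psi r).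
    rewrite -RintegralZl// -RintegralB//; last exact: RintegrableZ.
    by apply: eq_Rintegral => r _; rewrite /d; ring.
  have b1 := hB s s1.
  have := ray_inversion_laplace om'pi Ch0 hC1 hb hreal om_pi2 omom' T0 s2.
  rewrite -/Psi [\int[mu]_(r in `]0, T]) _]Rintegral_itv_obnd_cbnd; last first.
    by apply: (integrableS _ _ _ i2); try exact: measurable_itv; exact: subset_itv_oc_cc.
  rewrite /h (transfer_real Cs e C0)// [complex.Re _]/=.
  move: b1.
  set IS := \int[mu]_(r in _) _; set IP := \int[mu]_(r in _) _.
  set y := gsqrt_real C e s / s * _ => b1 b2.
  have -> : IS - pi^-1 * IP = (IS - y) - pi^-1 * (IP - pi * y).
    have pn : pi != 0 :> R by rewrite gt_eqF// pi_gt0.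
    by move: (pi : R) pn => P Pn; field.
  rewrite (le_trans (ler_normB _ _))// [X in _ <= X * _]mulrDl [leRHS]mulrDl.
  apply: lerD b1 _; rewrite normrM ger0_norm ?invr_ge0 ?pi_ge0//.
  have pi0 : 0 <= pi^-1 :> R by rewrite invr_ge0 pi_ge0.
  apply: (le_trans (ler_wpM2l pi0 b2)).
  have -> : expR ((1 - s) * T) = expR T * expR (- (s * T)).
    by rewrite -expRD; congr expR; ring.
  have -> : pi^-1 * (Ch / sin (om / 2) * (expR T * expR (- (s * T)))) = B' * expR (- (s * T)).
    by rewrite /B' !mulrA.
  apply: ler_wpM2r; first exact: expR_ge0.
  by rewrite ler_peMr// expr2 (le_trans s1)// ler_peMr// ltW.
- move=> r /andP[r0 rT].
  have cl : {for r, continuous (fun x => l (S x v))}.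
    apply/cvgrPdist_lt => eps eps0.
    have /within_contP/(_ r _ eps eps0)[|del del0 hdel] := cS; first exact/Rpos_itv/ltW.
    exists (Num.min del r); first by rewrite /= lt_min del0.
    move=> x /=; rewrite lt_min => /andP[x1 x2]; rewrite distrC; apply: hdel; last by rewrite distrC.
    by apply/Rpos_itv; move: x2; rewrite ltr_norml => /andP[_]; lra.
  have cF : {for r, continuous (fun x : R => l (F x%:C v))}.
    have [_ [G _ dF]] := F_analytic r0.
    apply/cvgrPdist_lt => eps eps0.
    have K0 : 0 < rf_norm l + 1 by rewrite ltr_wpDl ?rf_norm_ge0.
    have [del del0 hdel] := op_derive_continuous v dF (divr_gt0 eps0 K0).
    exists del => //= x xr; rewrite -rfB (le_lt_trans (rf_bound _ _))//.
    rewrite rnormC; have := hdel x%:C; rewrite -rmorphB cmod_real distrC => /(_ xr) b.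
    rewrite (le_lt_trans (y := (rf_norm l + 1) * rnorm (F x%:C v - F r%:C v)))//.
      by rewrite ler_wpM2r ?rnorm_ge0// lerDl.
    by rewrite mulrC -ltr_pdivlMr.
  have cd : {for r, continuous (fun x : R => l (S x v) - l (F x%:C v))}.
    by apply: cvgB; [exact: cl|exact: cF].
  have ne : nbhs r [set x : R | d x = l (S x v) - l (F x%:C v)].
    exists r => //= x xr; have {}xr : `|r - x| < r := xr.
    by rewrite /= /d PsiE//; move: xr; rewrite ltr_norml => /andP[_]; lra.
  have dr := nbhs_singleton ne.
  apply/cvgrPdist_lt => eps eps0; rewrite dr.
  move/cvgrPdist_lt: cd => /(_ eps eps0); apply: filterS2 ne => x -> //.
Qed.

Hypothesis hA_dense : densely_defined A.

Lemma contour_solution v (t : R) : 0 < t -> F t%:C v = S t v.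
Proof.
move=> t0; apply: contrapT => ne.
pose O : set X := [set w | F t%:C w - S t w != 0].
have cF : continuous (F t%:C) by have [] := F_analytic t0.
have cS : continuous (S t) by apply: (scf_bounded (so_scf hS)); exact: ltW.
have oO : open O.
  have cD : continuous (fun w => F t%:C w - S t w).
    by move=> w; apply: cvgB; [exact: cF|exact: cS].
  have -> : O = (fun w => F t%:C w - S t w) @^-1` [set~ 0].
    by apply/seteqP; split => w /=; [move=> /eqP|move=> h; apply/eqP].
  apply: open_comp; first by move=> w _; exact: cD.
  by apply: closed_openC; exact: (accessible_closed_set1 (hausdorff_accessible (@norm_hausdorff _ X))).
have [w [Ow Aw]] : O `&` opdom A !=set0.
  by apply: hA_dense => //; exists v; rewrite /O /= subr_eq0; apply/eqP.
by move: Ow; rewrite /O /= contour_solution_on_domain// subrr eqxx.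
Qed.

End contour_solution.

Theorem theorem3p4 (R : realType) (X : completeNormedModType R[i])
  (alpha : R) (halpha1 : 1 < alpha) (halpha2 : alpha < 2)
  (m : nat) (alphas : 'I_m -> R)
  (halphas_lt : forall j, alphas j < alpha)
  (halphas_decr : forall i j : 'I_m, (i < j)%N -> alphas j < alphas i)
  (halphas_gt0 : forall j, 0 < alphas j)
  (halphas_last : forall j : 'I_m, j.+1 = m -> alpha - alphas j <= 1)
  (c : R) (hc : 0 < c) (cs : 'I_m -> R) (hcs : forall j, 0 < cs j)
  (A : unbounded_operator X)
  (hA_closed : closed_operator A) (hA_dense : densely_defined A)
  (hA_cos : generates_bounded_cosine_family A)
  (k : R -> R) (hk : is_kernel (symbol c alpha cs alphas) k)
  (S : R -> {linear X -> X}) (hS : solution_operator A k S)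
  (eps : R) (heps : 0 < eps)
  (htheta0 : 0 < (2 - alpha) * pi / (2 * alpha) - eps) :
  admits_analytic_extension S
    (sector ((2 - alpha) * pi / (2 * alpha) - eps)).
Proof.
have [Cs [hC [M hM]]] := hA_cos.
have al0 : 0 < alpha by rewrite (lt_trans ltr01).
(* A bound of the cosine family may be negative when X = 0. *)
pose M' := Num.max M 0.
have M'0 : 0 <= M' by rewrite le_max lexx orbT.
have CM t v : 0 <= t -> rnorm (Cs t v) <= M' * rnorm v.
  by move=> t0; rewrite (le_trans (hM t v t0))// ler_wpM2r ?rnorm_ge0// le_max lexx.
have C0 i : 0 < symbol_coef c cs i by rewrite /symbol_coef; case: unlift.
have e_bounds i : 0 <= symbol_exp alpha alphas i <= alpha.
  rewrite /symbol_exp; case: unlift => [j|]; last by rewrite lexx ltW.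
  by rewrite !ltW.
have gE s : 0 < s -> symbol c alpha cs alphas s%:C =
    (gsym_real (symbol_coef c cs) (symbol_exp alpha alphas) s)%:C by exact: symbol_real.
set th := (2 - alpha) * pi / (2 * alpha) - eps in htheta0 *.
have thE : pi / 2 + th = pi / alpha - eps.
  by rewrite /th; move: (pi : R) => p; field; rewrite gt_eqF.
(* om is the direction of the rays; the wider om' keeps them inside the region where
   the symbol and its square root are controlled, and still alpha * om' < pi. *)
pose om := pi / 2 + th; pose om' := om + eps / 2.
have om_pi2 : pi / 2 < om by rewrite ltrDl.
have omom' : om < om' by rewrite ltrDl divr_gt0.
have aom' : alpha * om' < pi.
  have -> : alpha * om' = pi - alpha * eps / 2.
    by rewrite /om' /om thE; move: (pi : R) => p; field; rewrite gt_eqF.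
  by rewrite gtrDl oppr_lt0 divr_gt0// mulr_gt0.
have thp : th < pi / 2.
  have h : pi / alpha < pi by rewrite gtr_pMr ?pi_gt0// invf_lt1.
  by move: thE h heps; lra.
exists (contour_op Cs (symbol_coef c cs) (symbol_exp alpha alphas) om).
  move=> z /(sector_halfplane (introT andP (conj htheta0 thp))) hz.
  have [co so] : cos om = - sin th /\ sin om = cos th.
    by split; rewrite /om addrC ?cosDpihalf ?sinDpihalf.
  have om'0 : 0 < om' by move: (pi_gt0 R) om_pi2 omom' => *; lra.
  have c0 : 0 <= cos th.
    by apply: cos_ge0_pihalf; move: htheta0 thp => *; apply/andP; split; lra.
  have hi := ler_wpM2r c0 (ler_norm (complex.Im z)).
  have hi' : - complex.Im z * cos th <= `|complex.Im z| * cos th.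
    by rewrite ler_wpM2r// -normrN ler_norm.
  apply: (contour_analytic hC M'0 CM C0 e_bounds halpha1 om'0 aom' om_pi2 omom').
    by rewrite cReM /= co so; move: hz hi hi'; lra.
  by rewrite cReM cReJ cImJ /= co so; move: hz hi hi'; lra.
move=> t v t0.
exact: (contour_solution hC M'0 CM hk hS C0 e_bounds halpha1 (ltW halpha2) gE om_pi2 omom' aom').
Qed.
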